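(* Let $q,k\in\mathbb N$, $m\in\mathbb N_*=\{1,2,\dots\}$ and $e\in\mathcal E$. If $\mu\in\mathcal S_{q,k,m,e}$, then $\mu$ is absolutely continuous with respect to Lebesgue measure and its density $p_\mu$ belongs to $W^{q,e}$ (for $q=0$: $p_\mu\in L^e$). Moreover there is a constant $C$ (depending only on $q,k,m,d,e$) such that for every $\mu\in\mathcal S_{q,k,m,e}$, $$\|p_\mu\|_{q,(e)}\le C\,\rho_{q,k,m,e}(\mu).$$
   Context: A Young function is a function $e:\mathbb R\to\mathbb R_+$ which is symmetric, strictly convex, nonnegative, with $e(0)=0$. $\mathcal E$ denotes the set of Young functions such that (i) there is $\lambda>0$ with $e(2s)\le\lambda e(s)$ for all $s$; (ii) $s\mapsto e(s)/s$ is nondecreasing on $(0,\infty)$. For measurable $f:\mathbb R^d\to\mathbb R$, $\|f\|_{(e)}=\inf\{c>0:\int e(f(x)/c)\,dx\le 1\}$ and $L^e=\{f:\|f\|_{(e)}<\infty\}$. Set $e^{-1}(a)=\sup\{c:e(c)\le a\}$ and $\beta_e(R)=R/e^{-1}(R)$. For multi-indices $\alpha,\gamma\in\mathbb N^d$, $\partial_\alpha=\partial_{x_1}^{\alpha_1}\cdots\partial_{x_d}^{\alpha_d}$, $|\alpha|=\sum\alpha_i$, $x^\gamma=\prod_i x_i^{\gamma_i}$. Norms: $\|f\|_{k,(e)}=\sum_{|\alpha|\le k}\|\partial_\alpha f\|_{(e)}$, $W^{k,e}=\{f:\|f\|_{k,(e)}<\infty\}$; $\|f\|_{k,l,(e)}=\sum_{|\gamma|\le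 l}\sum_{|\alpha|\le k}\|x^\gamma\partial_\alpha f\|_{(e)}$, $W^{k,l,e}=\{f:\|f\|_{k,l,(e)}<\infty\}$; $\|\phi\|_{k,\infty}=\sum_{|\alpha|\le k}\sup_x|\partial_\alpha\phi(x)|$. $\mathcal M$ is the set of finite signed Borel measures on $\mathbb R^d$, $\mathcal M_a\subset\mathcal M$ those absolutely continuous w.r.t. Lebesgue measure, with density $p_\mu$. For $\mu,\nu\in\mathcal M$, $d_k(\mu,\nu)=\sup\{|\int\phi\,d\mu-\int\phi\,d\nu|:\phi\in C^\infty(\mathbb R^d),\|\phi\|_{k,\infty}\le 1\}$. For $\mu\in\mathcal M$ and a sequence $(\mu_n)_{n\in\mathbb N}\subset\mathcal M_a$, $$\pi_{q,k,m,e}(\mu,(\mu_n)_n)=\sum_{n=0}^\infty 2^{n(q+k)}\beta_e(2^{nd})\,d_k(\mu,\mu_n)+\sum_{n=0}^\infty 2^{-2nm}\|p_{\mu_n}\|_{2m+q,2m,(e)},$$ $\rho_{q,k,m,e}(\mu)=\inf\pi_{q,k,m,e}(\mu,(\mu_n)_n)$ over all sequences in $\mathcal M_a$, and $\mathcal S_{q,k,m,e}=\{\mu\in\mathcal M:\rho_{q,k,m,e}(\mu)<\infty\}$. *)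

(* Defs.v *)
From HB Require Import structures.
From mathcomp Require Import all_boot all_order all_algebra.
From mathcomp Require Import all_classical all_reals all_analysis.

Set Implicit Arguments.
Unset Strict Implicit.
Unset Printing Implicit Defensive.

Import Order.TTheory GRing.Theory Num.Theory.
Import numFieldNormedType.Exports.

Local Open Scope classical_set_scope.
Local Open Scope ring_scope.

Section Defs.
Variables (R : realType) (d : nat).

Definition Rd := 'rV[R]_d.

Definition BorelRd := g_sigma_algebraType (@open Rd).

Definition evec (i : 'I_d) : Rd := delta_mx 0 i.

Definition setcoord (x : Rd) (i : 'I_d) (t : R) : Rd :=
  \row_j (if j == i then t else x 0 j).

(* Iterated one-dimensional Lebesgue integrals over the coordinates listed
   in s (by Tonelli this is the d-dimensional Lebesgue integral of a
   nonnegative Borel function). *)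
Fixpoint iter_lint (s : seq 'I_d) (f : Rd -> \bar R) (x : Rd) : \bar R :=
  match s with
  | [::] => f x
  | i :: s' => (\int[@lebesgue_measure R]_(t in [set: R])
                  iter_lint s' f (setcoord x i t))%E
  end.

Definition lint (f : Rd -> \bar R) : \bar R := iter_lint (enum 'I_d) f 0.

Definition lintR (f : Rd -> R) : \bar R :=
  (lint (fun x => (Num.max (f x) 0)%:E) - lint (fun x => (Num.max (- f x) 0)%:E))%E.

Definition borel_measurable (f : Rd -> R) : Prop :=
  measurable_fun [set: BorelRd] (f : BorelRd -> R).

Definition lebesgue_integrable (f : Rd -> R) : Prop :=
  borel_measurable f /\ (lint (fun x => `|f x|%:E) < +oo)%E.

Definition locally_integrable (f : Rd -> R) : Prop :=
  borel_measurable f /\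
  forall K : set Rd, compact K ->
    (lint (fun x => (`|f x| * (\1_K x : R))%:E) < +oo)%E.

Definition pderiv (i : 'I_d) (f : Rd -> R) : Rd -> R :=
  fun x => 'D_(evec i) f x.

Definition mindex_size (a : 'I_d -> nat) : nat := (\sum_(i < d) a i)%N.

Definition cderiv (a : 'I_d -> nat) (f : Rd -> R) : Rd -> R :=
  foldr (fun i g => iter (a i) (pderiv i) g) f (enum 'I_d).

Definition smooth (f : Rd -> R) : Prop :=
  forall s : seq 'I_d,
    let g := foldr pderiv f s in
    continuous g /\ forall (i : 'I_d) (x : Rd), derivable g x (evec i).

Definition test_function (phi : Rd -> R) : Prop :=
  smooth phi /\ exists K : set Rd, compact K /\ forall x, ~ K x -> phi x = 0.

Definition monom (g : 'I_d -> nat) (x : Rd) : R := \prod_(i < d) x 0 i ^+ g i.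

Definition weak_deriv (a : 'I_d -> nat) (f g : Rd -> R) : Prop :=
  locally_integrable f /\ locally_integrable g /\
  forall phi, test_function phi ->
    lintR (fun x => f x * cderiv a phi x) =
    (((-1 : R) ^+ mindex_size a)%:E * lintR (fun x => (g x * phi x)%R))%E.

Definition young (e : R -> R) : Prop :=
  [/\ forall s, e (- s) = e s,
      forall x y t, x != y -> 0 < t < 1 ->
        e (t * x + (1 - t) * y) < t * e x + (1 - t) * e y,
      forall s, 0 <= e s &
      e 0 = 0].

Definition young_E (e : R -> R) : Prop :=
  [/\ young e,
      exists2 lam : R, 0 < lam & forall s, e (2 * s) <= lam * e s &
      forall s t, 0 < s -> s <= t -> e s / s <= e t / t].

(* Luxemburg norm ||f||_(e) (= +oo when no c works) *)
Definition orlicz_norm (e : R -> R) (f : Rd -> R) : \bar R :=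
  ereal_inf [set (c%:E)%E | c in
    [set c : R | 0 < c /\ (lint (fun x => (e (f x / c))%:E) <= 1)%E]].

Definition einv (e : R -> R) (a : R) : R := sup [set c : R | e c <= a].
Definition beta_e (e : R -> R) (r : R) : R := r / einv e r.

(* multi-indices of order <= k, as a finite type *)
Definition mi_of (k : nat) (a : {ffun 'I_d -> 'I_k.+1}) : 'I_d -> nat :=
  fun i => nat_of_ord (a i).

(* ||f||_{k,l,(e)} = sum_{|g|<=l} sum_{|a|<=k} ||x^g ∂_a f||_(e),
   with weak derivatives; +oo if the weak derivatives do not all exist. *)
Definition sobolev_wnorm (k l : nat) (e : R -> R) (f : Rd -> R) : \bar R :=
  ereal_inf [set S | exists G : {ffun 'I_d -> 'I_k.+1} -> Rd -> R,
    (forall a, (mindex_size (mi_of a) <= k)%N -> weak_deriv (mi_of a) f (G a)) /\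
    S = (\sum_(g : {ffun 'I_d -> 'I_l.+1} | (mindex_size (mi_of g) <= l)%N)
         \sum_(a : {ffun 'I_d -> 'I_k.+1} | (mindex_size (mi_of a) <= k)%N)
           orlicz_norm e (fun x => (monom (mi_of g) x * G a x)%R))%E].

Definition sobolev_norm (k : nat) (e : R -> R) (f : Rd -> R) : \bar R :=
  sobolev_wnorm k 0 e f.

Definition sup_norm (k : nat) (phi : Rd -> R) : \bar R :=
  (\sum_(a : {ffun 'I_d -> 'I_k.+1} | (mindex_size (mi_of a) <= k)%N)
     ereal_sup [set (`|cderiv (mi_of a) phi x|%:E)%E | x in [set: Rd]])%E.

Definition signed_measure := {charge set BorelRd -> \bar R}.

(* v = ∫ phi dmu, computed through any decomposition mu = m1 - m2 into
   finite (positive) Borel measures. *)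
Definition charge_integral (mu : signed_measure) (phi : Rd -> R) (v : R) : Prop :=
  exists (m1 m2 : {finite_measure set BorelRd -> \bar R}),
    (forall A, measurable A -> mu A = (m1 A - m2 A)%E) /\
    v%:E = (\int[m1]_x (phi x)%:E - \int[m2]_x (phi x)%:E)%E.

Definition is_density (mu : signed_measure) (p : Rd -> R) : Prop :=
  lebesgue_integrable p /\
  forall A : set BorelRd, measurable A ->
    mu A = lintR (fun x => p x * (\1_A x : R)).

Definition dist_k (k : nat) (mu nu : signed_measure) : \bar R :=
  ereal_sup [set r : \bar R | exists (phi : Rd -> R) (v1 v2 : R),
    [/\ smooth phi, (sup_norm k phi <= 1)%E, charge_integral mu phi v1,
        charge_integral nu phi v2 & r = (`|v1 - v2|)%:E]].

(* pi_{q,k,m,e}(mu, (mu_n)_n), the sequence mu_n in M_a given together with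
   densities p_n *)
Definition pi_qkme (q k m : nat) (e : R -> R) (mu : signed_measure)
    (mu_ : nat -> signed_measure) (p_ : nat -> Rd -> R) : \bar R :=
  (\sum_(n <oo) ((2 ^+ (n * (q + k)) * beta_e e (2 ^+ (n * d)))%:E
                    * dist_k k mu (mu_ n))
   + \sum_(n <oo) ((2 ^+ (2 * n * m))^-1%:E
                    * sobolev_wnorm (2 * m + q) (2 * m) e (p_ n)))%E.

Definition rho_qkme (q k m : nat) (e : R -> R) (mu : signed_measure) : \bar R :=
  ereal_inf [set r : \bar R | exists (mu_ : nat -> signed_measure)
      (p_ : nat -> Rd -> R),
    (forall n, is_density (mu_ n) (p_ n)) /\ r = pi_qkme q k m e mu mu_ p_].

Definition S_qkme (q k m : nat) (e : R -> R) (mu : signed_measure) : Prop :=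
  (rho_qkme q k m e mu < +oo)%E.

End Defs.

(* Main.v *)
(** The proof mollifies [mu] instead of expanding it in Hermite functions.
    Fix a smooth [a] supported in [[-1, 1]] with integral 1, and let [phi_n] be
    the [d]-fold tensor power of [2^n a(2^n t)].  The kernel is chosen so that
    [2 a(2t) - a(t)] is the [2m]-th derivative of a bump; telescoping the
    product, [phi_{n+1} - phi_n] is then a sum of [d] tensor kernels at scale
    [2^-n], each of which is [2^(-2nm)] times the [2m]-th derivative of a tensor
    kernel in one coordinate direction.  Convolving with [mu] and splitting
    [mu = (mu - mu_n) + mu_n], the [n]-th increment of a derivative of order at
    most [q] of [phi_n * mu] has two parts.
    - Against [mu_n], the derivatives are moved onto [p_n], and Jensen's
      inequality gives a Luxemburg norm at most [C 2^(-2nm)] times the Sobolev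
      norm of [p_n].
    - Against [mu - mu_n], duality gives a sup norm at most
      [C 2^(n(d+q+k)) d_k(mu, mu_n)] and an L^1 norm at most
      [C 2^(n(q+k)) d_k(mu, mu_n)]; interpolating between them costs the factor
      [beta_e(2^(nd))].
    Hence the increments are summable with sum at most [C pi], the sequences
    converge in L^1_loc, and the limits are the density of [mu] and its weak
    derivatives. *)

Require Import Defs.
From HB Require Import structures.
From mathcomp Require Import all_boot all_order all_algebra.
From mathcomp Require Import all_classical all_reals all_analysis.
From mathcomp Require Import measurable_realfun.
From mathcomp Require Import ring lra.

Set Implicit Arguments.
Unset Strict Implicit.
Unset Printing Implicit Defensive.

Import Order.TTheory GRing.Theory Num.Theory.
Import numFieldNormedType.Exports.

Local Open Scope classical_set_scope.
Local Open Scope ring_scope.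

(** [lint] is defined by iterated one-dimensional integrals, so Fubini, Fatou and dominated
    convergence apply only once it is recognised as the integral against a measure, [lmeas].
    Vanishing moments enter through an explicit [2m]-fold primitive instead of a Taylor expansion:
    kernel and primitive are both smooth with compact support, hence test functions for the weak
    derivatives of [p_n]. The order [2m] is dictated by the weight [2^(-2nm)] in [pi]. For the L^1
    norm of a mollified measure the natural test function is the kernel convolved with a sign. It is
    discretised on a grid whose mesh is the scale of the kernel: a finite sum of kernels has
    explicit derivatives. The mollifications and their limits are built from [mu] alone; an
    approximating sequence enters only the estimates. One and the same density therefore satisfies
    the bound for every sequence, which is what allows passing to the infimum [rho]. *)

Section MonotoneFunctional.
Context dd (T : measurableType dd) (R : realType) (mu : {measure set T -> \bar R}).
Variable J : (T -> \bar R) -> \bar R.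
Local Open Scope ereal_scope.
Hypothesis J_scale : forall (r : R) f, (0 <= r)%R -> (forall x, 0 <= f x) ->
  measurable_fun setT f -> J (fun x => r%:E * f x) = r%:E * J f.
Hypothesis J_sum : forall (s : seq R) (g : R -> T -> \bar R), (forall i x, 0 <= g i x) ->
  (forall i, measurable_fun setT (g i)) ->
  J (fun x => \sum_(i <- s) g i x) = \sum_(i <- s) J (g i).
Hypothesis J_monotone : forall g : nat -> T -> \bar R, (forall n x, 0 <= g n x) ->
  (forall n, measurable_fun setT (g n)) -> (forall x, nondecreasing_seq (g ^~ x)) ->
  J (fun x => limn (g ^~ x)) = limn (fun n => J (g n)).
Hypothesis J_indic : forall A, measurable A -> J (fun x => (\1_A x)%:E) = mu A.

Import HBNNSimple.

(** Homogeneity, additivity and monotone limits reduce [J] to indicators through the simple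
    approximations of [f]. It is applied to [lint] and to integration against a density. *)
Lemma monotone_functional_integral f : (forall x, 0 <= f x) -> measurable_fun setT f ->
  J f = \int[mu]_x f x.
Proof.
move=> f0 mf.
pose g := nnsfun_approx measurableT mf.
have sf (h : {nnsfun T >-> R}) : J (EFin \o h) = \int[mu]_x (h x)%:E.
  rewrite integralT_nnsfun sintegralE fsbig_finite//=.
  set r := finmap.enum_fset _.
  have hi i y : 0 <= (i * \1_(h @^-1` [set i]) y)%:E.
    rewrite lee_fin indicE; case: (boolP (_ \in _)); rewrite ?mulr0// mulr1 inE/=.
    by move=> <-.
  have mi i : measurable (h @^-1` [set i]) by exact: measurable_sfunP.
  transitivity (J (fun x => \sum_(i <- r) (i * \1_(h @^-1` [set i]) x)%:E)).
    congr J; apply/funext => x /=.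
    by rewrite sumEFin; congr EFin; rewrite {1}(fimfunE h x) fsbig_finite.
  rewrite J_sum//; last by move=> i; apply/measurable_EFinP; exact: measurable_funM.
  apply: eq_bigr => i _; have [i0|i0] := leP 0%R i.
    under [X in J X]eq_fun do rewrite EFinM.
    rewrite J_scale ?J_indic//.
    by apply/measurable_EFinP; exact: measurable_indic.
  (* [eq_bigr] has forgotten that [i] is a value of [h]. For negative [i], where [J_scale] does not
     apply, the level set is empty because [h] is nonnegative. *)
  have -> : h @^-1` [set i] = set0.
    apply/seteqP; split=> // y /= hy.
    by have := hi i y; rewrite lee_fin indicE mem_set// mulr1 leNgt i0.
  rewrite measure0 mule0; have := J_indic measurable0; rewrite measure0 => <-.
  by congr J; apply/funext => x; rewrite indic0 mulr0.
have fE y : f y = limn (fun n => (g n y)%:E).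
  apply/esym/cvg_lim => //; exact: (cvg_nnsfun_approx (D := setT)).
have ndg y : nondecreasing_seq (fun n => (g n y)%:E).
  by move=> m n mn; rewrite lee_fin; exact/lefP/nd_nnsfun_approx.
have mg n : measurable_fun setT (fun x => (g n x)%:E) by exact/measurable_EFinP.
have g0 n x : 0 <= (g n x)%:E by rewrite lee_fin.
rewrite (_ : f = fun y => limn (fun n => (g n y)%:E)); last exact/funext.
rewrite monotone_convergence// J_monotone//.
by congr (limn _); apply/funext => n; exact: sf.
Qed.

End MonotoneFunctional.

(** * Lebesgue measure as iterated integral *)

Section BorelRow.
Context (R : realType) (d : nat).
Local Notation Rd := (Rd R d).
Local Notation BRd := (BorelRd R d).

Lemma measurable_open (U : set Rd) : open U -> measurable (U : set BRd).
Proof. by move=> oU; apply: sub_sigma_algebra. Qed.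

Lemma continuous_borel (f : Rd -> R) : continuous f ->
  measurable_fun [set: BRd] (f : BRd -> R).
Proof.
move=> /continuousP cf; apply: (measurability _ (RGenOpens.measurableE R)).
move=> _ [_ [a [b ->]] <-]; rewrite setTI.
by apply: measurable_open; apply: cf; exact: interval_open.
Qed.

Lemma measurable_coord (i : 'I_d) :
  measurable_fun [set: BRd] (fun x : BRd => (x : Rd) 0 i).
Proof. by apply: continuous_borel; exact: coord_continuous. Qed.

(** Closed sup-norm balls with rational centre: countably many sets of which every open set is a
    union. *)
Definition rbox (c : 'rV[rat]_d) (n : nat) : set Rd :=
  [set x | forall i, `|x 0 i - ratr (c 0 i)| <= n.+1%:R^-1].

Lemma open_rboxes (U : set Rd) : open U ->
  U = \bigcup_(p in [set p : 'rV[rat]_d * nat | rbox p.1 p.2 `<=` U])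
        rbox p.1 p.2.
Proof.
move=> oU; apply/seteqP; split => [x Ux|x [p pU px]]; last exact: pU.
have /nbhs_ballP[e /= e0 eU] := open_nbhs_nbhs (conj oU Ux).
(* Half of [e], because [x] and [y] are compared through the centre of the box. *)
have [n ne] : exists n : nat, n.+1%:R^-1 < e / 2.
  have : 0 < e / 2 by rewrite divr_gt0.
  by move=> /ltr_add_invr[n]; rewrite add0r => ?; exists n.
have rP i : exists r : rat, `|x 0 i - ratr r| < n.+1%:R^-1.
  have /rat_in_itvoo[r] : x 0 i - n.+1%:R^-1 < x 0 i + n.+1%:R^-1.
    by rewrite ltrBlDr -addrA ltrDl addr_gt0// invr_gt0.
  rewrite in_itv/= => /andP[r1 r2]; exists r.
  by rewrite ltr_distlC r1 r2.
pose c := \row_i projT1 (cid (rP i)).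
have cx : rbox c n x by move=> i; rewrite mxE; case: cid => r /= /ltW.
exists (c, n) => //= y cy; apply: eU; split=> // i j.
rewrite /ball/= (_ : i = 0) ?ord1//.
have := cx j; have := cy j => h1 h2.
rewrite (_ : _ - _ = (x 0 j - ratr (c 0 j)) - (y 0 j - ratr (c 0 j))); last by ring.
apply: le_lt_trans (ler_normB _ _) _.
by rewrite (splitr e); apply: ltrD; apply: le_lt_trans ne.
Qed.

(** The sigma-algebra of [BorelRd] is generated by open sets rather than by coordinates; writing an
    open set as a countable union of rational boxes leaves only conditions on single coordinates. *)
Lemma measurable_fun_coord d' (T : measurableType d') (f : T -> BRd) :
  (forall i, measurable_fun [set: T] (fun x => (f x : Rd) 0 i)) ->
  measurable_fun [set: T] f.
Proof.
move=> mf; apply: (@measurability _ _ _ _ _ f (@open Rd)) => //.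
move=> _ [U oU <-]; rewrite setTI (open_rboxes oU) preimage_bigcup.
rewrite bigcup_mkcond; apply: countable_bigcupT_measurable.
  exact: countableP.
move=> p; case: ifPn => // _; rewrite (_ : _ @^-1` _ = \bigcap_(i in [set: 'I_d])
  [set x | `|(f x : Rd) 0 i - ratr (p.1 0 i)| <= p.2.+1%:R^-1]); last first.
  by apply/seteqP; split => x /= h i; [move=> _|]; exact: h.
apply: fin_bigcap_measurable => // i _.
have mg : measurable_fun [set: T] (fun x => `|(f x : Rd) 0 i - ratr (p.1 0 i)|).
  by apply: measurableT_comp => //; apply: measurable_funB.
have := mg measurableT _ (measurable_itv `]-oo, p.2.+1%:R^-1]).
by rewrite setTI; congr (measurable _); apply/seteqP; split => x /=; rewrite in_itv.
Qed.

Lemma measurable_setcoord (i : 'I_d) :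
  measurable_fun [set: BRd * R]
    ((fun z => setcoord (z.1 : Rd) i z.2) : BRd * R -> BRd).
Proof.
apply: measurable_fun_coord => j.
rewrite (_ : (fun _ => _) = if j == i then snd else (fun z : BRd * R => (z.1 : Rd) 0 j)).
  case: ifP => // _; exact: (measurableT_comp (measurable_coord j) measurable_fst).
by apply/funext => z; rewrite mxE; case: ifP.
Qed.

Lemma measurable_subr : measurable_fun [set: BRd * BRd]
   ((fun z => (z.1 : Rd) - z.2) : BRd * BRd -> BRd).
Proof.
apply: measurable_fun_coord => j.
rewrite (_ : (fun _ => _) = (fun z : BRd * BRd => (z.1 : Rd) 0 j - (z.2 : Rd) 0 j)).
  apply: measurable_funB.
    exact: (measurableT_comp (measurable_coord j) measurable_fst).
  exact: (measurableT_comp (measurable_coord j) measurable_snd).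
by apply/funext => z; rewrite !mxE.
Qed.

Lemma setcoordC (x : Rd) (i j : 'I_d) s t : i != j ->
  setcoord (setcoord x i s) j t = setcoord (setcoord x j t) i s.
Proof.
move=> ij; apply/rowP => k; rewrite !mxE.
by case: (eqVneq k j) => // ->; rewrite eq_sym (negbTE ij).
Qed.

Lemma iter_lint_ge0 s (f : Rd -> \bar R) x : (forall y, 0 <= f y)%E ->
  (0 <= iter_lint s f x)%E.
Proof.
by move=> f0; elim: s x => //= i s IH x; apply: integral_ge0 => t _.
Qed.

Lemma eq_iter_lint s (f g : Rd -> \bar R) x : f =1 g ->
  iter_lint s f x = iter_lint s g x.
Proof. by move=> /funext ->. Qed.

Lemma measurable_iter_lint s (f : Rd -> \bar R) : (forall y, 0 <= f y)%E ->
  measurable_fun [set: BRd] (f : BRd -> \bar R) ->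
  measurable_fun [set: BRd] (iter_lint s f : BRd -> \bar R).
Proof.
move=> f0 mf; elim: s => //= i s IH.
apply: (measurable_fun_fubini_tonelli_F (m2 := @lebesgue_measure R)
  (fun z : BRd * R => iter_lint s f (setcoord (z.1 : Rd) i z.2))).
  exact: (measurableT_comp IH (measurable_setcoord i)).
by move=> z; exact: iter_lint_ge0.
Qed.

Lemma measurable_iter_lint1 s (f : Rd -> \bar R) i x : (forall y, 0 <= f y)%E ->
  measurable_fun [set: BRd] (f : BRd -> \bar R) ->
  measurable_fun [set: R] (fun t => iter_lint s f (setcoord x i t)).
Proof.
move=> f0 mf; apply: (measurableT_comp (measurable_iter_lint s f0 mf)).
exact: (measurableT_comp (measurable_setcoord i) (pair1_measurable (x : BRd))).
Qed.

Lemma le_iter_lint s (f g : Rd -> \bar R) x :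
  (forall y, 0 <= f y)%E -> (forall y, f y <= g y)%E ->
  measurable_fun [set: BRd] (f : BRd -> \bar R) ->
  measurable_fun [set: BRd] (g : BRd -> \bar R) ->
  (iter_lint s f x <= iter_lint s g x)%E.
Proof.
move=> f0 fg mf mg.
have g0 y : (0 <= g y)%E by exact: le_trans (fg y).
elim: s x => //= i s IH x; apply: ge0_le_integral => //.
- by move=> t _; exact: iter_lint_ge0.
- exact: measurable_iter_lint1.
- exact: measurable_iter_lint1.
Qed.

Lemma iter_lint_nneseries s (f : nat -> Rd -> \bar R) x :
  (forall n y, 0 <= f n y)%E ->
  (forall n, measurable_fun [set: BRd] (f n : BRd -> \bar R)) ->
  iter_lint s (fun y => \sum_(n <oo) f n y)%E x =
  (\sum_(n <oo) iter_lint s (f n) x)%E.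
Proof.
move=> f0 mf; elim: s x => //= i s IH x.
under eq_integral do rewrite IH.
rewrite integral_nneseries//; first by move=> n; exact: measurable_iter_lint1.
by move=> n t _; exact: iter_lint_ge0.
Qed.

Lemma iter_lintZl s (f : Rd -> \bar R) (r : R) x : 0 <= r ->
  (forall y, 0 <= f y)%E -> measurable_fun [set: BRd] (f : BRd -> \bar R) ->
  iter_lint s (fun y => r%:E * f y)%E x = (r%:E * iter_lint s f x)%E.
Proof.
move=> r0 f0 mf; elim: s x => //= i s IH x.
under eq_integral do rewrite IH.
rewrite ge0_integralZl_EFin//; first by move=> t _; exact: iter_lint_ge0.
exact: measurable_iter_lint1.
Qed.

Lemma iter_lint0 s x : iter_lint s (fun _ : Rd => 0%E : \bar R) x = 0%E.
Proof.
elim: s x => //= i s IH x.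
by under eq_integral do rewrite IH; rewrite integral0.
Qed.

(** Lebesgue measure on [Rd], read off from [lint] on indicators; [lint_ge0E] then identifies [lint]
    with integration against it. *)
Definition lmeas (A : set BRd) : \bar R := lint (fun x => (\1_A x)%:E).

Let lmeas0 : lmeas set0 = 0%E.
Proof. by rewrite /lmeas; under [X in lint X]eq_fun do rewrite indic0; rewrite /lint iter_lint0. Qed.

Let lmeas_ge0 A : (0 <= lmeas A)%E.
Proof. by apply: iter_lint_ge0 => y; rewrite lee_fin. Qed.

Let measurable_indicE (A : set BRd) : measurable A ->
   measurable_fun [set: BRd] (fun x => (\1_A x : R)%:E).
Proof. by move=> mA; apply/measurable_EFinP; exact: measurable_indic. Qed.

Let lmeas_sigma_additive : semi_sigma_additive lmeas.
Proof.
move=> F mF tF mUF.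
rewrite (_ : lmeas _ = \sum_(n <oo) lmeas (F n))%E.
  by apply: is_cvg_ereal_nneg_natsum.
rewrite /lmeas/lint -iter_lint_nneseries//.
- by apply: eq_iter_lint => y; rewrite indic_bigcup.
- by move=> n; exact: measurable_indicE.
Qed.

HB.instance Definition _ := isMeasure.Build _ _ _ lmeas lmeas0 lmeas_ge0 lmeas_sigma_additive.

Local Open Scope ereal_scope.

Lemma iter_lint_monotone s (g : nat -> Rd -> \bar R) x :
  (forall n y, 0 <= g n y) ->
  (forall n, measurable_fun [set: BRd] (g n : BRd -> \bar R)) ->
  (forall y, nondecreasing_seq (g ^~ y)) ->
  iter_lint s (fun y => limn (g ^~ y)) x = limn (fun n => iter_lint s (g n) x).
Proof.
move=> g0 mg ndg; elim: s x => //= i s IH x.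
under eq_integral do rewrite IH.
rewrite monotone_convergence//.
- by move=> n; exact: measurable_iter_lint1.
- by move=> n t _; exact: iter_lint_ge0.
- move=> t _ m n mn; apply: le_iter_lint => // y; exact: ndg.
Qed.

Lemma iter_lint_sum s I (r : seq I) (g : I -> Rd -> \bar R) x :
  (forall n y, 0 <= g n y) ->
  (forall n, measurable_fun [set: BRd] (g n : BRd -> \bar R)) ->
  iter_lint s (fun y => \sum_(i <- r) g i y) x = \sum_(i <- r) iter_lint s (g i) x.
Proof.
move=> g0 mg; elim: s x => //= i s IH x.
under eq_integral do rewrite IH.
rewrite ge0_integral_sum//.
- by move=> n; exact: measurable_iter_lint1.
- by move=> n t _; exact: iter_lint_ge0.
Qed.

Lemma lint_ge0E (f : Rd -> \bar R) : (forall y, 0 <= f y) ->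
  measurable_fun [set: BRd] (f : BRd -> \bar R) ->
  lint f = \int[lmeas]_x (f : BRd -> \bar R) x.
Proof.
apply: (@monotone_functional_integral _ BRd R lmeas (fun f => lint (f : Rd -> \bar R))).
- by move=> r g r0 g0 mg; exact: iter_lintZl.
- by move=> s g g0 mg; exact: iter_lint_sum.
- by move=> g g0 mg ndg; exact: iter_lint_monotone.
- by [].
Qed.

Lemma iter_lint_swap s i j (f : Rd -> \bar R) x : i != j ->
  (forall y, 0 <= f y) -> measurable_fun [set: BRd] (f : BRd -> \bar R) ->
  iter_lint [:: i, j & s] f x = iter_lint [:: j, i & s] f x.
Proof.
move=> ij f0 mf /=.
rewrite (@fubini_tonelli _ _ _ _ _ lebesgue_measure lebesgue_measure
  (fun z : R * R => iter_lint s f (setcoord (setcoord x i z.1) j z.2))) /=.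
- apply: eq_integral => t _; apply: eq_integral => u _; congr iter_lint.
  exact: setcoordC.
- have m1 : measurable_fun [set: R * R] ((fun z => (setcoord x i z.1, z.2)) : R * R -> BRd * R).
    apply/measurable_fun_pairP; split; last exact: measurable_snd.
    apply: (measurableT_comp _ measurable_fst).
    exact: (measurableT_comp (measurable_setcoord i) (pair1_measurable (x : BRd))).
  exact: (measurableT_comp (measurable_iter_lint s f0 mf)
    (measurableT_comp (measurable_setcoord j) m1)).
- by move=> z; exact: iter_lint_ge0.
Qed.

Lemma iter_lint_rcons s i (f : Rd -> \bar R) x :
  (forall y, 0 <= f y) -> measurable_fun [set: BRd] (f : BRd -> \bar R) ->
  i \notin s -> iter_lint (i :: s) f x = iter_lint (rcons s i) f x.
Proof.
move=> f0 mf; elim: s x => //= j s IH x; rewrite inE negb_or => /andP[ij is_].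
have := iter_lint_swap s x ij f0 mf => /= ->.
by apply: eq_integral => t _; exact: IH.
Qed.

Lemma iter_lint_cat s1 s2 (f : Rd -> \bar R) x :
  iter_lint (s1 ++ s2) f x = iter_lint s1 (iter_lint s2 f) x.
Proof. by elim: s1 x => //= i s IH x; apply: eq_integral => t _; exact: IH. Qed.

(** Tonelli moves coordinate [i] to the innermost place, so facts about slices in direction [i] pass
    to [lint]. The list [s] is the same for all [f], which allows comparing two functions. *)
Lemma lint_slice i : exists s, forall f : Rd -> \bar R,
  (forall y, 0 <= f y) -> measurable_fun [set: BRd] (f : BRd -> \bar R) ->
  lint f = iter_lint s
    (fun y => \int[lebesgue_measure]_t f (setcoord y i t)) 0%R.
Proof.
have : i \in enum 'I_d by rewrite mem_enum.
have := enum_uniq 'I_d; rewrite /lint => + ie; case/splitPr: ie => s1 s2.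
rewrite cat_uniq => /and3P[_ _ /= /andP[is2 _]].
exists (s1 ++ s2) => f f0 mf; rewrite iter_lint_cat.
under eq_iter_lint do rewrite (iter_lint_rcons _ f0 mf is2).
by rewrite -iter_lint_cat -cats1 catA iter_lint_cat.
Qed.

(** Factors of coordinates outside [s] are kept at the base point [x]; this makes the induction on
    [s] possible. *)
Lemma iter_lint_prod s (h : 'I_d -> R -> R) (J : 'I_d -> R) x : uniq s ->
  (forall i t, (0 <= h i t)%R) -> (forall i, measurable_fun [set: R] (h i)) ->
  (forall i, \int[lebesgue_measure]_t (h i t)%:E = (J i)%:E) ->
  iter_lint s (fun y : Rd => (\prod_i h i (y 0%R i))%:E) x =
  ((\prod_(i <- s) J i) * \prod_(i | i \notin s) h i (x 0%R i))%:E.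
Proof.
move=> + h0 mh hJ; elim: s x => [x _ /=|i s IH x /= /andP[is_ us]].
  by rewrite big_nil mul1r.
under eq_integral => t _.
  rewrite IH// (bigD1 i)//= mxE eqxx.
  rewrite [X in (_ * (_ * X))%R](eq_bigr (fun j => h j (x 0%R j))); last first.
    by move=> j /andP[_ ji]; rewrite mxE (negbTE ji).
  rewrite mulrCA mulrC EFinM.
  over.
rewrite ge0_integralZl_EFin//=.
- rewrite hJ -EFinM big_cons; congr EFin; rewrite mulrC mulrA; congr (_ * _)%R.
  by apply: eq_bigl => j; rewrite inE negb_or andbC.
- by move=> t _; rewrite lee_fin.
- by apply/measurable_EFinP; exact: mh.
- apply: mulr_ge0; last by apply: prodr_ge0.
  apply: prodr_ge0 => j _; rewrite -lee_fin -hJ; apply: integral_ge0 => t _.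
  by rewrite lee_fin.
Qed.

Local Close Scope ereal_scope.

Definition box (a b : Rd) : set Rd := [set x | forall i, a 0 i <= x 0 i <= b 0 i]%R.

Lemma box_indic (a b x : Rd) : \1_(box a b) x = (\prod_i \1_(`[a 0 i, b 0 i]%classic) (x 0 i))%R :> R.
Proof.
rewrite indicE; case: (boolP (x \in box a b)); rewrite ?inE ?notin_setE/=.
  move=> xab; rewrite big1// => i _; rewrite indicE mem_set//= in_itv/=; exact: xab.
move=> /existsNP[i xi]; rewrite (bigD1 i)//= indicE memNset ?mul0r//=.
Qed.

Lemma measurable_box (a b : Rd) : measurable (box a b : set BRd).
Proof.
rewrite (_ : box a b = \bigcap_(i in [set: 'I_d]) (fun x : BRd => (x : Rd) 0 i) @^-1` `[a 0 i, b 0 i]).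
  apply: fin_bigcap_measurable => // i _; rewrite -[X in measurable X]setTI.
  exact: measurable_coord.
apply/seteqP; split => x /= h i; first by move=> _; rewrite /= in_itv/=; exact: h.
by have := h i Logic.I; rewrite /= in_itv.
Qed.

Lemma lmeas_box (a b : Rd) : (forall i, a 0 i <= b 0 i)%R ->
  lmeas (box a b) = (\prod_i (b 0 i - a 0 i))%R%:E.
Proof.
move=> ab; rewrite /lmeas/lint; under eq_iter_lint do rewrite box_indic.
rewrite (@iter_lint_prod _ (fun i => \1_`[a 0 i, b 0 i]) (fun i => b 0 i - a 0 i)) ?enum_uniq//.
- rewrite [X in (_ * X)%R]big_pred0 ?mulr1 ?big_enum//.
  by move=> i; rewrite mem_enum.
- move=> i; rewrite integral_indic//= setIT lebesgue_measure_itv/= lte_fin.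
  have := ab i; rewrite le_eqVlt => /predU1P[->|->//].
  by rewrite ltxx subrr.
Qed.

Lemma bigcup_box : \bigcup_n box (const_mx (- n%:R)) (const_mx n%:R) = [set: Rd].
Proof.
apply/seteqP; split=> // x _.
have [n xn] : exists n : nat, forall i, (`|x 0 i| <= n%:R)%R.
  exists (\max_i Num.truncn `|x 0%R i|).+1 => i.
  apply: ltW; apply: lt_le_trans (truncnS_gt _) _.
  by rewrite ler_nat ltnS (leq_bigmax i).
by exists n => // i; rewrite !mxE -ler_norml.
Qed.

Let lmeas_sigma_finite : sigma_finite setT lmeas.
Proof.
exists (fun n => box (const_mx (- n%:R)) (const_mx n%:R)).
  by rewrite bigcup_box.
move=> n; split; first exact: measurable_box.
rewrite lmeas_box ?ltry// => i; rewrite !mxE.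
by rewrite (@le_trans _ _ 0)// oppr_le0.
Qed.

HB.instance Definition _ := Measure_isSigmaFinite.Build _ _ _ lmeas lmeas_sigma_finite.

End BorelRow.

(** * One-dimensional kernels *)

Section Smooth1.
Context (R : realType).
Implicit Types (f g : R -> R).

Record smooth1 f : Prop := Smooth1
  { derivable_derive1n : forall n x, derivable (derive1n n f) x 1 }.

(** Coinduction: a class of differentiable functions stable under derivation consists of smooth
    functions. Used with classes of finite sums, it replaces explicit formulas for higher
    derivatives. *)
Lemma smooth1_coind (P : (R -> R) -> Prop) :
  (forall f, P f -> (forall x, derivable f x 1) /\ P (derive1 f)) ->
  forall f, P f -> smooth1 f.
Proof.
move=> H f Pf; constructor => n; elim: n f Pf => [|n IH] f Pf x; first exact: (H f Pf).1.
by rewrite derive1Sn; apply: IH; exact: (H f Pf).2.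
Qed.

Lemma smooth1_derivable f x : smooth1 f -> derivable f x 1.
Proof. by case=> /(_ 0%N x). Qed.

Lemma smooth1_derive1 f : smooth1 f -> smooth1 (derive1 f).
Proof. by move=> sf; constructor => n x; rewrite -derive1Sn; apply: derivable_derive1n. Qed.

Lemma smooth1_derive1n n f : smooth1 f -> smooth1 (derive1n n f).
Proof.
move=> sf; elim: n => [//|n IH].
by rewrite derive1nS; apply: smooth1_derive1.
Qed.

Lemma derivable1_continuous f : (forall x, derivable f x 1) -> continuous f.
Proof. by move=> df x; apply/differentiable_continuous/derivable1_diffP. Qed.

Lemma smooth1_continuous f : smooth1 f -> continuous f.
Proof. by move=> sf; apply: derivable1_continuous => x; exact: smooth1_derivable. Qed.

Lemma derive1_ext f g : (forall x, is_derive (x : R) (1 : R) f (g x)) -> (derive1 f) = g.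
Proof. by move=> fg; apply/funext => x; rewrite derive1E; apply: derive_val. Qed.

Lemma smooth1_is_derive f x : smooth1 f -> is_derive (x : R) (1 : R) f ((derive1 f) x).
Proof. by move=> /smooth1_derivable -/(_ x) /derivableP; rewrite derive1E. Qed.

Lemma is_derive_affine f (k a b x df : R) : is_derive (a * x + b : R) (1 : R) f df ->
  is_derive (x : R) (1 : R) (fun t => k * f (a * t + b)) (k * a * df).
Proof.
move=> dfx.
have da : is_derive (x : R) (1 : R) (fun t => a * t + b) a.
  apply: is_derive_eq.
  by rewrite addr0 -[_ *: _]/(a * 1) mulr1.
have dc : is_derive (x : R) (1 : R) (f \o (fun t => a * t + b)) (df * a).
  exact: is_derive1_comp.
by apply: is_derive_eq; rewrite -[_ *: _]/(k * _) mulrA mulrAC.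
Qed.

Lemma derive1n_affine n f (k a b : R) : smooth1 f ->
  (derive1n n (fun t => k * f (a * t + b))) = (fun t => k * a ^+ n * (derive1n n f) (a * t + b)).
Proof.
move=> sf; elim: n => [|n IH]; first by apply/funext => t; rewrite expr0 mulr1.
rewrite derive1nS IH; apply: derive1_ext => x.
rewrite exprSr mulrA.
apply: is_derive_affine; rewrite derive1nS.
by apply: smooth1_is_derive; exact: smooth1_derive1n.
Qed.

Lemma smooth1_affine f (k a b : R) : smooth1 f -> smooth1 (fun t => k * f (a * t + b)).
Proof.
move=> sf; constructor => n x; rewrite derive1n_affine//.
have := is_derive_affine (k * a ^+ n) (smooth1_is_derive (a * x + b) (smooth1_derive1n n sf)).
by move/@ex_derive.
Qed.

Lemma derive1nD n f g : smooth1 f -> smooth1 g -> (derive1n n (f \+ g)) = (derive1n n f) \+ (derive1n n g).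
Proof.
move=> sf sg; elim: n => // n IH; rewrite !derive1nS IH.
apply: derive1_ext => x; apply: is_deriveD; apply: smooth1_is_derive; exact: smooth1_derive1n.
Qed.

Lemma smooth1D f g : smooth1 f -> smooth1 g -> smooth1 (f \+ g).
Proof.
move=> sf sg; constructor => n x; rewrite derive1nD//.
by apply: derivableD; apply: smooth1_derivable; exact: smooth1_derive1n.
Qed.

Lemma derive1_cst0 (c : R) : derive1 (fun _ : R => c) = (fun=> 0).
Proof. by apply: derive1_ext => x; exact: is_derive_cst. Qed.

Lemma smooth1_cst (c : R) : smooth1 (fun _ : R => c).
Proof.
apply: (smooth1_coind (P := fun f => exists c, f = fun=> c)); last by exists c.
by move=> f [k ->]; split => //; exists 0; exact: derive1_cst0.
Qed.

Lemma smooth1M f g : smooth1 f -> smooth1 g -> smooth1 (f \* g).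
Proof.
move=> sf sg.
apply: (smooth1_coind (P := fun h => exists s : seq ((R -> R) * (R -> R)),
  (forall p, List.In p s -> smooth1 p.1 /\ smooth1 p.2) /\
  h = fun x => \sum_(p <- s) p.1 x * p.2 x)); last first.
  exists [:: (f, g)]; split => [p [<-|]//|]; apply/funext => x.
  by rewrite big_seq1.
move=> h [s [ss ->{h}]].
suff [s' [ss' hs']] : exists s', (forall p, List.In p s' -> smooth1 p.1 /\ smooth1 p.2) /\
   forall x, is_derive (x : R) (1 : R) (fun x => \sum_(p <- s) p.1 x * p.2 x)
    (\sum_(p <- s') p.1 x * p.2 x).
  split; first by move=> x; have /@ex_derive := hs' x.
  by exists s'; split => //; exact: derive1_ext.
elim: s ss => [|[u v] s IH] ss.
  exists [::]; split => // x; rewrite big_nil.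
  rewrite (_ : (fun _ => _) = (fun=> 0)); last by apply/funext => y; rewrite big_nil.
  exact: is_derive_cst.
have [|s' [ss' hs']] := IH; first by move=> p ps; apply: ss; right.
have [su sv] := ss (u, v) (or_introl erefl).
exists [:: ((derive1 u), v), (u, (derive1 v)) & s']; split.
  move=> p [<-|[<-|]]/=; last exact: ss'.
  by split => //; exact: smooth1_derive1.
  by split => //; exact: smooth1_derive1.
move=> x; rewrite !big_cons/= addrA.
rewrite (_ : (fun _ => _) = (u \* v) \+ (fun x => \sum_(p <- s) p.1 x * p.2 x)); last first.
  by apply/funext => y; rewrite big_cons.
apply: is_deriveD.
have := @is_deriveM _ _ u v x 1 _ _ (smooth1_is_derive x su) (smooth1_is_derive x sv).
by rewrite addrC [(derive1 u) x * _]mulrC.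
Qed.

Lemma smooth1_primitive F f : (forall x, is_derive (x : R) (1 : R) F (f x)) -> smooth1 f -> smooth1 F.
Proof.
move=> Ff sf; constructor => -[|n] x; first by have /@ex_derive := Ff x.
by rewrite derive1Sn (derive1_ext Ff); apply: derivable_derive1n.
Qed.

End Smooth1.

Section Kernel1.
Context (R : realType).
Implicit Types (f g : R -> R).

(** The family generated by differentiating the flat function [exp(-1/x)]: the derivative of member
    [n] combines members [n+2] and [n+1]. *)
Definition expbump n (x : R) : R := if 0 < x then x ^- n * expR (- x^-1) else 0.

Lemma expbump_ge0 n x : 0 <= expbump n x.
Proof.
by rewrite /expbump; case: ifPn => // x0; rewrite mulr_ge0 ?expR_ge0 ?invr_ge0 ?exprn_ge0// ltW.
Qed.

(** The term of order [n+1] in the series of [exp(1/x)] absorbs [x^-n] and leaves one factor [x],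
    which forces the derivative at 0 to vanish. *)
Lemma expbump_le n x : 0 < x -> expbump n x <= n.+1`!%:R * x.
Proof.
move=> x0; rewrite /expbump x0 expRN.
rewrite ler_pdivrMr ?expR_gt0// -ler_pdivrMl//; last first.
  by rewrite mulr_gt0// ltr0n fact_gt0.
have := @expR_ge1Dxn R x^-1 n (ltW (_ : 0 < x^-1)).
rewrite invr_gt0 x0 => /(_ isT) h.
rewrite invfM -exprVn -mulrA -exprS mulrC.
by apply: le_trans h; rewrite lerDr.
Qed.

Lemma is_derive_expbump n (x : R) :
  is_derive (x : R) (1 : R) (expbump n) (expbump n.+2 x - n%:R * expbump n.+1 x).
Proof.
have [x0|x0|->] := ltgtP x 0.
- rewrite /expbump !ifF; try by rewrite ltNge ltW.
  rewrite mulr0 subr0.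
  apply: (near_eq_is_derive _ (is_derive_cst (0 : R) x (1 : R))).
  near=> y; rewrite /= ifF//; apply/negbTE; rewrite -leNgt; near: y.
  by apply: filterS (lt_nbhsl x0) => y /ltW.
- rewrite /expbump x0.
  apply: (@near_eq_is_derive _ R R (fun y => y ^- n * expR (- y^-1))).
    near=> y; rewrite ifT//; near: y; exact: lt_nbhsr.
  have xn : x != 0 by rewrite gt_eqF.
  have dV : is_derive x 1 (fun y : R => y^-1) (- x ^- 2).
    by have := @is_deriveV R id x 1 1 xn (is_derive_id _ _); rewrite -[_ *: _]/(_ * _) mulr1.
  have dX : is_derive x 1 (fun y : R => y ^- n) (- n%:R * x ^- n.+1).
    have := @is_deriveX R _ _ n _ _ _ dV.
    rewrite (_ : (fun y => y^-1) ^+ n = (fun y : R => y ^- n)); last first.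
      by apply/funext => y; rewrite fctE/= exprVn.
    move=> h; apply: is_derive_eq.
    rewrite -[_ *: _]/(_ * _); case: n {h} => [|n /=]; first by rewrite !mul0r oppr0 mul0r.
    rewrite mulrN mulNr -!mulrA -!exprVn -exprD addn2; ring.
  have dN : is_derive x 1 (fun y : R => - y^-1) (x ^- 2).
    by apply: is_derive_eq; rewrite opprK.
  have dE : is_derive x 1 (fun y : R => expR (- y^-1)) (expR (- x^-1) * x ^- 2).
    exact: (@is_derive1_comp R expR (fun y => - y^-1)).
  have := is_deriveM dX dE.
  move=> h; apply: is_derive_eq.
  rewrite -[_ *: _]/(_ * _) -[X in _ + X]/(_ * _) -!exprVn !exprS; ring.
- rewrite /expbump ltxx mulr0 subr0.
  suff h : (fun h : R => h^-1 *: ((expbump n \o shift 0) (h *: (1 : R)) - expbump n 0)) @ 0^' --> (0 : R).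
    by split; [apply/cvg_ex; exists 0|apply: cvg_lim].
  apply/cvgrPdist_le => e e0; near=> y.
  rewrite sub0r normrN /= /shift/= addr0 -[y *: 1]/(y * 1) mulr1.
  rewrite [expbump n 0]/expbump ltxx subr0 -[_ *: _]/(_ * _).
  have [y0|y0] := ltP 0 y; last by rewrite /expbump ltNge y0 mulr0 normr0 ltW.
  (* The difference quotient at 0 is the next member of the family, small by [expbump_le]. *)
  rewrite (_ : y^-1 * _ = expbump n.+1 y); last first.
    by rewrite /expbump y0 exprS invfM mulrA.
  rewrite ger0_norm ?expbump_ge0//; apply: le_trans (expbump_le _ y0) _.
  rewrite -ler_pdivlMl ?ltr0n ?fact_gt0// -(gtr0_norm y0); near: y.
  apply: dnbhs0_le; rewrite mulr_gt0// invr_gt0 ltr0n fact_gt0//.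
Unshelve. all: by end_near. Qed.

Lemma smooth1_expbump n : smooth1 (expbump n).
Proof.
apply: (@smooth1_coind R (fun h => exists s : seq (R * nat),
  h = fun x => \sum_(p <- s) p.1 * expbump p.2 x)); last first.
  by exists [:: (1, n)]; apply/funext => x; rewrite big_seq1 mul1r.
move=> h [s ->{h}].
suff [s' hs'] : exists s' : seq (R * nat), forall x,
   is_derive (x : R) (1 : R) (fun x => \sum_(p <- s) p.1 * expbump p.2 x)
    (\sum_(p <- s') p.1 * expbump p.2 x).
  split; first by move=> x; have /@ex_derive := hs' x.
  by exists s'; exact: derive1_ext.
elim: s => [|[c k] s [s' IH]].
  exists [::] => x; rewrite big_nil.
  rewrite (_ : (fun _ => _) = (fun=> 0)); last by apply/funext => y; rewrite big_nil.
  exact: is_derive_cst.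
exists [:: (c, k.+2), (- c * k%:R, k.+1) & s'] => x; rewrite !big_cons/=.
rewrite (_ : (fun _ => _) = (fun y => c * expbump k y) \+ (fun x => \sum_(p <- s) p.1 * expbump p.2 x)); last first.
  by apply/funext => y; rewrite big_cons.
have d1 := is_derive_expbump k x.
rewrite addrA; apply: is_deriveD; apply: is_derive_eq.
rewrite -[_ *: _]/(_ * _); ring.
Qed.

Lemma FTC_is_derive F f (a b : R) : a < b ->
  (forall x, is_derive (x : R) (1 : R) F (f x)) -> continuous f ->
  (\int[lebesgue_measure]_(x in `[a, b]) (f x)%:E = (F b - F a)%:E)%E.
Proof.
move=> ab Ff cf.
have cF : continuous F by apply: derivable1_continuous => x; have /@ex_derive := Ff x.
rewrite (@continuous_FTC2 _ f F)//.
- exact: continuous_subspaceT.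
- split; first by move=> x _; have /@ex_derive := Ff x.
    exact/cvg_at_right_filter/cF.
  exact/cvg_at_left_filter/cF.
- by move=> x _; rewrite (derive1_ext Ff).
Qed.

Lemma is_derive_MVT F f (a b : R) : a < b ->
  (forall x, is_derive (x : R) (1 : R) F (f x)) ->
  exists2 c, a < c < b & F b - F a = f c * (b - a).
Proof.
move=> ab Ff.
have cF : continuous F by apply: derivable1_continuous => x; have /@ex_derive := Ff x.
have [c cab h] := @MVT R F f a b ab (fun x _ => Ff x) (continuous_subspaceT cF).
by exists c => //; move: cab; rewrite in_itv.
Qed.

Lemma primitive_left f : continuous f -> (forall x, x <= -1 -> f x = 0) ->
  exists2 F, (forall x, is_derive (x : R) (1 : R) F (f x)) &
    forall x, x <= -1 -> F x = 0.
Proof.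
move=> cf f0.
(* Starting at -2 instead of -1 makes every [x >= -1] an interior point, as [continuous_FTC1_closed]
   requires; left of -1 the primitive is locally zero. *)
pose F x := (\int[lebesgue_measure]_(t in `[-2, x]) f t)%R.
have F0 x : x <= -1 -> F x = 0.
  move=> x1; rewrite /F /Rintegral (eq_integral (fun=> 0%E)) ?integral0//.
  by move=> y; rewrite inE/= in_itv/= => /andP[_ yx]; rewrite f0// (le_trans yx).
exists F => // x; have [x1|x1] := ltP x (-1).
  rewrite f0 ?ltW//; apply: (near_eq_is_derive _ (is_derive_cst (0 : R) x (1 : R))).
  near=> y; rewrite F0//; near: y; by apply: filterS (lt_nbhsl x1) => y /ltW.
have x2 : -2 < x by apply: lt_le_trans x1; lra.
have xx : x < x + 1 by rewrite ltrDl.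
have fi : lebesgue_measure.-integrable `[-2, x + 1] (EFin \o f).
  apply: continuous_compact_integrable; first exact: segment_compact.
  exact: continuous_subspaceT.
have [dF F'] := continuous_FTC1_closed xx fi x2 (cf x).
by split; [exact: dF|rewrite -derive1E].
Unshelve. all: by end_near. Qed.

Lemma primitive_step f : smooth1 f -> (forall x, 1 <= `|x| -> f x = 0) ->
  exists F, [/\ smooth1 F, (forall x, is_derive (x : R) (1 : R) F (f x)),
    forall x, x <= -1 -> F x = 0 & forall x, 1 <= x -> F x = F 1].
Proof.
move=> sf f0.
have [|F Ff F0] := primitive_left (smooth1_continuous sf).
  by move=> x x1; apply: f0; rewrite ler_normr lerNr x1 orbT.
exists F; split => //; first exact: smooth1_primitive sf.
move=> x; rewrite le_eqVlt => /predU1P[<-//|x1].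
have [c /andP[c1 _] h] := is_derive_MVT x1 Ff.
by apply/eqP; rewrite -subr_eq0 h f0 ?mul0r// ger0_norm ?ltW// (lt_trans _ c1).
Qed.

(* [A] is the primitive of [a], so [A 1 = 1] says that [a] has integral 1. *)
Definition vanishing_pair N a b A :=
  [/\ smooth1 a, smooth1 b, smooth1 A & (forall x, is_derive (x : R) (1 : R) A (a x))] /\
  [/\ forall x, 1 <= `|x| -> a x = 0, forall x, 1 <= `|x| -> b x = 0,
    forall x, x <= -1 -> A x = 0, forall x, 1 <= x -> A x = 1 &
    forall x, 2 * a (2 * x) - a x = derive1n N b x].

Lemma normr_double (x : R) : 1 <= `|x| -> 1 <= `|2 * x|.
Proof. by move=> x1; rewrite normrM ger0_norm//; lra. Qed.

Lemma smooth1_double f k : smooth1 f -> smooth1 (fun t => k * f (2 * t)).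
Proof.
move=> sf; have := smooth1_affine k 2 0 sf.
by under [X in smooth1 X -> _]eq_fun do rewrite addr0.
Qed.

Lemma derive1n_double n f k : smooth1 f ->
  derive1n n (fun t => k * f (2 * t)) = fun t => k * 2 ^+ n * derive1n n f (2 * t).
Proof.
move=> sf; have := derive1n_affine n k 2 0 sf.
by under [X in derive1n _ X = _]eq_fun do rewrite addr0; under [X in _ = X]eq_fun do rewrite addr0.
Qed.

Lemma is_derive_double F f k x : (forall x, is_derive (x : R) (1 : R) F (f x)) ->
  is_derive (x : R) (1 : R) (fun t => k * F (2 * t)) (k * 2 * f (2 * x)).
Proof.
move=> Ff; have := @is_derive_affine R F k 2 0 x (f (2 * x)).
rewrite addr0 => /(_ (Ff _)).
by under [X in is_derive _ _ X _ -> _]eq_fun do rewrite addr0.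
Qed.

(** For order one, [b] is the difference of the step [A] at two scales, which cancels where both
    steps are constant. The induction is a Richardson extrapolation: passing from [a] to [2 a(2t)]
    multiplies the moment of order [N+1] by [w = 2^-(N+1)], so the weights [al] and [be] with
    [al + be = 1] and [al + w be = 0] keep the integral and kill that moment. *)
Lemma vanishing_pair_exists N : exists a b A, vanishing_pair N.+1 a b A.
Proof.
elim: N => [|N [a [b [A [[sa sb sA Aa] [a0 b0 A0 A1 ab]]]]]].
  pose eta := (fun x : R => 1 * expbump 0 ((-1) * x + 1)) \* (fun x => 1 * expbump 0 (1 * x + 1)).
  have seta : smooth1 eta by apply: smooth1M; apply: smooth1_affine; exact: smooth1_expbump.
  have eta0 x : 1 <= `|x| -> eta x = 0.
    rewrite /eta/= /expbump ler_normr => /orP[x1|x1].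
      by rewrite ifF ?(mulr0, mul0r)//; apply/negbTE; rewrite -leNgt; lra.
    by rewrite [X in _ * (_ * X)]ifF ?(mulr0, mul0r)//; apply/negbTE; rewrite -leNgt; lra.
  have eta_gt0 x : -1 < x < 1 -> 0 < eta x.
    move=> /andP[x1 x2]; rewrite /eta/= /expbump !ifT; [|lra|lra].
    by rewrite !mul1r mulr_gt0// mulr_gt0 ?expR_gt0// !expr0 invr1.
  have [F [sF Feta F0 F1]] := primitive_step seta eta0.
  (* The integral of [eta] is twice a value of [eta] inside the interval, by the mean value theorem;
     this permits the normalisation. *)
  have F1_gt0 : 0 < F 1.
    have [|c c1 h] := @is_derive_MVT F eta (-1) 1 _ Feta; first lra.
    have -> : F 1 = eta c * 2 by move: h; rewrite (F0 (-1))// subr0 => ->; congr (_ * _); lra.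
    by rewrite mulr_gt0 ?eta_gt0.
  pose A x := (F 1)^-1 * F x; pose a x := (F 1)^-1 * eta x.
  have Aa x : is_derive (x : R) (1 : R) A (a x) by apply: is_deriveZ; exact: Feta.
  have sa : smooth1 a.
    have := smooth1_affine (F 1)^-1 1 0 seta.
    by under [X in smooth1 X -> _]eq_fun do rewrite addr0 mul1r.
  have sA : smooth1 A by apply: smooth1_primitive sa.
  pose b x := 1 * A (2 * x) + (-1) * A (1 * x + 0).
  have bd x : is_derive (x : R) (1 : R) b (2 * a (2 * x) - a x).
    have d1 := @is_derive_double A a 1 x Aa.
    have d2 : is_derive x 1 (fun x => -1 * A (1 * x + 0)) (-1 * 1 * a (1 * x + 0)).
      exact: is_derive_affine.
    apply: is_derive_eq; rewrite !mul1r addr0; ring.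
  exists a, b, A; split; split => //.
  - apply: (@smooth1D _ (fun x => 1 * A (2 * x)) (fun x => (-1) * A (1 * x + 0))).
      exact: smooth1_double.
    exact: smooth1_affine.
  - by move=> x x1; rewrite /a eta0// mulr0.
  - move=> x; rewrite /b mul1r addr0 mul1r ler_normr => /orP[x1|x1].
      by rewrite /A !F1; [ring|lra|lra].
    by rewrite /A (F0 (2 * x)) ?(F0 x); [ring|lra|lra].
  - by move=> x x1; rewrite /A (F0 x)// mulr0.
  - by move=> x x1; rewrite /A (F1 x)// mulVf// gt_eqF.
  - by move=> x; rewrite (_ : derive1n 1 b = derive1 b)// (derive1_ext bd).
have [P [sP Pb P0 P1]] := primitive_step sb b0.
have [w w1 w2] : exists2 w : R, w < 1 & w * 2 ^+ N.+1 = 1.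
  exists (2 ^- N.+1); last by rewrite mulVf// expf_neq0.
  by rewrite invf_lt1 ?exprn_gt0// exprn_egt1//; lra.
(* Writing [S f := 2 f(2t)], the weights make [S a' - a'] equal to the [N.+1]-st
   derivative of [- al (S b - b)], which is itself the derivative of [b']. *)
pose be := (1 - w)^-1; pose al := - w * be.
have albe : al + be = 1.
  by rewrite /al -[X in _ + X]mul1r -mulrDl addrC mulfV// subr_eq0 gt_eqF.
pose a' x := al * a (1 * x + 0) + be * 2 * a (2 * x).
pose A' x := al * A (1 * x + 0) + be * A (2 * x).
(* [P] may tend to a nonzero constant on the right; the difference of its two dilates is again
   supported in [[-1, 1]]. *)
pose b' x := (- al) * P (2 * x) + al * P (1 * x + 0).
have b'd x : is_derive (x : R) (1 : R) b' ((- al) * 2 * b (2 * x) + al * b (1 * x + 0)).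
  have d1 := @is_derive_double P b (- al) x Pb.
  have d2 : is_derive x 1 (fun x => al * P (1 * x + 0)) (al * 1 * b (1 * x + 0)).
    exact: is_derive_affine.
  by apply: is_derive_eq; rewrite mulr1.
have A'd x : is_derive (x : R) (1 : R) A' (a' x).
  have d1 := @is_derive_double A a be x Aa.
  have d2 : is_derive x 1 (fun x => al * A (1 * x + 0)) (al * 1 * a (1 * x + 0)).
    exact: is_derive_affine.
  by apply: is_derive_eq; rewrite mulr1.
exists a', b', A'; split; split => //.
- apply: (@smooth1D _ (fun x => al * a (1 * x + 0)) (fun x => be * 2 * a (2 * x))).
    exact: smooth1_affine.
  exact: smooth1_double.
- apply: (@smooth1D _ (fun x => (- al) * P (2 * x)) (fun x => al * P (1 * x + 0))).
    exact: smooth1_double.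
  exact: smooth1_affine.
- apply: (@smooth1D _ (fun x => al * A (1 * x + 0)) (fun x => be * A (2 * x))).
    exact: smooth1_affine.
  exact: smooth1_double.
- by move=> x x1; rewrite /a' a0 ?mul1r ?addr0// a0 ?normr_double// !mulr0 addr0.
- move=> x; rewrite /b' mul1r addr0 ler_normr => /orP[x1|x1].
    by rewrite !P1; [ring|lra|lra].
  by rewrite !P0; [ring|lra|lra].
- by move=> x x1; rewrite /A' mul1r addr0 !A0; [ring|lra|lra].
- by move=> x x1; rewrite /A' mul1r addr0 !A1; [rewrite !mulr1|lra|lra].
- move=> x; rewrite derive1Sn (derive1_ext b'd) derive1nD; last 2 first.
  + exact: smooth1_double.
  + exact: smooth1_affine.
  rewrite (derive1n_double _ _ sb) (derive1n_affine _ _ _ _ sb) expr1n mulr1.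
  move: (derive1n N.+1 b) ab => bN ab /=.
  rewrite -!ab /a' !mul1r !addr0.
  rewrite (_ : - al * 2 * 2 ^+ N.+1 = be * 2); last first.
    by transitivity (w * 2 ^+ N.+1 * (be * 2)); [rewrite /al; ring|rewrite w2 mul1r].
  rewrite (_ : al = 1 - be); last by rewrite -albe addrK.
  ring.
Qed.

End Kernel1.

(** * Tensor products of one-dimensional functions *)

Section Tensor.
Context (R : realType) (d : nat).
Local Notation Rd := (Rd R d).
Local Notation BRd := (BorelRd R d).
Local Notation L := (@lmeas R d).
Implicit Types (c : 'I_d -> R -> R) (f g : Rd -> R).

Lemma setcoord_id (x : Rd) i : setcoord x i (x 0 i) = x.
Proof. by apply/rowP => j; rewrite mxE; case: eqP => [->|]. Qed.

Lemma setcoord_evec (x : Rd) i (t h : R) :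
  h *: evec R i + setcoord x i t = setcoord x i (h + t).
Proof.
apply/rowP => j; rewrite !mxE eqxx/=; case: eqP => _; first by rewrite mulr1.
by rewrite mulr0 add0r.
Qed.

Lemma slice_quotient f (x : Rd) i t :
  (fun h : R => h^-1 *: ((f \o shift (setcoord x i t)) (h *: evec R i) - f (setcoord x i t))) =
  (fun h : R => h^-1 *: (((fun u => f (setcoord x i u)) \o shift t) (h *: (1 : R)) - f (setcoord x i t))).
Proof.
by apply/funext => h /=; rewrite setcoord_evec -[h *: 1]/(h * 1) mulr1.
Qed.

Lemma is_derive_slice f (x : Rd) i (t df : R) :
  is_derive (setcoord x i t) (evec R i) f df <->
  is_derive (t : R) (1 : R) (fun u => f (setcoord x i u)) df.
Proof.
by split=> -[]; rewrite /derivable /derive => h1 h2; split; move: h1 h2;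
  rewrite /derivable /derive slice_quotient.
Qed.

Definition tens c (x : Rd) : R := \prod_i c i (x 0 i).

Definition upd c (i : 'I_d) (h : R -> R) : 'I_d -> R -> R :=
  fun j => if j == i then h else c j.

Lemma tens_setcoord c x i t :
  tens c (setcoord x i t) = c i t * \prod_(j | j != i) c j (x 0 j).
Proof.
rewrite /tens (bigD1 i)//= mxE eqxx; congr (_ * _).
by apply: eq_bigr => j ji; rewrite mxE (negbTE ji).
Qed.

Lemma continuous_bigprod I (r : seq I) (F : I -> Rd -> R) :
  (forall i, continuous (F i)) -> continuous (fun x => \prod_(i <- r) F i x).
Proof.
move=> cF; elim: r => [|i r IH] x.
  rewrite (_ : (fun x => _) = cst 1); first exact: cst_continuous.
  by apply/funext => y; rewrite big_nil.
rewrite (_ : (fun x => _) = F i \* (fun x => \prod_(i <- r) F i x)); last first.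
  by apply/funext => y; rewrite big_cons.
by apply: continuousM; [exact: cF|exact: IH].
Qed.

Lemma continuous_bigsum I (r : seq I) (F : I -> Rd -> R) :
  (forall i, continuous (F i)) -> continuous (fun x => \sum_(i <- r) F i x).
Proof.
move=> cF; elim: r => [|i r IH] x.
  rewrite (_ : (fun x => _) = cst 0); first exact: cst_continuous.
  by apply/funext => y; rewrite big_nil.
rewrite (_ : (fun x => _) = F i \+ (fun x => \sum_(i <- r) F i x)); last first.
  by apply/funext => y; rewrite big_cons.
by apply: continuousD; [exact: cF|exact: IH].
Qed.

Lemma continuous_tens c : (forall i, continuous (c i)) -> continuous (tens c).
Proof.
move=> cc; apply: continuous_bigprod => i x.
by apply: continuous_comp; [exact: coord_continuous|exact: cc].
Qed.

Lemma is_derive_tens c x i : (forall j, smooth1 (c j)) ->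
  is_derive x (evec R i) (tens c) (tens (upd c i (derive1 (c i))) x).
Proof.
move=> sc; rewrite -{1}(setcoord_id x i); apply/is_derive_slice.
under [X in is_derive _ _ X _]eq_fun do rewrite tens_setcoord.
rewrite -{3}(setcoord_id x i) tens_setcoord /upd eqxx.
rewrite [X in _ * X](eq_bigr (fun j => c j (x 0 j))); last first.
  by move=> j /negbTE ->.
have := smooth1_is_derive (x 0 i) (sc i) => h.
under [X in is_derive _ _ X _]eq_fun do rewrite mulrC.
by apply: is_derive_eq; rewrite -[_ *: _]/(_ * _) mulrC.
Qed.

Lemma upd_smooth1 c i h : (forall j, smooth1 (c j)) -> smooth1 h ->
  forall j, smooth1 (upd c i h j).
Proof. by move=> sc sh j; rewrite /upd; case: ifP. Qed.

Definition dtens c (l : seq 'I_d) : 'I_d -> R -> R :=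
  fun i => derive1n (count_mem i l) (c i).

(** A class closed under partial derivatives that contains the test functions of the duality
    estimate. *)
Definition lincomb (J : finType) (s : J -> R) (c : J -> 'I_d -> R -> R) (x : Rd) : R :=
  \sum_j s j * tens (c j) x.

Lemma is_derive_lincomb (J : finType) (s : J -> R) (c : J -> 'I_d -> R -> R) x i :
  (forall j k, smooth1 (c j k)) ->
  is_derive x (evec R i) (lincomb s c)
    (lincomb s (fun j => upd (c j) i (derive1 (c j i))) x).
Proof.
move=> sc; rewrite /lincomb; elim: (index_enum J) => [|j r IH].
  under [X in is_derive _ _ X _]eq_fun do rewrite big_nil.
  by rewrite big_nil; exact: is_derive_cst.
under [X in is_derive _ _ X _]eq_fun do rewrite big_cons.
rewrite big_cons; apply: is_deriveD.
have h := is_derive_tens x i (sc j).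
by apply: is_derive_eq; rewrite -[_ *: _]/(_ * _).
Qed.

Lemma dtens_smooth1 c l : (forall j, smooth1 (c j)) -> forall j, smooth1 (dtens c l j).
Proof. by move=> sc j; apply: smooth1_derive1n. Qed.

Lemma upd_dtens c l i :
  upd (dtens c l) i (derive1 (dtens c l i)) = dtens c (i :: l).
Proof.
apply/funext => j; rewrite /upd /dtens /=; case: eqP => [->|/eqP ji].
  by rewrite eqxx add1n derive1nS.
by rewrite eq_sym (negbTE ji).
Qed.

Lemma foldr_pderiv_lincomb (J : finType) (s : J -> R) (c : J -> 'I_d -> R -> R) l :
  (forall j k, smooth1 (c j k)) ->
  foldr (@pderiv R d) (lincomb s c) l = lincomb s (fun j => dtens (c j) l).
Proof.
move=> sc; elim: l => [|i l IH] //=; rewrite IH; apply/funext => x.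
rewrite /pderiv; have := @is_derive_lincomb _ s (fun j => dtens (c j) l) x i.
move=> /(_ (fun j => dtens_smooth1 l (sc j))) /@derive_val ->.
by congr (lincomb s _ x); apply/funext => j; rewrite upd_dtens.
Qed.

Lemma smooth_lincomb (J : finType) (s : J -> R) (c : J -> 'I_d -> R -> R) :
  (forall j k, smooth1 (c j k)) -> smooth (lincomb s c).
Proof.
move=> sc l /=; rewrite foldr_pderiv_lincomb//; split.
  apply: continuous_bigsum => j x; apply: continuousM; first exact: cst_continuous.
  apply: continuous_tens => i; apply: smooth1_continuous; exact: dtens_smooth1.
move=> i x; have := @is_derive_lincomb _ s (fun j => dtens (c j) l) x i.
by move=> /(_ (fun j => dtens_smooth1 l (sc j))) /@ex_derive.
Qed.

(** [cderiv] iterates coordinate by coordinate while [smooth] speaks of lists of directions; [mlist]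
    translates between them. *)
Definition mlist (a : 'I_d -> nat) : seq 'I_d :=
  flatten [seq nseq (a i) i | i <- enum 'I_d].

Lemma cderivE (a : 'I_d -> nat) f : cderiv a f = foldr (@pderiv R d) f (mlist a).
Proof.
rewrite /cderiv /mlist; elim: (enum 'I_d) => //= i s ->.
by rewrite foldr_cat; elim: (a i) => //= n ->.
Qed.

Lemma count_mlist (a : 'I_d -> nat) i : count_mem i (mlist a) = a i.
Proof.
rewrite /mlist count_flatten -map_comp sumnE big_map.
rewrite big_enum/= (bigD1 i)//= count_nseq/= eqxx mul1n big1 ?addn0// => j ji.
by rewrite count_nseq/= (negbTE ji).
Qed.

Lemma cderiv_lincomb (J : finType) (s : J -> R) (c : J -> 'I_d -> R -> R) (a : 'I_d -> nat) :
  (forall j k, smooth1 (c j k)) ->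
  cderiv a (lincomb s c) = lincomb s (fun j i => derive1n (a i) (c j i)).
Proof.
move=> sc; rewrite cderivE foldr_pderiv_lincomb//; congr lincomb.
by apply/funext => j; apply/funext => i; rewrite /dtens count_mlist.
Qed.

Lemma tens_lincomb c : tens c = lincomb (fun _ : unit => 1) (fun _ => c).
Proof. by apply/funext => x; rewrite /lincomb big_const/= card_unit/= addr0 mul1r. Qed.

Lemma cderiv_tens c (a : 'I_d -> nat) : (forall k, smooth1 (c k)) ->
  cderiv a (tens c) = tens (fun i => derive1n (a i) (c i)).
Proof. by move=> sc; rewrite tens_lincomb cderiv_lincomb// -tens_lincomb. Qed.

Lemma smooth_tens c : (forall k, smooth1 (c k)) -> smooth (tens c).
Proof. by move=> sc; rewrite tens_lincomb; apply: smooth_lincomb. Qed.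

Lemma smooth_continuous f : smooth f -> continuous f.
Proof. by move=> /(_ [::])[]. Qed.

Lemma smooth_is_derive f x i : smooth f -> is_derive x (evec R i) f (pderiv i f x).
Proof. by move=> /(_ [::])[_ /= df]; apply/derivableP. Qed.

Lemma smooth_pderiv f i : smooth f -> smooth (pderiv i f).
Proof. by move=> sf s; have := sf (rcons s i); rewrite foldr_rcons. Qed.

Lemma continuous_setcoord (x : Rd) i : continuous (fun t : R => setcoord x i t : Rd).
Proof.
rewrite (_ : (fun t => _) = (fun t : R => t *: evec R i) \+ cst (setcoord x i 0)); last first.
  by apply/funext => t /=; rewrite setcoord_evec addr0.
by move=> t; apply: continuousD; [exact: scalel_continuous|exact: cst_continuous].
Qed.

Definition cube (M : R) : set Rd := box (const_mx (- M)) (const_mx M).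

Lemma cubeP M x : cube M x <-> forall i, `|x 0 i| <= M.
Proof. by split => h i; have := h i; rewrite !mxE -ler_norml. Qed.

Lemma compact_cube M : compact (cube M).
Proof.
rewrite (_ : cube M = [set v | forall i, `[- M, M]%classic (v ord0 i)]).
  exact: (@rV_compact R d (fun=> `[- M, M]%classic) (fun i => @segment_compact R _ _)).
by apply/seteqP; split => x /= h i; have := h i; rewrite !mxE/= in_itv.
Qed.

Lemma compact_norm_bound (A : set R) : compact A -> exists M, forall x, A x -> `|x| <= M.
Proof.
move=> /compact_bounded[M [Mr h]]; exists (M + 1) => x Ax.
by apply: (h (M + 1)) Ax; rewrite ltrDl.
Qed.

Lemma compact_sub_cube (K : set Rd) : compact K -> exists2 M, 0 < M & K `<=` cube M.
Proof.
move=> cK.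
have h i : exists M, forall x, K x -> `|x 0 i| <= M.
  have [|M hM] := @compact_norm_bound ((fun x : Rd => x 0 i) @` K).
    apply: continuous_compact => //; apply: continuous_subspaceT.
    exact: coord_continuous.
  by exists M => x Kx; apply: hM; exists x.
have [M hM] := choice h; exists (1 + \sum_i `|M i|).
  by rewrite ltr_pwDl// sumr_ge0.
move=> x Kx; apply/cubeP => i; rewrite (bigD1 i)//=; apply: le_trans (hM i x Kx) _.
rewrite addrCA; apply: le_trans (ler_norm _) _.
by rewrite lerDl addr_ge0// sumr_ge0.
Qed.

(** Compact support in terms of cubes, whose measure and coordinates are explicit. *)
Definition csupp (f : Rd -> R) := exists M, forall x, ~ cube M x -> f x = 0.

Lemma csupp_pderiv f i : csupp f -> csupp (pderiv i f).
Proof.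
move=> [M fM]; exists M => x /cubeP/existsNP[j /negP].
rewrite -ltNge => Mx; rewrite /pderiv.
rewrite (@near_eq_derive _ _ _ f (cst 0) x (evec R i)); first exact: derive_cst.
have cj : continuous (fun y : Rd => `|y 0 j|).
  move=> y; apply: (@continuous_comp _ _ _ (fun y : Rd => y 0 j)).
    exact: coord_continuous.
  exact: norm_continuous.
near=> y; rewrite fM//; move/cubeP => /(_ j); apply/negP; rewrite -ltNge.
near: y; exact: (cvgr_gt _ (cj x) _ Mx).
Unshelve. all: by end_near. Qed.

Lemma csupp_bounded f : continuous f -> csupp f ->
  exists M B, [/\ 0 <= M, 0 <= B & forall x, `|f x| <= B * \1_(cube M) x].
Proof.
move=> cf [M fM].
have [|B hB] := @compact_norm_bound (f @` cube M).
  by apply: continuous_compact (@compact_cube M); exact: continuous_subspaceT.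
exists `|M|, `|B|; split => // x; rewrite indicE.
have [/fM ->|/contrapT xM] := pselect (~ cube M x); first by rewrite normr0 mulr_ge0.
rewrite mem_set/= ?mulr1.
  by apply: le_trans (ler_norm B); apply: hB; exists x.
move/cubeP : xM => xM; apply/cubeP => i; exact: le_trans (ler_norm M).
Qed.

Local Open Scope ereal_scope.

Lemma cst_indic_integrable (A : set BRd) (B : R) : measurable A ->
  lmeas A < +oo -> L.-integrable setT (fun x => (B * \1_A x)%:E).
Proof.
move=> mA Aoo; under eq_fun do rewrite EFinM.
apply: integrableZl => //; apply/integrableP; split.
  by apply/measurable_EFinP; exact: measurable_indic.
under eq_integral do rewrite gee0_abs ?lee_fin//.
by rewrite integral_indic// setIT.
Qed.

Lemma measurable_cube M : measurable (cube M : set BRd).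
Proof. exact: measurable_box. Qed.

Lemma lmeas_cube_lty M : (lmeas (cube M) : \bar R) < +oo.
Proof.
have [M0|M0] := leP 0%R M.
  by rewrite lmeas_box ?ltry// => i; rewrite !mxE; lra.
apply: (@le_lt_trans _ _ (lmeas (cube 0))).
  apply: le_measure; rewrite ?inE; [exact: measurable_cube|exact: measurable_cube|].
  by move=> x /cubeP h; apply/cubeP => i; apply: (le_trans (h i)); exact: ltW.
by rewrite lmeas_box ?ltry// => i; rewrite !mxE; lra.
Qed.

Lemma integrable_csupp (f : BRd -> R) M B : measurable_fun [set: BRd] f ->
  (forall x, `|f x| <= B * \1_(cube M) x)%R -> L.-integrable setT (EFin \o f).
Proof.
move=> mf fB; apply: (@le_integrable _ _ _ L _ measurableT _ (fun x : BRd => (B * \1_(cube M : set BRd) x)%:E)).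
- exact/measurable_EFinP.
- by move=> x _ /=; rewrite lee_fin; apply: le_trans (fB x) (ler_norm _).
- by apply: cst_indic_integrable; [exact: measurable_cube|exact: lmeas_cube_lty].
Qed.

Lemma continuous_csupp_integrable f : continuous f -> csupp f ->
  L.-integrable setT (EFin \o (f : BRd -> R)).
Proof.
move=> cf sf; have [M [B [_ _ fB]]] := csupp_bounded cf sf.
exact: integrable_csupp (continuous_borel cf) fB.
Qed.

Lemma integral_derive_csupp (F f : R -> R) M :
  (forall x, is_derive (x : R) (1%R : R) F (f x)) -> continuous f ->
  (forall x, M < `|x| -> F x = 0)%R ->
  (@lebesgue_measure R).-integrable setT (EFin \o f) /\
  \int[lebesgue_measure]_x (f x)%:E = 0.
Proof.
move=> Ff cf F0.
have f0 x : (M < `|x|)%R -> f x = 0%R.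
  move=> Mx; have := Ff x; rewrite -(derive1_ext Ff) derive1E => _.
  rewrite (@near_eq_derive _ _ _ F (cst 0%R) x 1%R); first exact: derive_cst.
  near=> y; apply: F0; near: y.
  exact: (cvgr_gt _ (@norm_continuous _ R x) _ Mx).
pose N := (`|M| + 1)%R.
have N0 : (- N < N)%R by rewrite /N; have := normr_ge0 M; lra.
have MN : (M < N)%R by rewrite /N; have := ler_norm M; lra.
have fE : EFin \o f = (EFin \o f) \_ `[(- N)%R, N].
  apply/funext => x; rewrite patchE; case: ifPn => // /=; rewrite notin_setE/= in_itv/=.
  rewrite -ler_norml => /negP; rewrite -ltNge => Nx; rewrite f0//.
  exact: lt_trans Nx.
have fi : (@lebesgue_measure R).-integrable `[(- N)%R, N] (EFin \o f).
  apply: continuous_compact_integrable; first exact: segment_compact.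
  exact: continuous_subspaceT.
split; first by rewrite fE; apply: (iffLR (integrable_mkcond _ _)).
rewrite -[LHS]/(\int[lebesgue_measure]_x (EFin \o f) x) fE -integral_mkcond.
rewrite (FTC_is_derive N0 Ff cf) !F0 ?subrr//.
- by rewrite normrN ger0_norm// /N; have := normr_ge0 M; lra.
- by rewrite ger0_norm// /N; have := normr_ge0 M; lra.
Unshelve. all: by end_near. Qed.

Lemma fin_sube0 (a b : \bar R) : a \is a fin_num -> b \is a fin_num ->
  a - b = 0 -> a = b.
Proof.
move: a b => [a| |] [b| |]// _ _; rewrite -EFinB => -[] /eqP.
by rewrite subr_eq0 => /eqP ->.
Qed.

(** [lint_slice] concerns nonnegative functions, so a vanishing slice integral is used as equality
    of the slice integrals of the positive and negative parts; their iterated integrals then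
    agree. *)
Lemma integral_slice0 (F : BRd -> R) i : L.-integrable setT (EFin \o F) ->
  (forall x, (@lebesgue_measure R).-integrable setT (fun t => (F (setcoord x i t))%:E) /\
    \int[lebesgue_measure]_t (F (setcoord x i t))%:E = 0) ->
  \int[L]_x (F x)%:E = 0.
Proof.
move=> iF F0; have mF := measurable_int _ iF.
have [s hs] := lint_slice R i.
have mP : measurable_fun [set: BRd] (EFin \o F)^\+ by exact: measurable_funepos.
have mN : measurable_fun [set: BRd] (EFin \o F)^\- by exact: measurable_funeneg.
have fN := integrable_neg_fin_num measurableT iF.
rewrite integralE -[X in _ - X]lint_ge0E// -[X in X - _]lint_ge0E//.
rewrite -lint_ge0E// in fN; rewrite !hs// in fN *.
rewrite [X in X - _](_ : _ = iter_lint s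
   (fun y => \int[lebesgue_measure]_t (EFin \o F)^\- (setcoord y i t)) 0%R).
  by rewrite subee.
apply: eq_iter_lint => y; have [iy] := F0 y.
rewrite integralE => /eqP.
have := integrable_pos_fin_num measurableT iy; have := integrable_neg_fin_num measurableT iy.
move=> h1 h2 /eqP h; transitivity (\int[lebesgue_measure]_t (fun t => (F (setcoord y i t))%:E)^\+ t).
  by apply: eq_integral => t _; rewrite !funeposE.
rewrite (fin_sube0 h2 h1 h).
by apply: eq_integral => t _; rewrite !funenegE.
Qed.

Lemma csuppM f g : csupp g -> csupp (fun x => f x * g x)%R.
Proof. by move=> [M gM]; exists M => x xM; rewrite gM ?mulr0. Qed.

Lemma integrable_mul_csupp f g : continuous f -> continuous g -> csupp g ->
  L.-integrable setT (fun x : BRd => (f x * g x)%:E).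
Proof.
move=> cf cg sg; apply: (@continuous_csupp_integrable (fun x => f x * g x)%R).
  by move=> x; apply: continuousM; [exact: cf|exact: cg].
exact: csuppM.
Qed.

(** The two integrands add up to the [i]-th partial derivative of [tens c * g], whose slices in
    direction [i] have compact support and hence integrate to zero. *)
Lemma integral_by_parts_tens c g i : (forall j, smooth1 (c j)) -> smooth g -> csupp g ->
  \int[L]_x (tens c x * pderiv i g x)%:E =
  - \int[L]_x (tens (upd c i (derive1 (c i))) x * g x)%:E.
Proof.
move=> sc sg [M gM]; set c' := upd _ _ _.
have sc' : forall j, smooth1 (c' j).
  by apply: upd_smooth1 => //; exact: smooth1_derive1.
have ct : continuous (tens c) by apply: continuous_tens => j; exact: smooth1_continuous.
have ct' : continuous (tens c') by apply: continuous_tens => j; exact: smooth1_continuous.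
have cg := smooth_continuous sg.
have cg' := smooth_continuous (smooth_pderiv i sg).
have sug : csupp g by exists M.
have i1 := integrable_mul_csupp ct cg' (csupp_pderiv i sug).
have i2 := integrable_mul_csupp ct' cg sug.
suff : \int[L]_x (tens c x * pderiv i g x)%:E + \int[L]_x (tens c' x * g x)%:E = 0.
  have := integrable_fin_num measurableT i2; have := integrable_fin_num measurableT i1.
  move: (\int[L]_x _) (\int[L]_x _) => [a| |] [b| |]// _ _.
  by rewrite -EFinD => -[] /eqP; rewrite addr_eq0 => /eqP ->.
rewrite -integralD//.
pose F := (fun x => tens c x * pderiv i g x + tens c' x * g x)%R.
have -> : \int[L]_x ((tens c x * pderiv i g x)%:E + (tens c' x * g x)%:E) = \int[L]_x (F x)%:E.
  by [].
have cF : continuous F.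
  move=> x; apply: (@continuousD _ _ _ (fun x => tens c x * pderiv i g x)%R (fun x => tens c' x * g x)%R).
    by apply: continuousM; [exact: ct|exact: cg'].
  by apply: continuousM; [exact: ct'|exact: cg].
apply: (@integral_slice0 F i).
  by apply: (integrableD measurableT i1 i2).
move=> x.
have setc := @continuous_setcoord x i.
apply: (@integral_derive_csupp (fun t => tens c (setcoord x i t) * g (setcoord x i t))%R
   (fun t => F (setcoord x i t)) M).
- move=> t; have /is_derive_slice h1 := is_derive_tens (setcoord x i t) i sc.
  have /is_derive_slice h2 := smooth_is_derive (setcoord x i t) i sg.
  apply: is_derive_eq; rewrite /F -/c' -![_ *: _]/(_ * _)%R.
  by rewrite [X in (_ + X = _)%R]mulrC.
- by move=> t; apply: continuous_comp; [exact: setc|exact: cF].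
- move=> t Mt; rewrite gM ?mulr0//; move/cubeP => /(_ i); rewrite mxE eqxx.
  by rewrite leNgt Mt.
Qed.

Lemma dtens_upd c l i : (forall j, smooth1 (c j)) ->
  dtens (upd c i (derive1 (c i))) l = dtens c (i :: l).
Proof.
move=> sc; apply/funext => j; rewrite /upd /dtens /=; case: eqP => [->|/eqP ji].
  by rewrite eqxx add1n derive1Sn.
by rewrite eq_sym (negbTE ji).
Qed.

Lemma size_mlist (a : 'I_d -> nat) : size (mlist a) = mindex_size a.
Proof.
rewrite /mlist size_flatten /shape -map_comp sumnE big_map big_enum/=.
by apply: eq_bigr => i _; rewrite /= size_nseq.
Qed.

Lemma csupp_foldr_pderiv g l : csupp g -> csupp (foldr (@pderiv R d) g l).
Proof. by move=> sg; elim: l => //= i l; exact: csupp_pderiv. Qed.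

Lemma smooth_foldr_pderiv g l : smooth g -> smooth (foldr (@pderiv R d) g l).
Proof.
move=> sg; elim: l => [|i l IH]; [exact: sg|exact: smooth_pderiv].
Qed.

Lemma integral_tens_cderiv c g a : (forall j, smooth1 (c j)) -> smooth g -> csupp g ->
  \int[L]_x (tens c x * cderiv a g x)%:E =
  ((-1) ^+ mindex_size a)%:E * \int[L]_x (tens (fun i => derive1n (a i) (c i)) x * g x)%:E.
Proof.
move=> + sg ug; rewrite cderivE -size_mlist => sc.
have -> : (fun i => derive1n (a i) (c i)) = dtens c (mlist a).
  by apply/funext => i; rewrite /dtens count_mlist.
elim: (mlist a) c sc => [|i l IH] c sc /=.
  by rewrite expr0 mul1e; congr (\int[L]_x (tens _ x * g x)%:E); apply/funext => i.
have sgl := smooth_foldr_pderiv l sg.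
rewrite (integral_by_parts_tens i sc sgl); last exact: csupp_foldr_pderiv.
rewrite IH; last by apply: upd_smooth1 => //; exact: smooth1_derive1.
by rewrite dtens_upd// exprS mulN1r EFinN mulNe.
Qed.

Lemma test_function_csupp g : test_function g -> smooth g /\ csupp g.
Proof.
move=> [sg [K [cK gK]]]; split => //.
have [M M0 KM] := compact_sub_cube cK.
by exists M => x xM; apply: gK => /KM.
Qed.

Lemma csupp_test_function g : smooth g -> csupp g -> test_function g.
Proof.
move=> sg [M gM]; split => //; exists (cube M); split => //; exact: compact_cube.
Qed.

Lemma lintRE (f : Rd -> R) : borel_measurable f -> lintR f = \int[L]_x (f x)%:E.
Proof.
move=> mf; rewrite /lintR integralE; have mfE : measurable_fun [set: BRd] (EFin \o f).
  exact/measurable_EFinP.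
have mP : measurable_fun [set: BRd] (EFin \o f)^\+ by exact: measurable_funepos.
have mN : measurable_fun [set: BRd] (EFin \o f)^\- by exact: measurable_funeneg.
rewrite -[X in _ = _ - X]lint_ge0E// -[X in _ = X - _]lint_ge0E//; congr (_ - _).
- by apply: eq_iter_lint => x; rewrite funeposE EFin_max.
- by apply: eq_iter_lint => x; rewrite funenegE EFin_max EFinN.
Qed.

Lemma lint_absE (f : Rd -> R) : borel_measurable f ->
  lint (fun x => `|f x|%:E) = \int[L]_x `|(f x)%:E|.
Proof.
move=> mf; rewrite lint_ge0E//.
by apply/measurable_EFinP; apply: measurableT_comp.
Qed.

Lemma lebesgue_integrableP (f : Rd -> R) :
  lebesgue_integrable f <-> L.-integrable setT (EFin \o f).
Proof.
split=> [[mf]|/integrableP[/measurable_EFinP mf foo]].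
  by rewrite lint_absE// => foo; apply/integrableP; split => //; exact/measurable_EFinP.
by split => //; rewrite lint_absE.
Qed.

End Tensor.

(** * Finite measures given by densities, and sums of finite measures *)

Section DensityMeasure.
Context dd (T : measurableType dd) (R : realType) (mu : {measure set T -> \bar R}).
Variable h : T -> R.
Hypothesis h0 : forall x, 0 <= h x.
Hypothesis ih : mu.-integrable setT (EFin \o h).

Local Open Scope ereal_scope.

(** The two proofs are arguments of the definition so that the measure instances depending on them
    can be inferred from the term. *)
Definition density_measure of (forall x, 0 <= h x)%R & mu.-integrable setT (EFin \o h) :=
  fun A : set T => \int[mu]_(x in A) (h x)%:E.

Local Notation dm := (density_measure h0 ih).

Let mh : measurable_fun setT (EFin \o h). Proof. exact: measurable_int ih. Qed.

Let dm0 : dm set0 = 0. Proof. exact: integral_set0. Qed.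

Let dm_ge0 A : 0 <= dm A.
Proof. by apply: integral_ge0 => x _; rewrite lee_fin. Qed.

Let dm_sigma_additive : semi_sigma_additive dm.
Proof. by apply: semi_sigma_additive_nng_induced => // x; rewrite lee_fin. Qed.

HB.instance Definition _ := isMeasure.Build _ _ _ dm dm0 dm_ge0 dm_sigma_additive.

Let dm_fin : fin_num_fun dm.
Proof.
move=> A mA; apply: integrable_fin_num => //; exact: integrableS ih.
Qed.

HB.instance Definition _ := Measure_isFinite.Build _ _ _ dm dm_fin.

Lemma ge0_integral_density_measure (f : T -> \bar R) : measurable_fun setT f ->
  (forall x, 0 <= f x) -> \int[dm]_x f x = \int[mu]_x (f x * (h x)%:E).
Proof.
move=> mf f0; have hE0 x : 0 <= (h x)%:E by rewrite lee_fin.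
have mh' g : measurable_fun setT g -> measurable_fun setT (fun x => g x * (h x)%:E).
  by move=> mg; exact: emeasurable_funM.
apply/esym; apply: (@monotone_functional_integral _ T R dm
  (fun f => \int[mu]_x (f x * (h x)%:E))) => //.
- move=> r g r0 g0 mg; rewrite -ge0_integralZl_EFin//; last 2 first.
  + by move=> x _; rewrite mule_ge0.
  + exact: mh'.
  by apply: eq_integral => x _; rewrite muleA.
- move=> s g g0 mg; rewrite -ge0_integral_sum//; last 2 first.
  + by move=> i; exact: mh'.
  + by move=> i x _; rewrite mule_ge0.
  by apply: eq_integral => x _; rewrite ge0_sume_distrl.
- move=> g g0 mg ndg; rewrite -monotone_convergence//; last 3 first.
  + by move=> n; exact: mh'.
  + by move=> n x _; rewrite mule_ge0.
  + by move=> x _ m n mn; apply: lee_pmul => //; exact: ndg.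
  apply: eq_integral => x _; apply/esym/cvg_lim => //; apply: cvgeZr => //.
  by apply: ereal_nondecreasing_is_cvgn; exact: ndg.
- move=> A mA; rewrite /density_measure [RHS]integral_mkcond; apply: eq_integral => x _.
  by rewrite patchE indicE; case: ifPn => _; rewrite ?mul1e ?mul0e.
Qed.

Lemma integral_density_measure (f : T -> R) : measurable_fun setT f ->
  \int[dm]_x (f x)%:E = \int[mu]_x (f x * h x)%:E.
Proof.
move=> mf; have mfE : measurable_fun setT (EFin \o f) by exact/measurable_EFinP.
rewrite [LHS]integralE [RHS]integralE; congr (_ - _).
- rewrite ge0_integral_density_measure//; last exact: measurable_funepos.
  apply: eq_integral => x _; rewrite !funeposE EFinM.
  rewrite -!EFin_max -!EFinM; congr EFin; rewrite maxr_pMl//; first by rewrite mul0r.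
- rewrite ge0_integral_density_measure//; last exact: measurable_funeneg.
  apply: eq_integral => x _; rewrite !funenegE -!EFinN.
  by rewrite -!EFin_max -!EFinM; congr EFin; rewrite maxr_pMl// mul0r mulNr.
Qed.

End DensityMeasure.

Section FiniteMeasureAdd.
Context dd (T : measurableType dd) (R : realType).
Variables m1 m2 : {finite_measure set T -> \bar R}.

Local Open Scope ereal_scope.

(** The difference of the signed measures [m1 - m2] and [P - N] is represented by the pair
    [madd m1 N], [madd m2 P], so that only finite positive measures are handled. *)
Definition madd (A : set T) : \bar R := m1 A + m2 A.

Let maddE : madd = measure_add m1 m2.
Proof. by apply/funext => A; rewrite measure_addE. Qed.

Let madd0 : madd set0 = 0. Proof. by rewrite /madd !measure0 adde0. Qed.

Let madd_ge0 A : 0 <= madd A. Proof. by rewrite /madd adde_ge0. Qed.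

Let madd_sigma_additive : semi_sigma_additive madd.
Proof. by rewrite maddE; exact: measure_semi_sigma_additive. Qed.

HB.instance Definition _ := isMeasure.Build _ _ _ madd madd0 madd_ge0 madd_sigma_additive.

Let madd_fin : fin_num_fun madd.
Proof.
by move=> A mA; rewrite fin_numD; apply/andP; split; exact: fin_num_measure.
Qed.

HB.instance Definition _ := Measure_isFinite.Build _ _ _ madd madd_fin.

Lemma integral_madd (f : T -> \bar R) :
  m1.-integrable setT f -> m2.-integrable setT f ->
  \int[madd]_x f x = \int[m1]_x f x + \int[m2]_x f x.
Proof.
move=> i1 i2; rewrite -integral_measure_add//.
by apply: eq_measure_integral => A mA _; rewrite /= maddE.
Qed.

End FiniteMeasureAdd.

Lemma integrable_bounded dd (T : measurableType dd) (R : realType)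
    (m : {finite_measure set T -> \bar R}) (f : T -> R) (B : R) : measurable_fun setT f ->
  (forall x, `|f x| <= B) -> m.-integrable setT (EFin \o f).
Proof.
move=> mf fB; apply: measurable_bounded_integrable => //; first exact: fin_num_fun_lty.
exists B; split; first exact: num_real.
by move=> x Bx t _ /=; apply: le_trans (fB t) (ltW Bx).
Qed.

(** * Tensor kernels *)

Section Kernel.
Context (R : realType) (d : nat).
Local Notation Rd := (Rd R d).
Local Notation BRd := (BorelRd R d).
Local Notation L := (@lmeas R d).
Implicit Types (chi : 'I_d -> R -> R) (del : R) (x y z : Rd).

Definition ker del chi : Rd -> R := tens (fun i t => del^-1 * chi i (del^-1 * t)).

(** The function [y -> ker del chi (x - y)] as a tensor in [y], with affine arguments so that
    [derive1n_affine] applies. *)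
Definition rker del chi x : 'I_d -> R -> R :=
  fun i t => del^-1 * chi i ((- del^-1) * t + del^-1 * x 0 i).

Definition dfam (a : 'I_d -> nat) chi : 'I_d -> R -> R := fun i => derive1n (a i) (chi i).

Definition bump_fam chi := (forall i, smooth1 (chi i)) /\
  forall i t, 1 < `|t| -> chi i t = 0.

Lemma rkerE del chi x y : tens (rker del chi x) y = ker del chi (x - y).
Proof.
apply: eq_bigr => i _; rewrite /rker !mxE; congr (_ * chi i _); ring.
Qed.

Lemma smooth1_rker del chi x : (forall i, smooth1 (chi i)) ->
  forall i, smooth1 (rker del chi x i).
Proof. by move=> sc i; apply: smooth1_affine. Qed.

Lemma derive_rker del chi (a : 'I_d -> nat) x y : (forall i, smooth1 (chi i)) ->
  tens (fun i => derive1n (a i) (rker del chi x i)) y =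
  (- del^-1) ^+ mindex_size a * ker del (dfam a chi) (x - y).
Proof.
move=> sc; rewrite -rkerE /tens /mindex_size -prodrXr -big_split/=.
apply: eq_bigr => i _; rewrite /rker derive1n_affine// /dfam mulrA; congr (_ * _).
by rewrite mulrC.
Qed.

Lemma derive1_supp (f : R -> R) : (forall t, 1 < `|t| -> f t = 0) ->
  forall t, 1 < `|t| -> derive1 f t = 0.
Proof.
move=> f0 t t1; rewrite derive1E (@near_eq_derive _ _ _ f (cst 0) t 1).
  exact: derive_cst.
near=> y; apply: f0; near: y; exact: (cvgr_gt _ (@norm_continuous _ R t) _ t1).
Unshelve. all: by end_near. Qed.

Lemma bump_fam_dfam a chi : bump_fam chi -> bump_fam (dfam a chi).
Proof.
move=> [sc c0]; split => i; first exact: smooth1_derive1n.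
rewrite /dfam; elim: (a i) => [|n IH]; first exact: c0.
by rewrite derive1nS; exact: derive1_supp.
Qed.

Lemma bump_fam_bound chi : bump_fam chi ->
  exists2 B, 1 <= B & forall i t, `|chi i t| <= B.
Proof.
move=> [sc c0].
have h i : exists M, forall t, `|chi i t| <= M.
  have [|M hM] := @compact_norm_bound R (chi i @` `[-1, 1]%classic).
    apply: continuous_compact; last exact: segment_compact.
    by apply: continuous_subspaceT; exact: smooth1_continuous.
  exists `|M| => t; have [t1|t1] := leP `|t| 1.
    apply: le_trans (ler_norm M); apply: hM; exists t => //=.
    by rewrite in_itv/= -ler_norml.
  by rewrite c0// normr0.
have [M hM] := choice h; exists (1 + \sum_i `|M i|).
  by rewrite lerDl sumr_ge0.
move=> i t; rewrite (bigD1 i)//=; apply: le_trans (hM i t) _.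
rewrite addrCA; apply: le_trans (ler_norm _) _.
by rewrite lerDl addr_ge0// sumr_ge0.
Qed.

Lemma cube_indic (M : R) z : \1_(cube M) z = \prod_(i < d) (`|z 0 i| <= M)%R%:R :> R.
Proof.
rewrite indicE; have [zM|zM] := pselect (cube M z).
  by rewrite mem_set// big1// => i _; move/cubeP : zM => ->.
rewrite memNset//; move/cubeP/existsNP : zM => [i /negP/negbTE zi].
by rewrite (bigD1 i)//= zi mul0r.
Qed.

Lemma ker_bound del chi (B : R) z : 0 < del -> bump_fam chi ->
  (forall i t, `|chi i t| <= B) ->
  `|ker del chi z| <= (B / del) ^+ d * \1_(cube del) z.
Proof.
move=> del0 [sc c0] cB; rewrite cube_indic /ker /tens normr_prod.
have -> : (B / del) ^+ d = \prod_(i < d) (B / del) by rewrite prodr_const card_ord.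
rewrite -big_split/=; apply: ler_prod => i _; rewrite normr_ge0/= normrM.
have d0 : 0 <= del^-1 by rewrite invr_ge0 ltW.
have [zi|zi] := leP `|z 0 i| del.
  by rewrite mulr1 (ger0_norm d0) mulrC ler_wpM2r.
rewrite c0 ?normr0 ?mulr0// normrM ger0_norm// mulrC.
by rewrite ltr_pdivlMr// mul1r.
Qed.

Lemma continuous_ker del chi : bump_fam chi -> continuous (ker del chi).
Proof.
move=> [sc _]; apply: continuous_tens => i.
have := smooth1_affine del^-1 del^-1 0 (sc i).
under [X in smooth1 X -> _]eq_fun do rewrite addr0.
exact: smooth1_continuous.
Qed.

Lemma measurable_ker del chi : bump_fam chi -> measurable_fun [set: BRd] (ker del chi : BRd -> R).
Proof. by move=> bc; apply: continuous_borel; exact: continuous_ker. Qed.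

Lemma measurable_ker_sub del chi : bump_fam chi ->
  measurable_fun [set: BRd * BRd] (fun p : BRd * BRd => ker del chi ((p.1 : Rd) - p.2)).
Proof. by move=> bc; apply: (measurableT_comp (measurable_ker del bc) (@measurable_subr R d)). Qed.

Lemma measurable_kerl del chi x : bump_fam chi ->
  measurable_fun [set: BRd] (fun y : BRd => ker del chi (x - y)).
Proof.
move=> bc; exact: (measurableT_comp (measurable_ker_sub del bc) (pair1_measurable (x : BRd))).
Qed.

Lemma measurable_kerr del chi y : bump_fam chi ->
  measurable_fun [set: BRd] (fun x : BRd => ker del chi ((x : Rd) - y)).
Proof.
move=> bc; exact: (measurableT_comp (measurable_ker_sub del bc) (pair2_measurable (y : BRd))).
Qed.

Lemma ker_bounded del chi : 0 < del -> bump_fam chi ->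
  exists2 C, 0 <= C & forall z, `|ker del chi z| <= C.
Proof.
move=> d0 bc; have [B B1 cB] := bump_fam_bound bc.
have C0 : 0 <= (B / del) ^+ d by rewrite exprn_ge0// divr_ge0 ?(ltW d0)// (le_trans ler01).
exists ((B / del) ^+ d) => // z; apply: le_trans (ker_bound z d0 bc cB) _.
by rewrite ler_piMr// indicE; case: (_ \in _).
Qed.

Lemma integrable_kerl (m : {finite_measure set BRd -> \bar R}) del chi x : 0 < del ->
  bump_fam chi -> m.-integrable setT (EFin \o (fun y : BRd => ker del chi (x - y))).
Proof.
move=> d0 bc; have [C _ kC] := ker_bounded d0 bc.
by apply: (@integrable_bounded _ _ _ _ _ C) => //; exact: measurable_kerl.
Qed.

Lemma lmeas_box_ball x del : 0 <= del ->
  L (box (x - const_mx del) (x + const_mx del)) = ((2 * del) ^+ d)%:E.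
Proof.
move=> d0; rewrite lmeas_box; last by move=> i; rewrite !mxE; lra.
congr EFin; rewrite -[d in RHS]card_ord -prodr_const; apply: eq_bigr => i _.
by rewrite !mxE; ring.
Qed.

Lemma cube_sub del x y : cube del (x - y) <-> box (x - const_mx del) (x + const_mx del) y.
Proof.
split=> [/cubeP h i|h]; [|apply/cubeP => i]; have := h i; rewrite !mxE ler_norml => /andP[]; lra.
Qed.

Lemma cubeN del x y : cube del (x - y) <-> cube del (y - x).
Proof. by split=> /cubeP h; apply/cubeP => i; have := h i; rewrite !mxE distrC. Qed.

Lemma integral_box_indic C x del : 0 <= C -> 0 <= del ->
  (\int[L]_y (C * \1_(box (x - const_mx del) (x + const_mx del)) y)%:E =
   (C * (2 * del) ^+ d)%:E)%E.
Proof.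
move=> C0 d0; under eq_integral do rewrite EFinM.
have mb := @measurable_box R d (x - const_mx del) (x + const_mx del).
rewrite ge0_integralZl_EFin//; last exact/measurable_EFinP/measurable_indic.
by rewrite integral_indic//= setIT lmeas_box_ball// EFinM.
Qed.

(** Height [(B / del)^d] times volume [(2 del)^d]: the scale cancels, and the kernels are bounded in
    L^1 uniformly in [del]. *)
Lemma integral_ball_bound (g : BRd -> R) del (B : R) x : 0 < del -> 0 <= B ->
  measurable_fun setT g -> (forall y, `|g y| <= (B / del) ^+ d * \1_(cube del) (x - y)) ->
  (\int[L]_y `|(g y)%:E| <= ((2 * B) ^+ d)%:E)%E.
Proof.
move=> d0 B0 mg gB; have BC : 0 <= (B / del) ^+ d by rewrite exprn_ge0// divr_ge0// ltW.
have -> : (2 * B) ^+ d = (B / del) ^+ d * (2 * del) ^+ d.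
  by rewrite -exprMn; congr (_ ^+ _); field; rewrite gt_eqF.
rewrite -(integral_box_indic x BC (ltW d0)); apply: ge0_le_integral => //.
- by apply: measurableT_comp => //; exact/measurable_EFinP.
- apply/measurable_EFinP; apply: measurable_funM => //; apply: measurable_indic; exact: measurable_box.
- move=> y _ /=; rewrite lee_fin; apply: le_trans (gB y) _; rewrite !indicE.
  rewrite (_ : (_ \in cube _) = (y \in box (x - const_mx del) (x + const_mx del)))//.
  by apply/idP/idP; rewrite !inE => /cube_sub.
Qed.

Lemma integral_ker_le del chi (B : R) x : 0 < del -> bump_fam chi -> 0 <= B ->
  (forall i t, `|chi i t| <= B) ->
  (\int[L]_y `|(ker del chi (x - y))%:E| <= ((2 * B) ^+ d)%:E)%E.
Proof.
move=> d0 bc B0 cB; apply: (@integral_ball_bound _ del B x) => //; first exact: measurable_kerl.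
by move=> y; exact: ker_bound.
Qed.

Lemma integral_ker_ler del chi (B : R) y : 0 < del -> bump_fam chi -> 0 <= B ->
  (forall i t, `|chi i t| <= B) ->
  (\int[L]_x `|(ker del chi ((x : Rd) - y))%:E| <= ((2 * B) ^+ d)%:E)%E.
Proof.
move=> d0 bc B0 cB; apply: (@integral_ball_bound _ del B y) => //; first exact: measurable_kerr.
move=> x; apply: le_trans (ker_bound _ d0 bc cB) _; rewrite !indicE.
rewrite (_ : (_ \in cube _) = ((y - x : Rd) \in cube del))//.
by apply/idP/idP; rewrite !inE => /cubeN.
Qed.

End Kernel.

(** * Young functions and Luxemburg norms *)

Section Young.
Context (R : realType) (e : R -> R).
Hypothesis ye : young e.

Lemma youngN s : e (- s) = e s. Proof. by case: ye. Qed.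
Lemma young_ge0 s : 0 <= e s. Proof. by case: ye. Qed.
Lemma young0 : e 0 = 0. Proof. by case: ye. Qed.

Lemma young_abs s : e `|s| = e s.
Proof. by have [s0|s0] := ltP s 0; [rewrite ltr0_norm// youngN|rewrite ger0_norm]. Qed.

Lemma young_convex x y t : 0 <= t <= 1 -> e (t * x + (1 - t) * y) <= t * e x + (1 - t) * e y.
Proof.
case: ye => _ cv _ _ /andP[]; rewrite le_eqVlt => /predU1P[<- _|t0].
  by rewrite subr0 !mul0r !mul1r !add0r.
rewrite le_eqVlt => /predU1P[->|t1].
  by rewrite subrr !mul0r !mul1r !addr0.
have [->|xy] := eqVneq x y; last by apply/ltW/cv => //; rewrite t0.
by rewrite -!mulrDl addrCA subrr addr0 !mul1r.
Qed.

Lemma young_scale t x : 0 <= t <= 1 -> e (t * x) <= t * e x.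
Proof.
by move=> t01; have := young_convex x 0 t01; rewrite young0 !mulr0 !addr0.
Qed.

Lemma young_le x y : `|x| <= `|y| -> e x <= e y.
Proof.
move=> xy; have [y0|y0] := eqVneq y 0.
  by move: xy; rewrite y0 normr0 normr_le0 => /eqP ->.
have y1 : 0 < `|y| by rewrite normr_gt0.
rewrite -(young_abs x) -(young_abs y) -[X in e X <= _](divfK (lt0r_neq0 y1)).
have t01 : 0 <= `|x| / `|y| <= 1.
  by rewrite divr_ge0//= ler_pdivrMr// mul1r.
apply: le_trans (young_scale _ t01) _.
by apply: ler_piMl; [exact: young_ge0|case/andP: t01].
Qed.

Lemma young_gt0 s : s != 0 -> 0 < e s.
Proof.
case: ye => ev cv _ e0 s0.
have ss : s != - s by rewrite -subr_eq0 opprK -mulr2n mulrn_eq0.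
have half0 : 0 < (2^-1 : R) by rewrite invr_gt0.
have half1 : (2^-1 : R) < 1 by lra.
have := cv s (- s) 2^-1 ss; rewrite half0 half1 => /(_ isT); rewrite ev mulrN.
have -> : (1 - 2^-1 : R) = 2^-1 by lra.
rewrite subrr e0; lra.
Qed.

Lemma young_lin s : 1 <= s -> s * e 1 <= e s.
Proof.
move=> s1; have s0 : 0 < s by exact: lt_le_trans s1.
have t01 : 0 <= s^-1 <= 1 by rewrite invr_ge0 ltW//= invf_le1.
by have := young_scale s t01; rewrite mulVf ?gt_eqF// ler_pdivlMl.
Qed.

(** At least linear growth away from 0; this embeds the Orlicz space into L^1_loc and bounds the
    sets defining [einv]. *)
Lemma young_lin_bound s : `|s| <= 1 + e s / e 1.
Proof.
have e1 : 0 < e 1 by apply: young_gt0; rewrite oner_eq0.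
have [s1|/ltW s1] := leP `|s| 1.
  by apply: le_trans s1 _; rewrite lerDl divr_ge0// ?young_ge0// ltW.
apply: (@le_trans _ _ (e s / e 1)); last by rewrite lerDr.
by rewrite ler_pdivlMr// -(young_abs s); exact: young_lin.
Qed.

(** [y] is the convex combination of [y + 1] and [x] with weight [t <= y - x] on [y + 1], so
    convexity controls the increment. Continuity and measurability of [e] follow. *)
Lemma young_lip M x y : x <= y -> `|x| <= M -> `|y| <= M ->
  e y - e x <= (y - x) * e (M + 1).
Proof.
move=> xy xM yM; have d0 : 0 < y + 1 - x by lra.
pose t := (y - x) / (y + 1 - x).
have t01 : 0 <= t <= 1.
  by apply/andP; split; [apply: divr_ge0; lra|rewrite ler_pdivrMr// mul1r; lra].
have := young_convex (y + 1) x t01.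
have -> : t * (y + 1) + (1 - t) * x = y.
  by rewrite /t; field; rewrite gt_eqF.
move=> h; have eM : e (y + 1) <= e (M + 1).
  apply: young_le; rewrite [leRHS]ger0_norm; last by have := normr_ge0 x; lra.
  by apply: le_trans (ler_normD _ _) _; rewrite normr1; lra.
have tx : t <= y - x by rewrite /t ler_pdivrMr//; nra.
have := young_ge0 x; have := young_ge0 (M + 1); case/andP: t01 => t0 t1 M0 x0.
have h2 : t * e (y + 1) <= t * e (M + 1) by apply: ler_wpM2l.
have h3 : t * e (M + 1) <= (y - x) * e (M + 1) by apply: ler_wpM2r.
have h4 : 0 <= t * e x by apply: mulr_ge0.
rewrite mulrBl mul1r in h; lra.
Qed.

Lemma young_lip_abs M x y : `|x| <= M -> `|y| <= M ->
  `|e y - e x| <= `|y - x| * e (M + 1).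
Proof.
suff H x' y' : x' <= y' -> `|x'| <= M -> `|y'| <= M ->
    `|e y' - e x'| <= `|y' - x'| * e (M + 1).
  have [xy|/ltW yx] := leP x y => xM yM; first exact: H.
  by rewrite distrC [X in X * _]distrC; apply: H.
move=> xy xM yM; rewrite (ger0_norm (_ : 0 <= y' - x')) ?subr_ge0//.
rewrite ler_norml young_lip// andbT lerNl opprB.
have := @young_lip M (- y') (- x'); rewrite !youngN !normrN => /(_ _ yM xM).
rewrite lerN2 => /(_ xy); lra.
Qed.

Lemma young_continuous : continuous e.
Proof.
move=> x; apply/cvgrPdist_lt => eps eps0.
have K0 : 0 < e (`|x| + 1 + 1).
  by apply: young_gt0; rewrite gt_eqF//; have := normr_ge0 x; lra.
pose r := Num.min 1 (eps / e (`|x| + 1 + 1)).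
apply/nbhs_ballP; exists r => [|y]; first by rewrite /= lt_min ltr01 divr_gt0.
rewrite /ball/= lt_min => /andP[yx1 yx2].
have yM : `|y| <= `|x| + 1.
  rewrite -[y](subrK x) addrC; apply: le_trans (ler_normD _ _) _.
  by rewrite lerD2l distrC ltW.
rewrite distrC; apply: le_lt_trans (young_lip_abs (M := `|x| + 1) _ yM) _; first by rewrite lerDl.
by rewrite -ltr_pdivlMr// distrC.
Qed.

Lemma measurable_young : measurable_fun setT e.
Proof. by apply: continuous_measurable_fun; exact: young_continuous. Qed.

Lemma three_slopes v z w : v < z -> z < w -> (e z - e v) / (z - v) <= (e w - e z) / (w - z).
Proof.
move=> vz zw; have d0 : 0 < w - v by lra.
pose t := (z - v) / (w - v).
have t01 : 0 <= t <= 1.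
  by apply/andP; split; [apply: divr_ge0; lra|rewrite ler_pdivrMr// mul1r; lra].
have := young_convex w v t01.
have -> : t * w + (1 - t) * v = z by rewrite /t; field; rewrite gt_eqF.
move=> h; rewrite ler_pdivrMr ?subr_gt0// mulrAC ler_pdivlMr ?subr_gt0//.
have tE : t * (w - v) = z - v by rewrite /t divfK// gt_eqF.
have := ler_wpM2l (ltW d0) h.
have -> : (w - v) * (t * e w + (1 - t) * e v) =
   t * (w - v) * e w + ((w - v) - t * (w - v)) * e v by ring.
by rewrite tE; move: (e z) (e v) (e w) => ez ev ew; nra.
Qed.

(** The supremum of the left slopes at [z]; by [three_slopes] it stays below every right slope. *)
Lemma young_subgradient z : exists s, forall w, e z + s * (w - z) <= e w.
Proof.
pose S := [set (e z - e v) / (z - v) | v in [set v | v < z]].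
have S0 : S !=set0 by exists ((e z - e (z - 1)) / (z - (z - 1))), (z - 1) => //=; lra.
have ubS w : z < w -> ubound S ((e w - e z) / (w - z)).
  by move=> zw _ [v /= vz <-]; exact: three_slopes.
have hS : has_sup S by split => //; exists ((e (z + 1) - e z) / (z + 1 - z)); apply: ubS; lra.
exists (sup S) => w; have [wz|zw|->] := ltgtP w z; last by rewrite subrr mulr0 addr0.
- have : (e z - e w) / (z - w) <= sup S by apply: sup_upper_bound => //; exists w.
  by rewrite ler_pdivrMr ?subr_gt0//; nra.
- have : sup S <= (e w - e z) / (w - z) by apply: ge_sup => //; exact: ubS.
  by rewrite ler_pdivlMr ?subr_gt0//; nra.
Qed.

Lemma einv_has_sup a : 0 < a -> has_sup [set c | e c <= a].
Proof.
move=> a0; split; first by exists 0; rewrite /= young0 ltW.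
have e1 : 0 < e 1 by apply: young_gt0; rewrite oner_eq0.
exists (1 + a / e 1) => c /= ca; apply: le_trans (ler_norm c) _.
by apply: le_trans (young_lin_bound c) _; rewrite lerD2l ler_pM2r ?invr_gt0.
Qed.

Lemma einv_gt0 a : 0 < a -> 0 < einv e a.
Proof.
move=> a0; have e1 : 0 < e 1 by apply: young_gt0; rewrite oner_eq0.
have m0 : 0 < Num.min 1 (a / e 1) by rewrite lt_min ltr01 divr_gt0.
apply: (lt_le_trans m0); apply: sup_upper_bound; first exact: einv_has_sup.
rewrite /= -[X in e X]mulr1; apply: le_trans (young_scale _ _) _.
  by rewrite ltW//= ge_min lexx.
by rewrite -ler_pdivlMr// ge_min lexx orbT.
Qed.

(** With a strict inequality it does not matter whether the supremum defining [einv] is attained.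
    This is the source of the strict inequality in [orlicz_le_L1_Linf]. *)
Lemma einv_lt a c : 0 < a -> 0 <= c -> c < einv e a -> e c <= a.
Proof.
move=> a0 c0 /(sup_gt (einv_has_sup a0).1)[c' /= c'a cc'].
apply: le_trans c'a; apply: young_le.
by rewrite (ger0_norm c0) (ger0_norm (ltW (le_lt_trans c0 cc'))) ltW.
Qed.

Lemma beta_gt0 a : 0 < a -> 0 < beta_e e a.
Proof. by move=> a0; rewrite divr_gt0 ?einv_gt0. Qed.

Section Jensen.
Context dd (T : measurableType dd) (mu : {measure set T -> \bar R}).
Local Open Scope ereal_scope.

(** Jensen for a weight [k] of mass at most 1. Since [e 0 = 0], the supporting line at [z] has
    intercept [e z - s z <= 0], so missing mass only helps. *)
Lemma jensen_young (w k : T -> R) (z : R) : measurable_fun setT w -> measurable_fun setT k ->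
  (forall x, 0 <= w x)%R -> (forall x, 0 <= k x)%R -> (0 <= z)%R ->
  \int[mu]_x (k x)%:E <= 1 -> \int[mu]_x (w x * k x)%:E = z%:E ->
  (e z)%:E <= \int[mu]_x (e (w x) * k x)%:E.
Proof.
move=> mw mk w0 k0 z0 k1 wz.
have [->|zn] := eqVneq z 0%R.
  rewrite young0; apply: integral_ge0 => x _.
  by rewrite lee_fin mulr_ge0// young_ge0.
have zp : (0 < z)%R by rewrite lt_neqAle eq_sym zn.
have [s hs] := young_subgradient z.
have b0 : (0 <= s * z - e z)%R by have := hs 0%R; rewrite young0 sub0r; lra.
have s0 : (0 <= s)%R.
  rewrite -(pmulr_lge0 _ zp); have := young_ge0 z; lra.
have mew : measurable_fun setT (fun x => e (w x)).
  exact: (measurableT_comp measurable_young).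
(* The intercept is moved to the side where it is nonnegative, so that only integrals of nonnegative
   functions occur. *)
suff : (s * z)%:E <= \int[mu]_x (e (w x) * k x)%:E + (s * z - e z)%:E.
  by rewrite -leeBlDr// -EFinB opprB addrC subrK.
apply: (@le_trans _ _ (\int[mu]_x ((e (w x) * k x)%:E + (s * z - e z)%:E * (k x)%:E))).
  rewrite EFinM -wz -ge0_integralZl_EFin//; last 2 first.
  - by move=> x _; rewrite lee_fin mulr_ge0.
  - by apply/measurable_EFinP; exact: measurable_funM.
  apply: ge0_le_integral => //.
  - by move=> x _; rewrite -EFinM lee_fin !mulr_ge0.
  - apply/measurable_EFinP; apply: measurable_funM => //; exact: measurable_funM.
  - apply/measurable_EFinP; apply: measurable_funD; apply: measurable_funM => //.
  - move=> x _; rewrite -!EFinM -EFinD lee_fin.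
    by have := hs (w x); have := k0 x; nra.
rewrite ge0_integralD//; last 4 first.
- by move=> x _; rewrite lee_fin mulr_ge0// young_ge0.
- by apply/measurable_EFinP; exact: measurable_funM.
- by move=> x _; rewrite -EFinM lee_fin mulr_ge0.
- by apply/measurable_EFinP; exact: measurable_funM.
apply: leeD => //; rewrite ge0_integralZl_EFin//; last 2 first.
- by move=> x _; rewrite lee_fin.
- exact/measurable_EFinP.
by rewrite -[leRHS]mule1; apply: lee_wpmul2l.
Qed.

End Jensen.
End Young.

Section Orlicz.
Context (R : realType) (d : nat) (e : R -> R).
Hypothesis ye : young e.
Local Notation Rd := (Rd R d).
Local Notation BRd := (BorelRd R d).
Local Notation L := (@lmeas R d).
Local Open Scope ereal_scope.

(** Admissible real constants replace the extended infimum [orlicz_norm]. [orlicz_le_norm] and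
    [norm_orlicz_le] translate, the latter only from a strict bound. *)
Definition orlicz_le (f : BRd -> R) (c : R) : Prop :=
  [/\ measurable_fun setT f, (0 < c)%R & \int[L]_x (e (f x / c))%:E <= 1].

Lemma measurable_young_div (f : BRd -> R) c : measurable_fun setT f ->
  measurable_fun setT (fun x => e (f x / c)).
Proof.
by move=> mf; apply: (measurableT_comp (measurable_young ye)); exact: measurable_funM.
Qed.

Lemma lint_young (f : BRd -> R) c : measurable_fun setT f ->
  lint (fun x => (e (f x / c))%:E) = \int[L]_x (e (f x / c))%:E.
Proof.
move=> mf; rewrite lint_ge0E// => [y|]; first by rewrite lee_fin young_ge0.
by apply/measurable_EFinP; exact: measurable_young_div.
Qed.

Lemma orlicz_le_norm f c : orlicz_le f c -> orlicz_norm e (f : Rd -> R) <= c%:E.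
Proof.
move=> [mf c0 fc]; apply: ereal_inf_lbound; exists c => //=; split => //.
by rewrite lint_young.
Qed.

Lemma orlicz_leW f c c' : orlicz_le f c -> (c <= c')%R -> orlicz_le f c'.
Proof.
move=> [mf c0 fc] cc'; have c'0 : (0 < c')%R by exact: lt_le_trans cc'.
split => //; apply: le_trans fc; apply: ge0_le_integral => //.
- by move=> x _; rewrite lee_fin young_ge0.
- by apply/measurable_EFinP; exact: measurable_young_div.
- by apply/measurable_EFinP; exact: measurable_young_div.
- move=> x _; rewrite lee_fin; apply: young_le => //.
  rewrite !normrM !normfV (gtr0_norm c0) (gtr0_norm c'0); apply: ler_wpM2l => //.
  by rewrite lef_pV2.
Qed.

Lemma norm_orlicz_le f c : measurable_fun setT (f : BRd -> R) ->
  orlicz_norm e (f : Rd -> R) < c%:E -> orlicz_le f c.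
Proof.
move=> mf /ereal_inf_lt[_ /= [c0 [c00 fc0] <-]]; rewrite lte_fin => c0c.
apply: (@orlicz_leW _ c0); last exact: ltW.
by split => //; rewrite -lint_young.
Qed.

Lemma orlicz_norm_ge0 f : 0 <= orlicz_norm e (f : Rd -> R).
Proof. by apply: le_ereal_inf_tmp => _ [c [c0 _] <-]; rewrite lee_fin ltW. Qed.

(** [(f + g) / (c + c')] is the convex combination of [f / c] and [g / c'] with weights [t] and
    [1 - t]. *)
Lemma orlicz_leD f g c c' : orlicz_le f c -> orlicz_le g c' ->
  orlicz_le (f \+ g)%R (c + c')%R.
Proof.
move=> [mf c0 fc] [mg c'0 gc']; have cc0 : (0 < c + c')%R by rewrite addr_gt0.
split => //; first exact: measurable_funD.
pose t := (c / (c + c'))%R.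
have t01 : (0 <= t <= 1)%R.
  apply/andP; split; first by apply: divr_ge0; exact: ltW.
  by rewrite ler_pdivrMr// mul1r lerDl ltW.
have t1 : (1 - t = c' / (c + c'))%R by rewrite /t; field; rewrite gt_eqF.
apply: (@le_trans _ _ (\int[L]_x (t%:E * (e (f x / c))%:E + (1 - t)%:E * (e (g x / c'))%:E))).
  apply: ge0_le_integral => //.
  - by move=> x _; rewrite lee_fin young_ge0.
  - by apply/measurable_EFinP; apply: measurable_young_div; exact: measurable_funD.
  - apply/measurable_EFinP; apply: measurable_funD; apply: measurable_funM => //;
      exact: measurable_young_div.
  - move=> x _; rewrite -!EFinM -EFinD lee_fin.
    apply: le_trans (young_convex ye (f x / c) (g x / c') t01).
    rewrite t1 /t le_eqVlt; apply/orP; left; apply/eqP; congr e.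
    by rewrite /=; field; rewrite !gt_eqF.
rewrite ge0_integralD//; last 4 first.
- move=> x _; rewrite -EFinM lee_fin; apply: mulr_ge0; last exact: young_ge0.
  by case/andP: t01.
- by apply/measurable_EFinP; apply: measurable_funM => //; exact: measurable_young_div.
- move=> x _; rewrite -EFinM lee_fin; apply: mulr_ge0; last exact: young_ge0.
  by rewrite subr_ge0; case/andP: t01.
- by apply/measurable_EFinP; apply: measurable_funM => //; exact: measurable_young_div.
have [t0 tle1] := andP t01.
rewrite !ge0_integralZl_EFin ?subr_ge0//; try by move=> x _; rewrite lee_fin young_ge0.
2,3: by apply/measurable_EFinP; exact: measurable_young_div.
rewrite (_ : 1 = t%:E * 1 + (1 - t)%:E * 1); last by rewrite !mule1 -EFinD addrCA subrr addr0.
by apply: leeD; apply: lee_wpmul2l => //; rewrite lee_fin subr_ge0.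
Qed.

Lemma orlicz_le_ext f g c : f =1 g -> orlicz_le f c -> orlicz_le g c.
Proof. by move=> /funext ->. Qed.

Lemma orlicz_le0 c : (0 < c)%R -> orlicz_le (fun=> 0%R) c.
Proof.
by move=> c0; split => //; under eq_integral do rewrite mul0r young0//; rewrite integral0.
Qed.

(** The extra [c0] keeps the constant positive when [r] is empty. *)
Lemma orlicz_le_sum I (r : seq I) (f : I -> BRd -> R) (c : I -> R) :
  (forall i, orlicz_le (f i) (c i)) -> forall c0, (0 < c0)%R ->
  orlicz_le (fun x => \sum_(i <- r) f i x)%R (c0 + \sum_(i <- r) c i)%R.
Proof.
move=> fc c0 c00; elim: r => [|i r IH].
  rewrite big_nil addr0; apply: (@orlicz_le_ext (fun=> 0%R)); last exact: orlicz_le0.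
  by move=> x; rewrite big_nil.
rewrite big_cons addrCA; apply: (@orlicz_le_ext (f i \+ (fun x => \sum_(i <- r) f i x))%R).
  by move=> x; rewrite big_cons.
exact: orlicz_leD.
Qed.

(** Interpolation: since [|f| <= A r], convexity gives [e(f/c) <= |f| / (A r) * e(A r / c)]. The
    choice of [c] makes [e(A r / c) <= r], and what remains is [|f| / A], of integral at most 1. *)
Lemma orlicz_le_L1_Linf (f : BRd -> R) (A r c : R) : measurable_fun setT f ->
  (0 < A)%R -> (0 < r)%R -> (forall x, `|f x| <= A * r)%R ->
  \int[L]_x `|(f x)%:E| <= A%:E -> (A * beta_e e r < c)%R -> orlicz_le f c.
Proof.
move=> mf A0 r0 fA fA1 Ac; have c0 : (0 < c)%R.
  by apply: le_lt_trans Ac; rewrite mulr_ge0 ?ltW// beta_gt0.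
split => //; have Ar0 : (0 < A * r)%R by rewrite mulr_gt0.
have er : (e (A * r / c) <= r)%R.
  apply: einv_lt => //; first by rewrite divr_ge0 ?ltW.
  by rewrite ltr_pdivrMr// [ltRHS]mulrC -ltr_pdivrMr ?einv_gt0// -mulrA.
apply: (@le_trans _ _ (\int[L]_x ((A^-1)%:E * `|(f x)%:E|))).
  apply: ge0_le_integral => //.
  - by move=> x _; rewrite lee_fin young_ge0.
  - by apply/measurable_EFinP; exact: measurable_young_div.
  - by apply/measurable_EFinP; apply: measurable_funM => //; exact: measurableT_comp.
  - move=> x _; rewrite -EFinM lee_fin.
    have t01 : (0 <= `|f x| / (A * r) <= 1)%R.
      apply/andP; split; first by apply: divr_ge0 => //; exact: ltW.
      by rewrite ler_pdivrMr// mul1r.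
    rewrite -(young_abs ye) normrM normfV (gtr0_norm c0).
    rewrite (_ : (`|f x| / c = (`|f x| / (A * r)) * (A * r / c))%R); last first.
      by field; rewrite !gt_eqF.
    apply: le_trans (young_scale ye _ t01) _.
    apply: le_trans (ler_wpM2l _ er) _; first by case/andP: t01.
    by rewrite le_eqVlt; apply/orP; left; apply/eqP; field; rewrite !gt_eqF.
rewrite ge0_integralZl_EFin//; last 2 first.
- by apply: measurableT_comp => //; exact/measurable_EFinP.
- by rewrite invr_ge0 ltW.
by rewrite -lee_pdivlMl ?invr_gt0// invrK mule1.
Qed.

Lemma orlicz_le_L1loc (f : BRd -> R) c M : orlicz_le f c ->
  \int[L]_(x in cube M) `|(f x)%:E| <= c%:E * (L (cube M) + (e 1)^-1%:E).
Proof.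
move=> [mf c0 fc]; have e1 : (0 < e 1)%R by apply: young_gt0; rewrite ?oner_eq0.
have mM := @measurable_cube R d M.
apply: (@le_trans _ _ (\int[L]_(x in cube M) (c%:E * (1 + (e 1)^-1%:E * (e (f x / c))%:E)))).
  apply: ge0_le_integral => //.
  - by apply: measurableT_comp => //; apply/measurable_EFinP; exact: measurable_funTS.
  - apply/measurable_EFinP; apply: measurable_funM => //; apply: measurable_funD => //.
    by apply: measurable_funM => //; apply: measurable_funTS; exact: measurable_young_div.
  - move=> x _; rewrite -(EFinM (e 1)^-1) -(EFinD 1) -(EFinM c) lee_fin mulrC -ler_pdivrMr//.
    have := young_lin_bound ye (f x / c)%R.
    by rewrite normrM normfV (gtr0_norm c0) [(_^-1 * _)%R]mulrC.
have mE : measurable_fun (cube M : set BRd) (fun x => (e (f x / c))%:E).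
  by apply/measurable_EFinP; apply: measurable_funTS; exact: measurable_young_div.
rewrite ge0_integralZl_EFin//; last 3 first.
- move=> x _; rewrite -EFinM -EFinD lee_fin addr_ge0//.
  by apply: mulr_ge0; [rewrite invr_ge0 ltW|exact: young_ge0].
- apply: emeasurable_funD => //; exact: measurable_funeM.
- exact: ltW.
apply: lee_wpmul2l; first by rewrite lee_fin ltW.
rewrite ge0_integralD//; last 2 first.
- move=> x _; rewrite -EFinM lee_fin.
  by apply: mulr_ge0; [rewrite invr_ge0 ltW|exact: young_ge0].
- exact: measurable_funeM.
rewrite integral_cst// mul1e leeD2l// ge0_integralZl_EFin//; last 2 first.
- by move=> x _; rewrite lee_fin young_ge0.
- by rewrite invr_ge0 ltW.
rewrite -[leRHS]mule1; apply: lee_wpmul2l; first by rewrite lee_fin invr_ge0 ltW.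
apply: le_trans fc; apply: ge0_subset_integral => //.
- by apply/measurable_EFinP; exact: measurable_young_div.
- by move=> x _; rewrite lee_fin young_ge0.
Qed.

Lemma limn_einf_le (u : (\bar R)^nat) (a : \bar R) : (forall n, u n <= a) -> limn_einf u <= a.
Proof.
move=> ua; rewrite limn_einf_lim; apply: lime_le; first exact: is_cvg_einfs.
apply: nearW => n; apply: le_trans (ua n); apply: ereal_inf_lbound.
by exists n => //=.
Qed.

Lemma limn_einf_ge (u : (\bar R)^nat) (a : \bar R) : (forall n, a <= u n) -> a <= limn_einf u.
Proof.
move=> ua; rewrite limn_einf_lim; apply: lime_ge; first exact: is_cvg_einfs.
by apply: nearW => n; apply: le_ereal_inf_tmp => _ [k _ <-].
Qed.

(** Fatou's lemma together with the continuity of [e]. *)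
Lemma orlicz_le_lim (f : nat -> BRd -> R) (g : BRd -> R) (c : R) :
  (forall n, orlicz_le (f n) c) -> measurable_fun setT g ->
  {ae L, forall x, f n x @[n --> \oo] --> g x} -> orlicz_le g c.
Proof.
move=> fc mg fg; have [_ c0 _] := fc 0%N; split => //.
have mfe n : measurable_fun setT (fun x => (e (f n x / c))%:E).
  by apply/measurable_EFinP; apply: measurable_young_div; case: (fc n).
apply: (@le_trans _ _ (\int[L]_x limn_einf (fun n => (e (f n x / c))%:E))).
  apply: ae_ge0_le_integral => //.
  - by move=> x _; rewrite lee_fin young_ge0.
  - by apply/measurable_EFinP; exact: measurable_young_div.
  - by move=> x _; apply: limn_einf_ge => n; rewrite lee_fin young_ge0.
  - apply: measurableT_comp => //; apply: measurable_fun_limn_esup => n.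
    exact: measurableT_comp.
  - apply: filterS fg => x fgx _.
    have : (e (f n x / c))%:E @[n --> \oo] --> (e (g x / c))%:E.
      apply: cvg_EFin; first exact: nearW.
      apply: (@cvg_comp _ _ _ (fun n => (f n x / c)%R) e _ (nbhs (g x / c)%R)); last exact: young_continuous.
      exact: cvgMr_tmp.
    by move/cvg_limn_einf_sup => [-> _].
apply: le_trans (fatou L measurableT mfe _) _; first by move=> n x _; rewrite lee_fin young_ge0.
by apply: limn_einf_le => n; case: (fc n).
Qed.

Lemma orlicz_le_series (f : nat -> BRd -> R) (g : BRd -> R) (c : nat -> R) (S : R) :
  (forall n, orlicz_le (f n) (c n)) -> (forall n, \sum_(i < n) c i <= S)%R -> (0 < S)%R ->
  measurable_fun setT g ->
  {ae L, forall x, (\sum_(i < n) f i x)%R @[n --> \oo] --> g x} ->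
  orlicz_le g S.
Proof.
move=> fc cS S0 mg fg; apply: (@orlicz_le_lim (fun n x => \sum_(i < n) f i x)%R) => //.
case=> [|n].
  apply: (@orlicz_le_ext (fun=> 0%R)); first by move=> x; rewrite big_ord0.
  exact: orlicz_le0.
apply: (orlicz_leW _ (cS n.+1)); elim: n => [|n IH].
  rewrite big_ord_recr big_ord0/= add0r; apply: orlicz_le_ext (fc 0%N) => x.
  by rewrite big_ord_recr big_ord0/= add0r.
rewrite big_ord_recr/=; apply: (orlicz_le_ext _ (orlicz_leD IH (fc n.+1))) => x.
by rewrite /= [RHS]big_ord_recr.
Qed.

Lemma measurable_param_integral dd (T : measurableType dd)
   (m : {sigma_finite_measure set T -> \bar R}) (H : BRd * T -> R) :
  measurable_fun setT H -> measurable_fun setT (fun x => \int[m]_y (H (x, y))%:E).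
Proof.
move=> mH; have mHE : measurable_fun setT (EFin \o H) by exact/measurable_EFinP.
rewrite (_ : (fun x => _) = (fun x => \int[m]_y (EFin \o H)^\+ (x, y) -
   \int[m]_y (EFin \o H)^\- (x, y))); last first.
  apply/funext => x; rewrite [LHS]integralE; congr (_ - _).
    by apply: eq_integral => y _; rewrite !funeposE.
  by apply: eq_integral => y _; rewrite !funenegE.
apply: emeasurable_funB.
  apply: (measurable_fun_fubini_tonelli_F (EFin \o H)^\+); first exact: measurable_funepos.
  by move=> z; exact: funepos_ge0.
apply: (measurable_fun_fubini_tonelli_F (EFin \o H)^\-); first exact: measurable_funeneg.
by move=> z; exact: funeneg_ge0.
Qed.

Lemma measurable_fine_param dd (T : measurableType dd)
   (m : {sigma_finite_measure set T -> \bar R}) (H : BRd * T -> R) :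
  measurable_fun setT H -> measurable_fun setT (fun x => fine (\int[m]_y (H (x, y))%:E)).
Proof. by move=> mH; apply: measurableT_comp => //; exact: measurable_param_integral. Qed.

(** A Schur test for the Luxemburg norm: Jensen in [y] with weight [|K(x, y)| / M], then Tonelli and
    the bound on the integrals in [x]. Finiteness of the integrals of [G K] ensures that [fine]
    returns the actual value. *)
Lemma orlicz_le_conv (G : BRd -> R) (K : BRd * BRd -> R) (M c : R) :
  (0 < M)%R -> measurable_fun setT K ->
  (forall x, \int[L]_y `|(K (x, y))%:E| <= M%:E) ->
  (forall y, \int[L]_x `|(K (x, y))%:E| <= M%:E) ->
  (forall x, \int[L]_y `|(G y * K (x, y))%:E| < +oo) ->
  orlicz_le G c ->
  orlicz_le (fun x => fine (\int[L]_y (G y * K (x, y))%:E)) (M * c).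
Proof.
move=> M0 mK K1 K2 GK [mG c0 Gc].
have mGs : measurable_fun setT (fun z : BRd * BRd => G z.2).
  exact: (measurableT_comp mG measurable_snd).
have mGK : measurable_fun setT (fun z : BRd * BRd => (G z.2 * K z)%R).
  exact: measurable_funM.
have mKx x : measurable_fun setT (fun y => K (x, y)).
  exact: (measurableT_comp mK (pair1_measurable x)).
have Mc0 : (0 < M * c)%R by rewrite mulr_gt0.
split => //.
  exact: (measurable_fine_param L mGK).
have meG : measurable_fun setT (fun z : BRd * BRd => (e (G z.2 / c) * (`|K z| / M))%R).
  apply: measurable_funM.
    exact: (measurableT_comp (measurable_young_div _ mG) measurable_snd).
  by apply: measurable_funM => //; exact: measurableT_comp.
have H0 (z : BRd * BRd) : 0 <= (e (G z.2 / c) * (`|K z| / M))%:E.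
  rewrite lee_fin; apply: mulr_ge0; first exact: young_ge0.
  by apply: divr_ge0 => //; exact: ltW.
apply: (@le_trans _ _ (\int[L]_x \int[L]_y (e (G y / c) * (`|K (x, y)| / M))%:E)).
  apply: ge0_le_integral => //.
  - by move=> x _; rewrite lee_fin young_ge0.
  - apply/measurable_EFinP; apply: measurable_young_div.
    exact: (measurable_fine_param L mGK).
  - exact: (measurable_param_integral L meG).
  - move=> x _.
    have mw : measurable_fun setT (fun y => `|G y / c|%R).
      by apply: measurableT_comp => //; exact: measurable_funM.
    have mk : measurable_fun setT (fun y => (`|K (x, y)| / M)%R).
      by apply: measurable_funM => //; exact: measurableT_comp.
    (* The mean of [|G| / c] under the normalised kernel; it dominates the modulus of the
       convolution at [x] divided by [M c]. *)
    pose z := fine (\int[L]_y (`|G y / c| * (`|K (x, y)| / M))%:E).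
    have wkE : \int[L]_y (`|G y / c| * (`|K (x, y)| / M))%:E =
        ((M * c)^-1)%:E * \int[L]_y `|(G y * K (x, y))%:E|.
      rewrite -ge0_integralZl_EFin//; last 2 first.
      - apply: measurableT_comp => //; apply/measurable_EFinP; exact: measurable_funM.
      - by rewrite invr_ge0 ltW.
      apply: eq_integral => y _; rewrite -EFinM normrM normfV (gtr0_norm c0) normrM.
      by congr EFin; field; rewrite !gt_eqF.
    have zE : \int[L]_y (`|G y / c| * (`|K (x, y)| / M))%:E = z%:E.
      have fGK : \int[L]_y `|(G y * K (x, y))%:E| \is a fin_num.
        by rewrite ge0_fin_numE; [exact: GK|exact: integral_ge0].
      by rewrite /z fineK// wkE fin_numM.
    have z0 : (0 <= z)%R.
      rewrite -lee_fin -zE; apply: integral_ge0 => y _.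
      rewrite lee_fin; apply: mulr_ge0 => //.
      by apply: divr_ge0 => //; exact: ltW.
    apply: (@le_trans _ _ (e z)%:E).
      rewrite lee_fin; apply: (young_le ye); rewrite (ger0_norm z0) normrM normfV (gtr0_norm Mc0).
      rewrite ler_pdivrMr//.
      have intGK : L.-integrable setT (fun y => (G y * K (x, y))%:E).
        apply/integrableP; split; last exact: GK.
        by apply/measurable_EFinP; exact: measurable_funM.
      have h := le_abse_integral L measurableT (measurable_int _ intGK).
      have fint := integrable_fin_num measurableT intGK.
      rewrite -lee_fin -[X in X <= _]/(`|(fine _)%:E|) fineK//.
      apply: (le_trans h).
      rewrite mulrC EFinM -zE wkE muleA -EFinM mulfV ?mul1e//.
      by rewrite gt_eqF.
    have := @jensen_young _ _ ye _ _ L (fun y => `|G y / c|%R) (fun y => `|K (x, y)| / M)%R z mw mk.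
    under [X in _ -> _ -> _ -> _ -> _ -> _ <= X]eq_integral do rewrite young_abs//.
    apply => //.
    + by move=> y; rewrite divr_ge0// ltW.
    + under eq_integral do rewrite mulrC EFinM.
      rewrite ge0_integralZl_EFin//; last 2 first.
      * by apply/measurable_EFinP; apply: measurableT_comp => //; exact: mKx.
      * by rewrite invr_ge0 ltW.
      by rewrite -lee_pdivlMl ?invr_gt0// invrK mule1; exact: (K1 x).
rewrite (@fubini_tonelli _ _ _ _ _ L L (fun z => (e (G z.2 / c) * (`|K z| / M))%:E))//=; last first.
  exact/measurable_EFinP.
apply: le_trans Gc; apply: ge0_le_integral => //.
- by move=> y _; apply: integral_ge0 => x _; exact: (H0 (x, y)).
- apply: (measurable_fun_fubini_tonelli_G (fun z => (e (G z.2 / c) * (`|K z| / M))%:E)) => //.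
  exact/measurable_EFinP.
- by apply/measurable_EFinP; exact: measurable_young_div.
- move=> y _; under eq_integral do rewrite [(_ / M)%R]mulrC mulrA EFinM.
  have mKy : measurable_fun setT (fun x => K (x, y)).
    exact: (measurableT_comp mK (pair2_measurable y)).
  rewrite ge0_integralZl_EFin//; last 2 first.
  + by apply/measurable_EFinP; apply: measurableT_comp => //; exact: mKy.
  + by apply: mulr_ge0; [exact: young_ge0|rewrite invr_ge0 ltW].
  rewrite EFinM -muleA -[leRHS]mule1; apply: lee_wpmul2l; first by rewrite lee_fin young_ge0.
  by rewrite -lee_pdivlMl ?invr_gt0// invrK mule1; exact: (K2 y).
Qed.

End Orlicz.

(** * The duality estimate *)

Section Grid.
Context (R : realType) (d : nat).
Local Notation Rd := (Rd R d).
Local Notation BRd := (BorelRd R d).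
Local Notation L := (@lmeas R d).

(** If [m] is the least natural number in the window of length 3, the others are among
    [m, ..., m + 3]. *)
Lemma sum_window_le4 (u : R) n : (\sum_(k < n) (u <= k%:R <= u + 3)%R <= 4)%N.
Proof.
have [[k0 k0P]|noP] := pselect (exists k : nat, u <= k%:R <= u + 3); last first.
  rewrite big1// => k _; apply/eqP; rewrite eqb0; apply/negP => kP.
  by apply: noP; exists k.
have exP : exists k : nat, u <= k%:R <= u + 3 by exists k0.
case: (ex_minnP exP) => m /andP[um mu] mmin.
apply: (@leq_trans (\sum_(k < n) (m <= k < m + 4)%N)).
  apply: leq_sum => k _; case: (boolP (u <= k%:R <= u + 3)) => //= kP.
  rewrite lt0b mmin//= -(ltr_nat R) natrD.
  by case/andP: kP => h1 h2; lra.
rewrite -(big_mkord xpredT (fun k => (m <= k < m + 4)%N : nat)) /index_iota subn0.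
rewrite (eq_bigr (fun k => if (m <= k < m + 4)%N then 1%N else 0%N)); last first.
  by move=> k _; case: ifP.
rewrite -big_mkcond sum1_count -size_filter.
have -> : 4%N = size (iota m 4) by rewrite size_iota.
apply: uniq_leq_size; first by rewrite filter_uniq// iota_uniq.
by move=> k; rewrite mem_filter size_iota !mem_iota => /andP[].
Qed.

(** A supremum need not be attained, so a point reaching half of it is chosen; this is the factor 2
    in [L1_cells]. *)
Lemma half_sup (T : Type) (Q : set T) (g : T -> R) B : Q !=set0 ->
  (forall x, 0 <= g x) -> (forall x, g x <= B) ->
  exists2 x0, Q x0 & forall x, Q x -> g x <= 2 * g x0.
Proof.
move=> [q Qq] g0 gB.
have hs : has_sup (g @` Q).
  by split; [exists (g q), q|exists B => _ [x _ <-]].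
have gS x : Q x -> g x <= sup (g @` Q).
  by move=> Qx; apply: sup_upper_bound => //; exists x.
have [S0|S0] := leP (sup (g @` Q)) 0.
  exists q => // x Qx; apply: le_trans (gS _ Qx) _; apply: le_trans S0 _.
  by rewrite mulr_ge0.
have : sup (g @` Q) / 2 < sup (g @` Q) by lra.
move=> /(sup_gt hs.1)[_ [x0 Qx0 <-]] h; exists x0 => // x /gS; lra.
Qed.

Variables (del : R).
Hypothesis del0 : 0 < del.

Definition cello N (j : {ffun 'I_d -> 'I_(2 * N)}) : Rd :=
  \row_i (del * ((j i)%:R - N%:R)).

Definition cell N (j : {ffun 'I_d -> 'I_(2 * N)}) : set Rd :=
  box (cello j) (cello j + const_mx del).

(** One more layer of cells than the cube suggests: with [N] in place of [N.+1], a point on the face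
    [x_i = del * N] would receive the index [2 * N], which is out of range. *)
Lemma cell_cover N x : cube (del * N%:R) x -> exists j, @cell N.+1 j x.
Proof.
move=> /cubeP xN.
have bnd i : (Num.truncn (x 0%R i / del + N.+1%:R) < 2 * N.+1)%N.
  rewrite -(ltr_nat R); apply: (@le_lt_trans _ _ (x 0 i / del + N.+1%:R)).
    rewrite truncn_le; have := xN i; rewrite ler_norml => /andP[h _].
    have : - N%:R <= x 0 i / del by rewrite ler_pdivlMr// mulNr mulrC.
    by rewrite -natr1; have : 0 <= N%:R :> R by []; lra.
  have := xN i; rewrite ler_norml => /andP[_ h].
  have : x 0 i / del <= N%:R by rewrite ler_pdivrMr// mulrC.
  by rewrite natrM -natr1; lra.
exists [ffun i => Ordinal (bnd i)] => i; rewrite !mxE ffunE /=.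
have ge0 : 0 <= x 0 i / del + N.+1%:R.
  have := xN i; rewrite ler_norml => /andP[h _].
  have : - N%:R <= x 0 i / del by rewrite ler_pdivlMr// mulNr mulrC.
  by rewrite -natr1; have : 0 <= N%:R :> R by []; lra.
have := ge0; rewrite -truncn_le => h1; have h2 := truncnS_gt (x 0 i / del + N.+1%:R).
set t := Num.truncn _ in h1 h2 *; rewrite -[t.+1%:R]natr1 in h2.
have xE : x 0 i = del * (x 0 i / del) by rewrite mulrC divfK// gt_eqF.
rewrite xE; apply/andP; split; first by rewrite ler_pM2l//; lra.
by rewrite -[X in _ + X]mulr1 -mulrDr ler_pM2l//; lra.
Qed.

Lemma measurable_cell N j : measurable (@cell N j : set BRd).
Proof. exact: measurable_box. Qed.

Lemma lmeas_cell N j : L (@cell N j) = (del ^+ d)%:E.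
Proof.
rewrite lmeas_box; last by move=> i; rewrite !mxE lerDl ltW.
congr EFin; rewrite -[d in RHS]card_ord -prodr_const; apply: eq_bigr => i _.
by rewrite [X in X - _]mxE addrAC subrr add0r mxE.
Qed.

Lemma cell_neq0 N j : @cell N j !=set0.
Proof. by exists (cello j) => i; rewrite lexx/= !mxE lerDl ltW. Qed.

(** Along each axis, a point of cell [j] within [del] of [y] forces [j_i] into a window of length 3
    starting at [u i], which holds at most four integers. The sum over multi-indices factors over
    the axes. *)
Lemma cell_overlap N (x_ : {ffun 'I_d -> 'I_(2 * N)} -> Rd) (y : Rd) :
  (forall j, cell j (x_ j)) ->
  \sum_j \prod_i (`|x_ j 0%R i - y 0%R i| <= del)%R%:R <= 4 ^+ d :> R.
Proof.
move=> xc; pose u i := y 0 i / del + N%:R - 2.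
apply: (@le_trans _ _ (\sum_(j : {ffun 'I_d -> 'I_(2 * N)}) \prod_i
   (u i <= (j i)%:R <= u i + 3)%R%:R)).
  apply: ler_sum => j _; apply: ler_prod => i _; rewrite ler0n/= ler_nat.
  case: (boolP (_ <= del)) => // h; rewrite lt0b.
  have := xc j i; rewrite !mxE => /andP[h1 h2].
  move: h; rewrite ler_norml => /andP[h3 h4].
  have yE : y 0 i = del * (y 0 i / del) by rewrite mulrC divfK// gt_eqF.
  rewrite /u; apply/andP; split; rewrite -(ler_pM2l del0) !(mulrDr, mulrBr) -yE; lra.
rewrite -(bigA_distr_bigA (fun i (k : 'I_(2 * N)) => (u i <= k%:R <= u i + 3)%R%:R : R)).
have -> : (4 : R) ^+ d = \prod_(i < d) 4 by rewrite prodr_const card_ord.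
apply: ler_prod => i _; rewrite sumr_ge0//=.
by rewrite -natr_sum ler_nat; exact: sum_window_le4.
Qed.

(** On each cell [|f|] is at most twice its value at a chosen point, and the cell has volume
    [del^d]. The bound [A] is independent of [N], so the cubes may exhaust the space. *)
Lemma L1_cells (f : BRd -> R) (A B : R) : measurable_fun setT f -> (forall x, `|f x| <= B) ->
  (forall N (x_ : {ffun 'I_d -> 'I_(2 * N)} -> Rd), (forall j, cell j (x_ j)) ->
     \sum_j `|f (x_ j)| <= A) ->
  (\int[L]_x `|(f x)%:E| <= (2 * A * del ^+ d)%:E)%E.
Proof.
move=> mf fB fA.
have mfE : measurable_fun setT (fun x => `|(f x)%:E|%E).
  by apply: measurableT_comp => //; exact/measurable_EFinP.
pose F (N : nat) : set BRd := cube (del * N%:R).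
have mF N : measurable (F N) by exact: measurable_cube.
have ndF : nondecreasing_seq F.
  move=> m n mn; apply/subsetPset => x /cubeP xm; apply/cubeP => i.
  by apply: le_trans (xm i) _; rewrite ler_pM2l// ler_nat.
have FT : \bigcup_N F N = setT.
  apply/seteqP; split=> // x _; have : [set: Rd] x by [].
  rewrite -bigcup_box => -[n _ xn]; have [m nm] : exists m : nat, n%:R <= del * m%:R.
    exists (Num.truncn (n%:R / del)).+1; rewrite mulrC -ler_pdivrMr// ltW//; exact: truncnS_gt.
  exists m => //; apply/cubeP => i; apply: le_trans nm.
  by have := xn i; rewrite !mxE -ler_norml.
have cvgF : ((\int[L]_(x in F N) `|(f x)%:E|)%E @[N --> \oo] --> (\int[L]_x `|(f x)%:E|)%E).
  rewrite -FT; apply: ge0_nondecreasing_set_cvg_integral => //.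
  by move=> N; exact: measurable_funTS.
rewrite -(cvg_lim _ cvgF)//; apply: lime_le; first by apply/cvg_ex; eexists; exact: cvgF.
apply: nearW => N.
have choice_cell (j : {ffun 'I_d -> 'I_(2 * N.+1)}) :
    exists x0, cell j x0 /\ forall x, cell j x -> `|f x| <= 2 * `|f x0|.
  by have [|x0 h1 h2] := half_sup (cell_neq0 j) _ fB; [move=> x|exists x0].
have [x_ hx_] := choice choice_cell.
apply: (@le_trans _ _ (\int[L]_(x in F N) (\sum_j (2 * `|f (x_ j)|)%:E * (\1_(cell j) x)%:E))%E).
  apply: ge0_le_integral => //.
  - exact: measurable_funTS.
  - apply: emeasurable_sum => j; apply: measurable_funeM; apply/measurable_EFinP.
    by apply: measurable_indic; exact: measurable_cell.
  - move=> x /cell_cover[j xj]; rewrite (bigD1 j)//= indicE mem_set// mule1.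
    rewrite -[X in (X <= _)%E]adde0; apply: leeD.
      by rewrite lee_fin; exact: (hx_ j).2.
    by apply: sume_ge0 => i _; rewrite -EFinM lee_fin !mulr_ge0.
apply: (@le_trans _ _ (\int[L]_x (\sum_j (2 * `|f (x_ j)|)%:E * (\1_(cell j) x)%:E))%E).
  apply: ge0_subset_integral => //.
  - apply: emeasurable_sum => j; apply: measurable_funeM; apply/measurable_EFinP.
    by apply: measurable_indic; exact: measurable_cell.
  - by move=> x _; apply: sume_ge0 => i _; rewrite -EFinM lee_fin !mulr_ge0.
rewrite ge0_integral_sum//; last first.
  move=> j; apply: measurable_funeM; apply/measurable_EFinP.
  by apply: measurable_indic; exact: measurable_cell.
under eq_bigr => j _.
  rewrite ge0_integralZl_EFin//; last first.
    by apply/measurable_EFinP; apply: measurable_indic; exact: measurable_cell.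
  rewrite integral_indic//=; last exact: measurable_cell.
  rewrite setIT lmeas_cell -EFinM.
  over.
rewrite sumEFin lee_fin -mulr_suml -mulr_sumr ler_pM2r ?exprn_gt0// ler_pM2l//.
by apply: fA => j; case: (hx_ j).
Qed.

End Grid.

Section FiniteMeasureIntegral.
Context dd (T : measurableType dd) (R : realType).
Implicit Type m : {finite_measure set T -> \bar R}.

(** The integral against the signed measure [P - N]. *)
Definition pint (P N : {finite_measure set T -> \bar R}) (f : T -> R) : R :=
  (\int[P]_x f x) - (\int[N]_x f x).

Lemma Rintegral_lincomb m (J : finType) (s : J -> R) (f : J -> T -> R) :
  (forall j, m.-integrable setT (EFin \o f j)) ->
  \int[m]_x (\sum_j s j * f j x) = \sum_j s j * (\int[m]_x f j x).
Proof.
move=> fi; rewrite /Rintegral.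
under eq_integral do rewrite -sumEFin.
rewrite integral_sum//; last first.
  move=> j; rewrite (_ : (fun x => _) = (fun x => (s j)%:E * (EFin \o f j) x)%E) //.
  exact: integrableZl.
rewrite (eq_bigr (fun j => (s j * (\int[m]_x f j x)%R)%:E)); first by rewrite sumEFin.
move=> j _; rewrite /Rintegral EFinM fineK; last exact: integrable_fin_num (fi j).
by rewrite -(integralZl _ (fi j))//; apply: eq_integral => x _; rewrite EFinM.
Qed.

Lemma pint_lincomb (P N : {finite_measure set T -> \bar R}) (J : finType) (s : J -> R) (f : J -> T -> R) :
  (forall j, P.-integrable setT (EFin \o f j)) -> (forall j, N.-integrable setT (EFin \o f j)) ->
  pint P N (fun x => \sum_j s j * f j x) = \sum_j s j * pint P N (f j).
Proof.
move=> fP fN; rewrite /pint !Rintegral_lincomb// -sumrB.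
by apply: eq_bigr => j _; rewrite mulrBr.
Qed.

End FiniteMeasureIntegral.

Section Duality.
Context (R : realType) (d : nat) (k : nat).
Local Notation Rd := (Rd R d).
Local Notation BRd := (BorelRd R d).
Local Notation L := (@lmeas R d).
Variable chi : 'I_d -> R -> R.
Hypothesis bc : bump_fam chi.

Lemma bump_fam_dfam_bound : exists2 M, 1 <= M &
  forall (a : {ffun 'I_d -> 'I_k.+1}) i t, `|dfam (mi_of a) chi i t| <= M.
Proof.
have h (a : {ffun 'I_d -> 'I_k.+1}) := bump_fam_bound (bump_fam_dfam (mi_of a) bc).
have {}h (a : {ffun 'I_d -> 'I_k.+1}) :
    exists B, 1 <= B /\ forall i t, `|dfam (mi_of a) chi i t| <= B.
  by have [B B1 hB] := h a; exists B.
have [M hM] := choice h; exists (1 + \sum_a M a).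
  by rewrite lerDl sumr_ge0// => a _; apply: le_trans ler01 (hM a).1.
move=> a i t; apply: le_trans ((hM a).2 i t) _; rewrite (bigD1 a)//=.
rewrite addrCA lerDl addr_ge0// sumr_ge0// => b _; exact: le_trans ler01 (hM b).1.
Qed.

(** A derivative of order [|a| <= k] costs [del^-|a| <= del^-k] and each kernel has height of order
    [del^-d]; the overlap hypothesis turns the sum over [j] into a factor [4^d]. Summing over all
    [a] in the constant covers the sum in [sup_norm]. *)
Lemma sup_norm_bumps : exists2 C, 0 < C & forall (del b : R) (J : finType) (s : J -> R) (x_ : J -> Rd),
  0 < del -> del <= 1 -> (forall j, `|s j| <= b) -> 0 <= b ->
  (forall y, \sum_j \1_(cube del) (x_ j - y) <= (4 : R) ^+ d) ->
  (sup_norm k (lincomb s (fun j => rker del chi (x_ j))) <= (b * (C * del^-1 ^+ (d + k)))%:E)%E.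
Proof.
have [M M1 hM] := bump_fam_dfam_bound.
have M0 : 0 < M by exact: lt_le_trans M1.
exists (\sum_(a : {ffun 'I_d -> 'I_k.+1}) (4 * M) ^+ d).
  rewrite sumr_const pmulrn_lgt0; first by rewrite exprn_gt0// mulr_gt0.
  by rewrite card_ffun !card_ord expn_gt0.
move=> del b J s x_ d0 d1 sb b0 ov; rewrite /sup_norm mulr_suml mulr_sumr -sumEFin.
have id1 : 1 <= del^-1 by rewrite invf_ge1.
have id0 : 0 <= del^-1 by rewrite invr_ge0 ltW.
apply: (@le_trans _ _ (\sum_(a : {ffun 'I_d -> 'I_k.+1} | (mindex_size (mi_of a) <= k)%N)
   (b * ((4 * M) ^+ d * del^-1 ^+ (d + k)))%:E)%E); last first.
  rewrite big_mkcond/=; apply: lee_sum => a _; case: ifP => // _.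
  by rewrite lee_fin !mulr_ge0// ?exprn_ge0// mulr_ge0// ltW.
apply: lee_sum => a ak; apply: ge_ereal_sup => _ [x _ <-]; rewrite lee_fin.
rewrite cderiv_lincomb; last by move=> j; exact: smooth1_rker bc.1.
rewrite /lincomb; apply: le_trans (ler_norm_sum _ _ _) _.
apply: (@le_trans _ _ (\sum_j b * (del^-1 ^+ k * ((M / del) ^+ d * \1_(cube del) (x_ j - x))))).
  apply: ler_sum => j _; rewrite normrM; apply: ler_pM => //.
  rewrite derive_rker; last exact: bc.1.
  rewrite normrM normrX normrN (ger0_norm id0); apply: ler_pM => //.
  - by rewrite exprn_ge0.
  - by rewrite ler_weXn2l.
  - by apply: ker_bound => //; exact: bump_fam_dfam.
rewrite -!mulr_sumr; apply: ler_wpM2l => //.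
rewrite exprMn exprMn [X in _ <= X](_ : _ = del^-1 ^+ k * (M ^+ d * del^-1 ^+ d * 4 ^+ d)); last first.
  by rewrite exprD; ring.
apply: ler_wpM2l; first by rewrite exprn_ge0.
by apply: ler_wpM2l; rewrite ?ov// mulr_ge0 ?exprn_ge0// ltW.
Qed.

Variables (P N : {finite_measure set BRd -> \bar R}).

Lemma integrable_rker (m : {finite_measure set BRd -> \bar R}) del x : 0 < del ->
  m.-integrable setT (EFin \o (tens (rker del chi x) : BRd -> R)).
Proof.
move=> d0; rewrite (_ : tens _ = fun y => ker del chi (x - y)); first exact: integrable_kerl.
by apply/funext => y; rewrite rkerE.
Qed.

Definition mconv del x : R := pint P N (fun y => ker del chi (x - y)).

Lemma mconvE del x : mconv del x = pint P N (tens (rker del chi x)).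
Proof. by congr pint; apply/funext => y; rewrite rkerE. Qed.

Lemma measurable_mconv del : measurable_fun [set: BRd] (mconv del : BRd -> R).
Proof.
apply: measurable_funB.
- apply: (@measurable_fine_param _ _ _ _ P (fun p => ker del chi ((p.1 : Rd) - p.2))).
  exact: measurable_ker_sub.
- apply: (@measurable_fine_param _ _ _ _ N (fun p => ker del chi ((p.1 : Rd) - p.2))).
  exact: measurable_ker_sub.
Qed.

End Duality.

Section DualBound.
Context (R : realType) (d : nat) (k : nat).
Local Notation Rd := (Rd R d).
Local Notation BRd := (BorelRd R d).
Local Notation L := (@lmeas R d).
Variables (e : R -> R) (chi : 'I_d -> R -> R).
Hypotheses (ye : young e) (bc : bump_fam chi).

(** The distance [d_k] from [P - N] to zero is at most [D], expressed through the representing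
    measures. *)
Definition dual_bound (P N : {finite_measure set BRd -> \bar R}) (D : R) : Prop :=
  forall Phi : Rd -> R, smooth Phi -> (sup_norm k Phi <= 1)%E -> `|pint P N (Phi : BRd -> R)| <= D.

(* The [L^1] norm is tested against [\sum_j s_j K(x_j - y)], where [x_j] nearly
   maximizes the modulus in the [j]-th cell of a grid of mesh [del] and [s_j] is
   the sign at [x_j]; at most [4 ^ d] of the summands overlap at any point. *)
Lemma dual_orlicz : exists2 C, 0 < C & forall (del D : R) (P N : {finite_measure set BRd -> \bar R}),
  0 < del -> del <= 1 -> 0 < D -> dual_bound P N D ->
  orlicz_le e (mconv chi P N del : BRd -> R) (C * del^-1 ^+ k * beta_e e (del^-1 ^+ d) * D).
Proof.
have [C C0 hC] := sup_norm_bumps k bc; exists (3 * C); first by rewrite mulr_gt0.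
move=> del D P N d0 d1 D0 dD.
have id0 : 0 < del^-1 by rewrite invr_gt0.
(* The largest amplitude for which [sup_norm_bumps] makes the test function admissible. *)
pose b := (C * del^-1 ^+ (d + k))^-1.
have b0 : 0 < b by rewrite invr_gt0 mulr_gt0// exprn_gt0.
have bE : b^-1 = C * del^-1 ^+ (d + k) by rewrite invrK.
have test (J : finType) (s : J -> R) (x_ : J -> Rd) : (forall j, `|s j| <= 1) ->
    (forall y, \sum_j \1_(cube del) (x_ j - y) <= (4 : R) ^+ d) ->
    `|\sum_j s j * mconv chi P N del (x_ j)| <= C * del^-1 ^+ (d + k) * D.
  move=> s1 ov; have sm : smooth (lincomb (fun j => b * s j) (fun j => rker del chi (x_ j))).
    by apply: smooth_lincomb => j; exact: smooth1_rker bc.1.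
  have := dD _ sm; rewrite [X in `|X|](_ : _ = b * \sum_j s j * mconv chi P N del (x_ j)); last first.
    rewrite pint_lincomb; last 2 first.
    - by move=> j; exact: integrable_rker.
    - by move=> j; exact: integrable_rker.
    rewrite mulr_sumr; apply: eq_bigr => j _; rewrite -mulrA; congr (_ * (_ * _)).
    by rewrite mconvE.
  rewrite normrM (gtr0_norm b0) -ler_pdivlMl// bE; apply.
  apply: le_trans (hC del b J _ x_ d0 d1 _ (ltW b0) ov) _.
    by move=> j; rewrite normrM (gtr0_norm b0) ler_piMr// ltW.
  by rewrite lee_fin mulVf// gt_eqF// -bE invr_gt0.
(* The sup bound is the case of a single kernel. *)
have supb x : `|mconv chi P N del x| <= C * del^-1 ^+ (d + k) * D.
  have := test unit (fun=> 1) (fun=> x); rewrite big_const card_unit/= addr0 mul1r; apply.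
    by move=> _; rewrite normr1.
  move=> y; rewrite big_const card_unit/= addr0; apply: (@le_trans _ _ 1).
    by rewrite indicE; case: (_ \in _).
  by rewrite exprn_ege1// ler1n.
have L1 : (\int[L]_x `|(mconv chi P N del x)%:E| <=
    (2 * (C * del^-1 ^+ (d + k) * D) * del ^+ d)%:E)%E.
  apply: (@L1_cells _ _ _ d0 _ _ (C * del^-1 ^+ (d + k) * D)) => //.
    exact: measurable_mconv.
  move=> M x_ xc; have := test _ (fun j => Num.sg (mconv chi P N del (x_ j))) x_.
  rewrite [X in `|X|](_ : _ = \sum_j `|mconv chi P N del (x_ j)|); last first.
    by apply: eq_bigr => j _; rewrite -normrEsg.
  rewrite (ger0_norm (sumr_ge0 _ _)); last by move=> j _.
  apply.
    by move=> j; rewrite normr_sg; case: (_ != 0).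
  move=> y; apply: le_trans (cell_overlap d0 y xc); apply: ler_sum => j _.
  by rewrite cube_indic; apply: ler_prod => i _; rewrite !mxE ler0n lexx.
have dd : del^-1 ^+ d * del ^+ d = 1 by rewrite -exprMn mulVf ?gt_eqF// expr1n.
(* [A] is the L^1 bound, and with [r = del^-d] the product [A r] is twice the sup bound. The
   constant 3 instead of 2 provides the strict inequality. *)
apply: (@orlicz_le_L1_Linf _ _ _ ye _ (2 * C * del^-1 ^+ k * D) (del^-1 ^+ d)).
- exact: measurable_mconv.
- by rewrite !mulr_gt0// exprn_gt0.
- by rewrite exprn_gt0.
- move=> x; apply: le_trans (supb x) _.
  have -> : C * del^-1 ^+ (d + k) * D = 1 * (C * del^-1 ^+ k * del^-1 ^+ d * D).
    by rewrite exprD; ring.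
  have -> : 2 * C * del^-1 ^+ k * D * del^-1 ^+ d = 2 * (C * del^-1 ^+ k * del^-1 ^+ d * D) by ring.
  by rewrite ler_wpM2r ?ler1n// !mulr_ge0// ?exprn_ge0// ltW.
- apply: le_trans L1 _; rewrite lee_fin exprD.
  rewrite (_ : _ * del ^+ d = 2 * C * del^-1 ^+ k * D * (del^-1 ^+ d * del ^+ d)); last ring.
  by rewrite dd mulr1.
- have -> : 2 * C * del^-1 ^+ k * D * beta_e e (del^-1 ^+ d) =
    2 * (C * del^-1 ^+ k * beta_e e (del^-1 ^+ d) * D) by ring.
  have -> : 3 * C * del^-1 ^+ k * beta_e e (del^-1 ^+ d) * D =
    3 * (C * del^-1 ^+ k * beta_e e (del^-1 ^+ d) * D) by ring.
  have be0 : 0 < beta_e e (del^-1 ^+ d) by apply: (beta_gt0 ye); rewrite exprn_gt0.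
  have X0 : 0 < C * del^-1 ^+ k * beta_e e (del^-1 ^+ d) * D.
    by apply: mulr_gt0 => //; apply: mulr_gt0 => //; apply: mulr_gt0 => //; exact: exprn_gt0.
  by rewrite ltr_pM2r// ltr_nat.
Qed.

End DualBound.

(** * Increments of the mollification *)

Section Telescope.
Context (R : realType) (d N : nat) (a b A : R -> R).
Hypothesis vp : vanishing_pair N a b A.
Local Notation Rd := (Rd R d).

Lemma prod_telescope n (u v : 'I_n -> R) :
  \prod_i u i - \prod_i v i =
  \sum_(i < n) \prod_(j < n) (if (j < i)%N then u j else if j == i then u j - v j else v j).
Proof.
elim: n u v => [|n IH] u v; first by rewrite !big_ord0 subrr.
rewrite !big_ord_recl.
have -> : u ord0 * \prod_(i < n) u (lift ord0 i) - v ord0 * \prod_(i < n) v (lift ord0 i) =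
    (u ord0 - v ord0) * \prod_(i < n) v (lift ord0 i) +
    u ord0 * (\prod_(i < n) u (lift ord0 i) - \prod_(i < n) v (lift ord0 i)) by ring.
congr (_ + _).
rewrite IH mulr_sumr; apply: eq_bigr => i _; rewrite big_ord_recl/=; congr (_ * _).
Qed.

Let sa : smooth1 a. Proof. by case: vp => -[]. Qed.
Let sb : smooth1 b. Proof. by case: vp => -[]. Qed.

Definition kfam : 'I_d -> R -> R := fun=> a.

(* The [i]-th term of the telescoping sum is obtained from [pre_step i] by
   differentiating its [i]-th factor [N] times. *)
Definition pre_step (i : 'I_d) : 'I_d -> R -> R :=
  fun j => if (j < i)%N then (fun t => 2 * a (2 * t)) else if j == i then b else a.

Lemma bump_kfam : bump_fam kfam.
Proof.
split=> [i|i t t1]; first exact: sa.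
by case: vp => _ [a0 _ _ _ _]; rewrite /kfam a0// ltW.
Qed.

Lemma bump_pre_step i : bump_fam (pre_step i).
Proof.
case: vp => _ [a0 b0 _ _ _]; split=> [j|j t t1]; rewrite /pre_step.
  by case: ifP => _; [exact: smooth1_double|case: ifP => _; [exact: sb|exact: sa]].
case: ifP => _; first by rewrite a0 ?mulr0//; apply: normr_double; exact: ltW.
by case: ifP => _; rewrite ?b0 ?a0// ltW.
Qed.

Definition madd_mi (al : 'I_d -> nat) (i : 'I_d) : 'I_d -> nat :=
  fun j => (al j + (if j == i then N else 0))%N.

Lemma mindex_size_madd al i : mindex_size (madd_mi al i) = (mindex_size al + N)%N.
Proof.
by rewrite /mindex_size big_split/= -big_mkcond/= big_pred1_eq.
Qed.

Lemma ker_step n (al : 'I_d -> nat) (z : Rd) :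
  (2 ^- n.+1)^-1 ^+ mindex_size al * ker (2 ^- n.+1) (dfam al kfam) z -
  (2 ^- n)^-1 ^+ mindex_size al * ker (2 ^- n) (dfam al kfam) z =
  (2 ^- n)^-1 ^+ mindex_size al *
    \sum_i ker (2 ^- n) (dfam (madd_mi al i) (pre_step i)) z.
Proof.
rewrite !invrK.
(* The finer kernel, seen at scale [2^-n], is the tensor power of [2 a(2t)]; the additional powers
   of 2 are those produced by differentiating the dilation. *)
have -> : (2 : R) ^+ n.+1 ^+ mindex_size al * ker (2 ^- n.+1) (dfam al kfam) z =
    2 ^+ n ^+ mindex_size al * ker (2 ^- n) (dfam al (fun _ t => 2 * a (2 * t))) z.
  rewrite /ker /tens /mindex_size -!prodrXr -!big_split/=; apply: eq_bigr => i _.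
  rewrite /dfam /kfam derive1n_double// !invrK.
  have -> : 2 * (2 ^+ n * z 0 i) = 2 ^+ n.+1 * z 0 i by rewrite mulrA exprS.
  by rewrite exprS exprMn; ring.
rewrite -mulrBr; congr (_ * _); rewrite /ker /tens prod_telescope.
apply: eq_bigr => i _; apply: eq_bigr => j _.
rewrite /dfam /madd_mi /pre_step; case: ifP => ji.
  by rewrite (_ : j == i = false) ?addn0// -val_eqE/= ltn_eqF.
case: ifP => _; last by rewrite addn0.
rewrite -mulrBr; congr (_ * _).
have -> : derive1n (al j + N) b = derive1n (al j) (derive1n N b) by exact: iterD.
have -> : (fun t => 2 * a (2 * t)) = derive1n N b \+ a.
  by case: vp => _ [_ _ _ _ ab]; apply/funext => t /=; rewrite -ab subrK.
rewrite derive1nD//; last exact: smooth1_derive1n.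
by rewrite /= addrK.
Qed.

End Telescope.

Section ConvStep.
Context (R : realType) (d k : nat).
Local Notation Rd := (Rd R d).
Local Notation BRd := (BorelRd R d).
Local Notation L := (@lmeas R d).
Implicit Types (chi : 'I_d -> R -> R).

Lemma integrable_loc_csupp (f g : Rd -> R) M B : Defs.locally_integrable f ->
  measurable_fun [set: BRd] (g : BRd -> R) -> (forall x, `|g x| <= B * \1_(cube M) x) ->
  L.-integrable setT (fun x : BRd => (f x * g x)%:E).
Proof.
move=> [mf lf] mg gB.
have mc : measurable_fun [set: BRd] (fun x : BRd => `|f x| * \1_(cube M : set BRd) x).
  apply: measurable_funM; first exact: measurableT_comp.
  by apply: measurable_indic; exact: measurable_cube.
have ic : L.-integrable setT (fun x : BRd => (`|f x| * \1_(cube M : set BRd) x)%:E).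
  apply/integrableP; split; first exact/measurable_EFinP.
  under eq_integral do rewrite gee0_abs ?lee_fin ?mulr_ge0//.
  rewrite -lint_ge0E; last 2 first.
  - by move=> y; rewrite lee_fin mulr_ge0.
  - exact/measurable_EFinP.
  exact: (lf _ (@compact_cube R d M)).
have {}ic := integrableZl measurableT B ic.
apply: le_integrable ic => //; first by apply/measurable_EFinP; exact: measurable_funM.
move=> x _ /=; rewrite lee_fin normrM; apply: le_trans (ler_norm _).
by rewrite mulrCA ler_wpM2l.
Qed.

Lemma rker_indic del chi (x : Rd) : 0 < del -> bump_fam chi ->
  exists M B, forall y, `|ker del chi (x - y)| <= B * \1_(cube M) y.
Proof.
move=> d0 bc; have [B B1 cB] := bump_fam_bound bc.
exists (del + \sum_i `|x 0 i|), ((B / del) ^+ d) => y.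
apply: le_trans (ker_bound _ d0 bc cB) _; apply: ler_wpM2l.
  by rewrite exprn_ge0// divr_ge0 ?(ltW d0)// (le_trans ler01).
rewrite !indicE; case: (boolP (_ \in cube del)) => // /set_mem/cubeP xy.
rewrite mem_set//; apply/cubeP => i.
have -> : y 0 i = - (x - y) 0 i + x 0 i by rewrite !mxE; ring.
apply: le_trans (ler_normD _ _) _; rewrite normrN lerD//.
by rewrite (bigD1 i)//= lerDl sumr_ge0.
Qed.

(** The test function is [y -> ker del X (x - y)]. Its reflection in [y] and the definition of the
    weak derivative each give the sign [(-1)^|ga|], which cancel; undoing the dilation gives
    [del^|ga|]. *)
Lemma weak_deriv_ker del X (ga : 'I_d -> nat) (p G : Rd -> R) (x : Rd) :
  0 < del -> bump_fam X -> weak_deriv ga p G ->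
  (\int[L]_y (p y * ker del (dfam ga X) (x - y))%:E =
   (del ^+ mindex_size ga)%:E * \int[L]_y (G y * ker del X (x - y))%:E)%E.
Proof.
move=> d0 bX [lp [lG wd]].
have bX' := bump_fam_dfam ga bX.
have [M [B MB]] := rker_indic x d0 bX.
have [M' [B' MB']] := rker_indic x d0 bX'.
have ip := integrable_loc_csupp lp (measurable_kerl del x bX') MB'.
have iG := integrable_loc_csupp lG (measurable_kerl del x bX) MB.
have sm : smooth (tens (rker del X x)) by apply: smooth_tens => i; exact: smooth1_rker bX.1 i.
have tf : test_function (tens (rker del X x)).
  apply: csupp_test_function => //; exists M => y yM; rewrite rkerE; apply/eqP.
  by rewrite -normr_le0; apply: le_trans (MB y) _; rewrite indicE memNset// mulr0.
have := wd _ tf; rewrite cderiv_tens; last exact: smooth1_rker bX.1.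
have -> : (fun x0 => p x0 * tens (fun i => derive1n (ga i) (rker del X x i)) x0) =
    (fun y => (- del^-1) ^+ mindex_size ga * (p y * ker del (dfam ga X) (x - y))).
  by apply/funext => y; rewrite (derive_rker del ga x y bX.1) mulrCA.
have -> : (fun x0 => G x0 * tens (rker del X x) x0) = (fun y => G y * ker del X (x - y)).
  by apply/funext => y; rewrite rkerE.
have mp : borel_measurable (fun y => p y * ker del (dfam ga X) (x - y)).
  by apply/measurable_EFinP; exact: measurable_int ip.
rewrite lintRE; last exact: measurable_funM.
rewrite lintRE; last by apply/measurable_EFinP; exact: measurable_int iG.
under eq_integral do rewrite EFinM.
rewrite integralZl//.
rewrite -(fineK (integrable_fin_num measurableT ip)) -(fineK (integrable_fin_num measurableT iG)).
rewrite -!EFinM => -[h]; congr EFin.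
have s2 : (-1 : R) ^+ mindex_size ga * (-1) ^+ mindex_size ga = 1.
  by rewrite -exprMn mulrNN mulr1 expr1n.
have dd : del ^+ mindex_size ga * del^-1 ^+ mindex_size ga = 1.
  by rewrite -exprMn divff ?gt_eqF// expr1n.
have inv : forall u : R, u = (-1) ^+ mindex_size ga * del ^+ mindex_size ga *
    ((- del^-1) ^+ mindex_size ga * u).
  move=> u; rewrite -[- del^-1]mulN1r exprMn.
  rewrite (_ : _ * (_ * u) = ((-1) ^+ mindex_size ga * (-1) ^+ mindex_size ga) *
     (del ^+ mindex_size ga * del^-1 ^+ mindex_size ga) * u); last ring.
  by rewrite s2 dd !mul1r.
rewrite [LHS]inv h.
rewrite (_ : _ * (_ * _) = ((-1) ^+ mindex_size ga * (-1) ^+ mindex_size ga) *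
     (del ^+ mindex_size ga * fine (\int[L]_y (G y * ker del X (x - y))%:E))); last ring.
by rewrite s2 mul1r.
Qed.

(** [p] is the Lebesgue density of [P - N], stated against bounded measurable functions because it
    is applied to kernels and indicators. *)
Definition diff_density (p : Rd -> R) (P N : {finite_measure set BRd -> \bar R}) : Prop :=
  forall f : BRd -> R, measurable_fun setT f -> (exists B, forall x, `|f x| <= B) ->
    pint P N f = fine (\int[L]_x (p x * f x)%:E).

Lemma pint_madd (m1 m2 P N : {finite_measure set BRd -> \bar R}) (f : BRd -> R) :
  measurable_fun setT f -> (exists B, forall x, `|f x| <= B) ->
  pint (madd m1 N) (madd m2 P) f = pint m1 m2 f - pint P N f.
Proof.
move=> mf [B fB].
have fi (m : {finite_measure set BRd -> \bar R}) := @integrable_bounded _ _ _ m f B mf fB.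
have E (m m' : {finite_measure set BRd -> \bar R}) :
    \int[madd m m']_x f x = (\int[m]_x f x) + (\int[m']_x f x).
  rewrite /Rintegral integral_madd//.
  by rewrite (fineD (integrable_fin_num measurableT (fi m)) (integrable_fin_num measurableT (fi m'))).
rewrite /pint !E; ring.
Qed.

Variable e : R -> R.
Hypothesis ye : young e.

Lemma orlicz_leZ (f : BRd -> R) (c s : R) : 0 < s ->
  orlicz_le e f c -> orlicz_le e (fun x => s * f x) (s * c).
Proof.
move=> s0 [mf c0 fc]; split; [exact: measurable_funM|exact: mulr_gt0|].
under eq_integral => x _.
  rewrite (_ : s * f x / (s * c) = f x / c); first over.
  by rewrite invfM mulrACA divff ?mul1r// gt_eqF.
exact: fc.
Qed.

(** Stated for an arbitrary [ga] so that it serves the starting mollification as well as the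
    increments. Only the part carried by [p] gains the power [del^|ga|]. *)
Lemma conv_step (ga : 'I_d -> nat) (X : 'I_d -> R -> R) : bump_fam X ->
  exists2 C, 0 < C & forall (del D S : R) (m1 m2 P N : {finite_measure set BRd -> \bar R})
    (p G : Rd -> R), 0 < del -> del <= 1 -> 0 < D -> 0 < S ->
    diff_density p P N -> dual_bound k (madd m1 N) (madd m2 P) D ->
    weak_deriv ga p G -> orlicz_le e (G : BRd -> R) S ->
    orlicz_le e (mconv (dfam ga X) m1 m2 del : BRd -> R)
      (C * (del^-1 ^+ k * beta_e e (del^-1 ^+ d) * D + del ^+ mindex_size ga * S)).
Proof.
move=> bX; have bX' := bump_fam_dfam ga bX.
have [C C0 hC] := dual_orlicz k ye bX'.
have [B B1 XB] := bump_fam_bound bX.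
have B0 : 0 <= B by exact: le_trans ler01 B1.
have M0 : 0 < (2 * B) ^+ d by rewrite exprn_gt0// mulr_gt0// (lt_le_trans ltr01).
exists (C + (2 * B) ^+ d); first exact: addr_gt0.
move=> del D S m1 m2 P N p G d0 d1 D0 S0 pPN dD wd GS.
have h1 := hC _ _ _ _ d0 d1 D0 dD.
have h2 : orlicz_le e (fun x => fine (\int[L]_y (G y * ker del X ((x : Rd) - y))%:E)) ((2 * B) ^+ d * S).
  apply: (@orlicz_le_conv _ _ _ ye G (fun p => ker del X ((p.1 : Rd) - p.2))) => //.
  - exact: measurable_ker_sub.
  - by move=> x; exact: integral_ker_le.
  - by move=> y; exact: integral_ker_ler.
  - move=> x; have [M [B' MB]] := rker_indic x d0 bX.
    by have /integrableP[_] := integrable_loc_csupp wd.2.1 (measurable_kerl del x bX) MB.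
have dg0 : 0 < del ^+ mindex_size ga by rewrite exprn_gt0.
have {}h2 := orlicz_leZ dg0 h2.
have h := orlicz_leD ye h1 h2.
have {}h : orlicz_le e (mconv (dfam ga X) m1 m2 del : BRd -> R)
    (C * del^-1 ^+ k * beta_e e (del^-1 ^+ d) * D + del ^+ mindex_size ga * ((2 * B) ^+ d * S)).
  apply: orlicz_le_ext h => x /=; have [M [B' MB]] := rker_indic x d0 bX'.
  have bd : exists B, forall y : BRd, `|ker del (dfam ga X) (x - y)| <= B.
    exists `|B'| => y; apply: le_trans (MB y) _; rewrite indicE.
    by case: (_ \in _); rewrite ?mulr1 ?mulr0// ler_norm.
  rewrite /mconv pint_madd; last 2 first.
  - exact: measurable_kerl.
  - exact: bd.
  rewrite (pPN (fun y => ker del (dfam ga X) (x - y))); last 2 first.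
  - exact: measurable_kerl.
  - exact: bd.
  rewrite (weak_deriv_ker x d0 bX wd) fineM ?subrK//.
  have [M' [B'' MB']] := rker_indic x d0 bX.
  exact: integrable_fin_num (integrable_loc_csupp wd.2.1 (measurable_kerl del x bX) MB').
apply: (orlicz_leW ye h).
have b0 : 0 < beta_e e (del^-1 ^+ d) by apply: (beta_gt0 ye); rewrite exprn_gt0// invr_gt0.
have X1 : 0 <= del^-1 ^+ k * beta_e e (del^-1 ^+ d) * D.
  by apply: mulr_ge0 (ltW D0); apply: mulr_ge0 (ltW b0); rewrite exprn_ge0// invr_ge0 ltW.
have X2 : 0 <= del ^+ mindex_size ga * S by rewrite mulr_ge0// ltW.
have := mulr_ge0 (ltW C0) X2; have := mulr_ge0 (ltW M0) X1; lra.
Qed.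

End ConvStep.

(** * Signed measures as differences of finite measures, and the distance [d_k] *)

Section Charges.
Context (R : realType) (d k : nat).
Local Notation Rd := (Rd R d).
Local Notation BRd := (BorelRd R d).
Local Notation L := (@lmeas R d).
Local Notation fmeas := {finite_measure set BRd -> \bar R}.

Definition charge_diff (mu : signed_measure R d) (P N : fmeas) : Prop :=
  forall A : set BRd, measurable A -> mu A = (P A - N A)%E.

Lemma jordan_charge_diff (mu : signed_measure R d) : exists P N : fmeas, charge_diff mu P N.
Proof.
have [P [N PN]] := Hahn_decomposition mu.
exists (jordan_pos PN), (jordan_neg PN) => A mA.
by rewrite (jordan_decomp PN mA) /cadd/= cscaleN1.
Qed.

Lemma integrable_mul_bounded (p f : BRd -> R) B : L.-integrable setT (EFin \o p) ->
  measurable_fun setT f -> (forall x, `|f x| <= B) ->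
  L.-integrable setT (fun x => (p x * f x)%:E).
Proof.
move=> ip mf fB; have iBp := integrableZl measurableT B ip.
apply: le_integrable iBp => //.
  apply/measurable_EFinP; apply: measurable_funM => //.
  by apply/measurable_EFinP; exact: measurable_int ip.
move=> x _ /=; rewrite lee_fin !normrM mulrC ler_wpM2r//.
exact: le_trans (fB x) (ler_norm _).
Qed.

Lemma integrable_diff_density (p : Rd -> R) : L.-integrable setT (EFin \o (p : BRd -> R)) ->
  exists P N : fmeas, diff_density p P N.
Proof.
move=> ip.
have mp : measurable_fun [set: BRd] (p : BRd -> R).
  by apply/measurable_EFinP; exact: measurable_int ip.
pose pp : BRd -> R := fun x => Num.max (p x) 0.
pose pn : BRd -> R := fun x => Num.max (- p x) 0.
have pp0 x : 0 <= pp x by rewrite /pp le_max lexx orbT.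
have pn0 x : 0 <= pn x by rewrite /pn le_max lexx orbT.
have mpp : measurable_fun setT pp by exact: measurable_maxr.
have mpn : measurable_fun setT pn by apply: measurable_maxr => //; exact: measurableT_comp.
have pE x : p x = pp x - pn x.
  rewrite /pp /pn; have [p0|/ltW p0] := leP 0 (p x); last first.
    by rewrite max_l ?oppr_ge0// sub0r opprK.
  by rewrite max_r ?oppr_le0// subr0.
have ipp : L.-integrable setT (EFin \o pp).
  apply: le_integrable ip => //; first exact/measurable_EFinP.
  move=> x _; rewrite /= lee_fin (ger0_norm (pp0 x)) /pp.
  by rewrite ge_max ler_norm normr_ge0.
have ipn : L.-integrable setT (EFin \o pn).
  apply: le_integrable ip => //; first exact/measurable_EFinP.
  move=> x _; rewrite /= lee_fin (ger0_norm (pn0 x)) /pn.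
  by rewrite ge_max -normrN ler_norm normr_ge0.
pose P : fmeas := density_measure pp0 ipp.
pose N : fmeas := density_measure pn0 ipn.
exists P, N.
move=> f mf [B fB].
rewrite /pint /Rintegral !integral_density_measure//.
have i1 := integrable_mul_bounded ipp mf fB.
have i2 := integrable_mul_bounded ipn mf fB.
under eq_integral do rewrite mulrC.
under [X in _ - fine X = _]eq_integral do rewrite mulrC.
rewrite -fineB; [|exact: integrable_fin_num i1|exact: integrable_fin_num i2].
rewrite -integralB_EFin//; congr fine; apply: eq_integral => x _.
by rewrite -EFinB pE mulrBl.
Qed.

Lemma diff_density_set (p : Rd -> R) (P N : fmeas) (A : set BRd) :
  L.-integrable setT (EFin \o (p : BRd -> R)) -> diff_density p P N -> measurable A ->
  lintR (fun x => p x * (\1_A x : R)) = (P A - N A)%E.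
Proof.
move=> ip dPN mA.
have mp : measurable_fun [set: BRd] (p : BRd -> R).
  by apply/measurable_EFinP; exact: measurable_int ip.
have mA1 : measurable_fun [set: BRd] (\1_A : BRd -> R) by exact: measurable_indic.
have A1 x : `|\1_A x : R| <= 1 by rewrite indicE; case: (_ \in _); rewrite ?normr1 ?normr0.
have := dPN (\1_A) mA1 (ex_intro _ 1 A1).
rewrite /pint /Rintegral !integral_indic// !setIT => h.
rewrite lintRE; last by exact: measurable_funM.
have ipA := integrable_mul_bounded ip mA1 A1.
rewrite -[LHS]fineK; last exact: integrable_fin_num ipA.
rewrite -h EFinB !fineK//; exact: fin_num_measure.
Qed.

Lemma density_diff (nu : signed_measure R d) (p : Rd -> R) : is_density nu p ->
  exists P N : fmeas, charge_diff nu P N /\ diff_density p P N.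
Proof.
move=> [/lebesgue_integrableP ip nup]; have [P [N dPN]] := integrable_diff_density ip.
by exists P, N; split => // A mA; rewrite nup// (diff_density_set ip dPN mA).
Qed.

Lemma cderiv0 (a : 'I_d -> nat) (f : Rd -> R) : mindex_size a = 0%N -> cderiv a f = f.
Proof. by rewrite -size_mlist cderivE => /size0nil ->. Qed.

Lemma mindex_size_ord0 d' l : mindex_size (mi_of ([ffun=> ord0] : {ffun 'I_d' -> 'I_l.+1})) = 0%N.
Proof. by rewrite /mindex_size big1// => i _; rewrite /mi_of ffunE. Qed.

(** The term of order zero in [sup_norm]; it makes admissible test functions bounded, hence
    integrable for finite measures. *)
Lemma sup_norm_bound (Phi : Rd -> R) x : (`|Phi x|%:E <= sup_norm k Phi)%E.
Proof.
pose a0 : {ffun 'I_d -> 'I_k.+1} := [ffun=> ord0].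
have a00 := mindex_size_ord0 d k.
rewrite /sup_norm (bigD1 a0)/=; last by rewrite a00.
rewrite cderiv0// -[X in (X <= _)%E]adde0; apply: leeD.
  by apply: ereal_sup_ubound; exists x.
apply: sume_ge0 => a _; apply: (@le_trans _ _ `|cderiv (mi_of a) Phi 0|%:E); first by rewrite lee_fin.
by apply: ereal_sup_ubound; exists 0.
Qed.

Lemma charge_integralP (mu : signed_measure R d) (P N : fmeas) (f : Rd -> R) B :
  charge_diff mu P N -> measurable_fun [set: BRd] (f : BRd -> R) -> (forall x, `|f x| <= B) ->
  charge_integral mu f (pint P N (f : BRd -> R)).
Proof.
move=> dPN mf fB; exists P, N; split => //.
have fi (m : fmeas) := integrable_fin_num measurableT (@integrable_bounded _ _ _ m (f : BRd -> R) B mf fB).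
by rewrite /pint /Rintegral EFinB !fineK//; exact: (fi).
Qed.

(** [charge_integral] accepts any decomposition, so the pairs at hand may be inserted into the
    supremum. *)
Lemma dual_bound_dist (mu nu : signed_measure R d) (m1 m2 P N : fmeas) D :
  charge_diff mu m1 m2 -> charge_diff nu P N -> (dist_k k mu nu <= D%:E)%E ->
  dual_bound k (madd m1 N) (madd m2 P) D.
Proof.
move=> dmu dnu distD Phi sPhi Phi1.
have mPhi : measurable_fun [set: BRd] (Phi : BRd -> R).
  by apply: continuous_borel; exact: smooth_continuous.
have PhiB x : `|Phi x| <= 1 by rewrite -lee_fin; apply: le_trans (sup_norm_bound _ _) Phi1.
rewrite pint_madd//; last by exists 1.
rewrite -lee_fin; apply: le_trans distD; apply: ereal_sup_ubound.
exists Phi, (pint m1 m2 (Phi : BRd -> R)), (pint P N (Phi : BRd -> R)).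
by split => //; apply: charge_integralP PhiB.
Qed.

(** The supremum must not range over an empty set. The zero function is a witness, written as a
    [lincomb] to inherit smoothness and derivatives. *)
Lemma dist_k_ge0 (mu nu : signed_measure R d) : (0 <= dist_k k mu nu)%E.
Proof.
have [m1 [m2 dmu]] := jordan_charge_diff mu.
have [P [N dnu]] := jordan_charge_diff nu.
pose Z : Rd -> R := lincomb (fun=> 0 : R) (fun (_ : unit) (_ : 'I_d) => cst 0).
have sZ : forall (j : unit) (i : 'I_d), smooth1 (cst 0 : R -> R) by move=> _ _; exact: smooth1_cst.
have ZB x : `|Z x| <= 1.
  by rewrite /Z /lincomb big1 ?normr0// => j _; rewrite mul0r.
have mZ : measurable_fun [set: BRd] (Z : BRd -> R).
  by apply: continuous_borel; apply: smooth_continuous; exact: smooth_lincomb.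
apply: (@le_trans _ _ (`|pint m1 m2 (Z : BRd -> R) - pint P N (Z : BRd -> R)|)%:E).
  by rewrite lee_fin.
apply: ereal_sup_ubound; exists Z, (pint m1 m2 (Z : BRd -> R)), (pint P N (Z : BRd -> R)); split => //.
- exact: smooth_lincomb.
- apply: (@le_trans _ _ 0%E) => //; apply: sume_le0 => a _; apply: ge_ereal_sup => _ [x _ <-].
  rewrite cderiv_lincomb// /lincomb big1 ?normr0// => j _; exact: mul0r.
- exact: charge_integralP ZB.
- exact: charge_integralP ZB.
Qed.

End Charges.

(** * Limits of the mollification *)

Section SeriesLimit.
Context (R : realType) (d : nat).
Local Notation Rd := (Rd R d).
Local Notation BRd := (BorelRd R d).
Local Notation L := (@lmeas R d).
Variable e : R -> R.
Hypothesis ye : young e.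

Lemma summable_cvg (u : R^nat) : (\sum_(0 <= i <oo) `|u i|%:E < +oo)%E -> cvgn (series u).
Proof.
move=> ufin; apply: normed_cvg; apply: nondecreasing_is_cvgn.
  by apply: nondecreasing_series => n _ _; exact: normr_ge0.
exists (fine (\sum_(0 <= i <oo) `|u i|%:E)) => _ [n _ <-].
rewrite -lee_fin fineK; last first.
  by rewrite ge0_fin_numE// nneseries_ge0// => i _ _; rewrite lee_fin.
rewrite /series/= -sumEFin; apply: nneseries_lim_ge => i _ _.
by rewrite lee_fin.
Qed.

(* A limsup rather than a chosen limit: the result depends on [mu] alone, not on
   the approximating sequence used to prove convergence. *)
Definition lim_fun (U : nat -> BRd -> R) (x : BRd) : R := fine (limn_esup (fun n => (U n x)%:E)).

Lemma measurable_lim_fun U : (forall n, measurable_fun setT (U n)) ->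
  measurable_fun setT (lim_fun U).
Proof.
move=> mU; apply: measurableT_comp => //.
by apply: measurable_fun_limn_esup => n; exact/measurable_EFinP.
Qed.

Lemma lim_funP U x l : U n x @[n --> \oo] --> l -> lim_fun U x = l.
Proof.
move=> Ul; rewrite /lim_fun.
have /cvg_limn_einf_sup[_ ->]// : (U n x)%:E @[n --> \oo] --> l%:E.
by apply: cvg_EFin => //; apply: nearW.
Qed.

Lemma orlicz_le_locally_integrable (f : BRd -> R) c : orlicz_le e f c ->
  Defs.locally_integrable (f : Rd -> R).
Proof.
move=> fc; have [mf c0 _] := fc; split => // K cK.
have [M _ KM] := compact_sub_cube cK.
have mK : measurable (K : set BRd).
  rewrite -[K]setCK; apply: measurableC; apply: measurable_open.
  by apply: closed_openC; exact: compact_closed cK.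
apply: (@le_lt_trans _ _ (c%:E * (L (cube M) + (e 1)^-1%:E))%E); last first.
  rewrite lte_mul_pinfty ?lee_fin ?ltW// lte_add_pinfty ?ltry//.
  exact: lmeas_cube_lty.
apply: le_trans (orlicz_le_L1loc ye M fc).
rewrite lint_ge0E; last 2 first.
- by move=> y; rewrite lee_fin mulr_ge0.
- apply/measurable_EFinP; apply: measurable_funM; first exact: measurableT_comp.
  exact: measurable_indic.
rewrite [leRHS]integral_mkcond; apply: ge0_le_integral => //.
- apply/measurable_EFinP; apply: measurable_funM; first exact: measurableT_comp.
  exact: measurable_indic.
- apply/(measurable_restrictT _ _).1; first exact: measurable_cube.
  apply: measurable_funTS; apply: measurableT_comp => //; exact/measurable_EFinP.
move=> x _; rewrite patchE indicE; case: (boolP (x \in K)) => xK; last first.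
  by rewrite mulr0; case: ifP => _; [exact: abse_ge0|exact: lexx].
by rewrite mulr1 mem_set//; apply: KM; exact/set_mem.
Qed.

Variables (U : nat -> BRd -> R) (c : nat -> R) (S : R).
Hypothesis U0 : orlicz_le e (U 0%N) (c 0%N).
Hypothesis US : forall n, orlicz_le e (fun x => U n.+1 x - U n x) (c n.+1).
Hypothesis cS : forall n, \sum_(i < n) c i <= S.

Let f (n : nat) : BRd -> R := if n is n'.+1 then (fun x => U n'.+1 x - U n' x) else U 0%N.

Let fc n : orlicz_le e (f n) (c n). Proof. by case: n. Qed.

Let mf n : measurable_fun setT (f n). Proof. by case: (fc n). Qed.

Let sumf n x : \sum_(i < n.+1) f i x = U n x.
Proof.
elim: n => [|n IH]; first by rewrite big_ord1.
by rewrite big_ord_recr/= IH addrC subrK.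
Qed.

Let mU n : measurable_fun setT (U n).
Proof.
elim: n => [|n IH]; first by case: U0.
rewrite (_ : U n.+1 = (fun x => U n.+1 x - U n x) \+ U n).
  by apply: measurable_funD => //; case: (US n).
by apply/funext => x /=; rewrite subrK.
Qed.

Let S0 : 0 < S.
Proof.
by apply: lt_le_trans (cS 1); rewrite big_ord1; case: U0.
Qed.

(** The sum of the moduli of the increments. Integrable on every cube, it is finite almost
    everywhere, which gives convergence, and it dominates all [U n]. *)
Let h (x : BRd) : \bar R := \sum_(0 <= i <oo) `|f i x|%:E.

Let mh : measurable_fun setT h.
Proof.
apply: ge0_emeasurable_sum => [i x _ _|i _]; first by rewrite lee_fin.
by apply/measurable_EFinP; exact: measurableT_comp.
Qed.

Let h0 x : (0 <= h x)%E.
Proof. by apply: nneseries_ge0 => i _ _; rewrite lee_fin. Qed.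

Let ih M : L.-integrable (cube M) h.
Proof.
apply/integrableP; split; first exact: measurable_funTS.
under eq_integral do rewrite gee0_abs//.
have mM := @measurable_cube R d M.
rewrite integral_nneseries//; last first.
  by move=> n; apply: measurable_funTS; apply/measurable_EFinP; exact: measurableT_comp.
apply: (@le_lt_trans _ _ (S%:E * (L (cube M) + (e 1)^-1%:E))%E); last first.
  rewrite lte_mul_pinfty ?lee_fin ?ltW// lte_add_pinfty ?ltry//.
  exact: lmeas_cube_lty.
have K0 : (0 <= L (cube M) + (e 1)^-1%:E)%E.
  by rewrite adde_ge0// lee_fin invr_ge0 young_ge0.
apply: lime_le.
  by apply: is_cvg_nneseries => n _ _; apply: integral_ge0 => x _; rewrite lee_fin.
apply: nearW => n; rewrite big_mkord.
apply: (@le_trans _ _ (\sum_(i < n) (c i)%:E * (L (cube M) + (e 1)^-1%:E))%E).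
  by apply: lee_sum => i _; exact: orlicz_le_L1loc (fc i).
rewrite -ge0_sume_distrl; last by move=> i _; rewrite lee_fin ltW//; case: (fc i).
by apply: lee_wpmul2r => //; rewrite sumEFin lee_fin.
Qed.

Lemma lim_fun_cvg : {ae L, forall x, U n x @[n --> \oo] --> lim_fun U x}.
Proof.
have h1 : {ae L, forall x, forall n, cube n%:R x -> h x \is a fin_num}.
  apply: ae_foralln => n; apply: integrable_ae; first exact: measurable_cube.
  exact: ih.
apply: (@filterS _ _ (ae_filter_ringOfSetsType _)) h1 => x hx.
have [n xn] : exists n, cube n%:R x.
  have : [set: Rd] x by [].
  by rewrite -bigcup_box => -[n _ xn]; exists n.
have /summable_cvg/cvg_ex[l fl] : (h x < +oo)%E by rewrite -ge0_fin_numE// (hx n).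
suff Ul : U n x @[n --> \oo] --> l by rewrite (lim_funP Ul).
have := fl; rewrite -(cvg_shiftS _ _).
by apply: cvg_trans; apply: near_eq_cvg; apply: nearW => i /=; rewrite /series/= big_mkord sumf.
Qed.

Lemma lim_fun_orlicz_le : orlicz_le e (lim_fun U) S.
Proof.
apply: (orlicz_le_series ye fc cS S0 (measurable_lim_fun mU)).
apply: (@filterS _ _ (ae_filter_ringOfSetsType _)) lim_fun_cvg => x Ux.
by rewrite -(cvg_shiftS _ _); apply: cvg_trans Ux; apply: near_eq_cvg; apply: nearW => i /=; rewrite sumf.
Qed.

Lemma lim_fun_integral (phi : Rd -> R) : continuous phi -> csupp phi ->
  (\int[L]_x (U n x * phi x)%:E @[n --> \oo] --> \int[L]_x (lim_fun U x * phi x)%:E)%E.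
Proof.
move=> cphi sphi; have [M [B [M0 B0 phiB]]] := csupp_bounded cphi sphi.
have mphi := continuous_borel cphi.
have mM := @measurable_cube R d M.
have E (g : BRd -> R) : (\int[L]_x (g x * phi x)%:E = \int[L]_(x in cube M) (g x * phi x)%:E)%E.
  rewrite [RHS]integral_mkcond; apply: eq_integral => x _; rewrite patchE.
  case: ifP => // /negbT/negP xM; have := phiB x; rewrite indicE.
  rewrite (_ : x \in _ = false); last exact/negP.
  by rewrite mulr0 normr_le0 => /eqP ->; rewrite mulr0.
rewrite E; under eq_fun do rewrite E.
have m1 n : measurable_fun (cube M : set BRd) (fun x => (U n x * phi x)%:E).
  by apply: measurable_funTS; apply/measurable_EFinP; exact: measurable_funM.
have m2 : measurable_fun (cube M : set BRd) (fun x => (lim_fun U x * phi x)%:E).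
  apply: measurable_funTS; apply/measurable_EFinP; apply: measurable_funM => //.
  exact: measurable_lim_fun.
have ae1 : {ae L, forall x, cube M x -> (U n x * phi x)%:E @[n --> \oo] --> (lim_fun U x * phi x)%:E}.
  apply: (@filterS _ _ (ae_filter_ringOfSetsType _)) lim_fun_cvg => x Ux _.
  apply: cvg_EFin; first exact: nearW.
  by apply: cvgM => //; exact: cvg_cst.
have iBh : L.-integrable (cube M) (fun x => B%:E * h x)%E by apply: integrableZl => //; exact: ih.
have dom : {ae L, forall x n, cube M x -> (`|(U n x * phi x)%:E| <= B%:E * h x)%E}.
  apply: aeW => x n _; rewrite abse_EFin normrM mulrC EFinM; apply: lee_pmul => //.
  - by rewrite lee_fin; apply: le_trans (phiB x) _; rewrite ler_piMr// indicE; case: (_ \in _).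
  - rewrite -sumf; apply: (@le_trans _ _ (\sum_(i < n.+1) `|f i x|)%:E).
      by rewrite lee_fin; exact: ler_norm_sum.
    rewrite -sumEFin -(big_mkord xpredT (fun i => `|f i x|%:E)).
    by apply: nneseries_lim_ge => i _ _; rewrite lee_fin.
by case: (dominated_convergence mM m1 m2 ae1 iBh dom).
Qed.

End SeriesLimit.

(** * Fubini for mollified measures *)

Section MconvFubini.
Context (R : realType) (d : nat).
Local Notation Rd := (Rd R d).
Local Notation BRd := (BorelRd R d).
Local Notation L := (@lmeas R d).
Local Notation fmeas := {finite_measure set BRd -> \bar R}.
Variables (del : R) (chi : 'I_d -> R -> R).
Hypotheses (del0 : 0 < del) (bc : bump_fam chi).

(** The adjoint of [mconv]: [fubini_mconv] transfers the mollification from the measure to the test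
    function. *)
Definition tconv (f : Rd -> R) (y : Rd) : R := fine (\int[L]_x (ker del chi ((x : Rd) - y) * f x)%:E).

Lemma integrable_ker_mul (f : Rd -> R) y : continuous f -> csupp f ->
  L.-integrable setT (fun x : BRd => (ker del chi ((x : Rd) - y) * f x)%:E).
Proof.
move=> cf sf; have [M [B [M0 B0 fB]]] := csupp_bounded cf sf.
have [C C0 kC] := ker_bounded del0 bc.
apply: (@integrable_csupp _ _ _ M (C * B)).
  by apply: measurable_funM; [exact: measurable_kerr|exact: continuous_borel].
by move=> x; rewrite normrM -mulrA ler_pM.
Qed.

Lemma tconv_bounded (f : Rd -> R) : continuous f -> csupp f ->
  exists2 T, 0 <= T & forall y, `|tconv f y| <= T.
Proof.
move=> cf sf; have [M [B [M0 B0 fB]]] := csupp_bounded cf sf.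
have [C C0 kC] := ker_bounded del0 bc.
have CB x : `|C * B * \1_(cube M) x| = C * B * \1_(cube M) x :> R.
  by rewrite ger0_norm// !mulr_ge0.
have mM := @measurable_cube R d M.
exists (fine (\int[L]_x (C * B * \1_(cube M) x)%:E)).
  by rewrite fine_ge0// integral_ge0// => x _; rewrite lee_fin -CB.
move=> y; rewrite /tconv -fine_abse; last first.
  exact: integrable_fin_num (integrable_ker_mul y cf sf).
apply: fine_le.
- by rewrite abse_fin_num; exact: integrable_fin_num (integrable_ker_mul y cf sf).
- exact: integrable_fin_num (cst_indic_integrable (C * B) mM (lmeas_cube_lty d M)).
apply: le_trans (le_abse_integral _ _ _) _ => //.
  exact: measurable_int (integrable_ker_mul y cf sf).
apply: ge0_le_integral => //.
- apply: measurableT_comp => //; exact: measurable_int (integrable_ker_mul y cf sf).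
- by apply/measurable_EFinP; apply: measurable_funM => //; exact: measurable_indic.
by move=> x _; rewrite abse_EFin lee_fin normrM -mulrA ler_pM.
Qed.

Lemma measurable_tconv (f : Rd -> R) : continuous f -> measurable_fun [set: BRd] (tconv f : BRd -> R).
Proof.
move=> cf; have mf := continuous_borel cf.
apply: (@measurable_fine_param _ _ _ _ L (fun p : BRd * BRd => ker del chi ((p.2 : Rd) - p.1) * f p.2)).
apply: measurable_funM; last exact: measurableT_comp.
have msw : measurable_fun [set: BRd * BRd] (fun p : BRd * BRd => (p.2, p.1)) by exact: measurable_swap.
exact: (measurableT_comp (measurable_ker_sub del bc) msw).
Qed.

Lemma fubini_mconv1 (m : fmeas) (f : Rd -> R) : continuous f -> csupp f ->
  L.-integrable setT (fun x : BRd => ((\int[m]_y ker del chi ((x : Rd) - y)) * f x)%:E) /\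
  (\int[L]_x ((\int[m]_y ker del chi ((x : Rd) - y)) * f x)%:E = (\int[m]_y tconv f y)%:E)%E.
Proof.
move=> cf sf; have [M [B [M0 B0 fB]]] := csupp_bounded cf sf.
have [C C0 kC] := ker_bounded del0 bc.
have mf := continuous_borel cf.
pose K (p : BRd * BRd) : \bar R := (ker del chi ((p.1 : Rd) - p.2) * f p.1)%:E.
have mK : measurable_fun setT K.
  apply/measurable_EFinP; apply: measurable_funM; first exact: measurable_ker_sub.
  exact: measurableT_comp.
have mM := @measurable_cube R d M.
have iK : (L \x m)%E.-integrable setT K.
  apply/integrable12ltyP => //.
  apply: (@le_lt_trans _ _ (\int[L]_x ((C * B * fine (m setT)) * \1_(cube M) x)%:E)%E).
    apply: ge0_le_integral => //.
    - by move=> x _; apply: integral_ge0.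
    - apply: (measurable_fun_fubini_tonelli_F (fun p : BRd * BRd => `|K p|%E)) => //.
      exact: measurableT_comp.
    - by apply/measurable_EFinP; apply: measurable_funM => //; exact: measurable_indic.
    move=> x _; apply: (@le_trans _ _ (\int[m]_y (C * B * \1_(cube M) x)%:E)%E).
      apply: ge0_le_integral => //.
      - by apply: measurableT_comp => //; exact: (measurableT_comp mK (pair1_measurable x)).
      by move=> y _; rewrite abse_EFin lee_fin normrM -mulrA ler_pM.
    rewrite (@integral_cst _ _ _ m setT measurableT).
    rewrite [X in (_ * X <= _)%E](_ : _ = (fine (m [set: BRd]))%:E); last first.
      by rewrite fineK//; exact: fin_num_measure.
    by rewrite -EFinM lee_fin mulrAC.
  have /integrableP[_] := cst_indic_integrable (C * B * fine (m setT)) mM (lmeas_cube_lty d M).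
  apply: le_lt_trans; apply: ge0_le_integral => //.
  - move=> x _; rewrite lee_fin !mulr_ge0// fine_ge0//.
  - by apply/measurable_EFinP; apply: measurable_funM => //; exact: measurable_indic.
  - apply: measurableT_comp => //.
    by apply/measurable_EFinP; apply: measurable_funM => //; exact: measurable_indic.
  by move=> x _; rewrite lee_fin ler_norm.
have kint x := integrable_kerl m x del0 bc.
have E x : ((\int[m]_y ker del chi (x - y)) * f x)%:E = (\int[m]_y K (x, y))%E.
  rewrite mulrC EFinM fineK; last exact: integrable_fin_num (kint x).
  by rewrite -(integralZl _ (kint x))//; apply: eq_integral => y _; rewrite /K mulrC EFinM.
split.
  under eq_fun do rewrite E.
  exact: integrable_fubini_F.
under eq_integral do rewrite E.
rewrite integral12_prod_meas1// -integral21_prod_meas1//.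
rewrite fineK; last first.
  have [T T0 fT] := tconv_bounded cf sf.
  by apply: integrable_fin_num => //; apply: (@integrable_bounded _ _ _ m _ T) => //; exact: measurable_tconv.
apply: eq_integral => y _; rewrite fineK//.
exact: integrable_fin_num (integrable_ker_mul y cf sf).
Qed.

Lemma fubini_mconv (m1 m2 : fmeas) (f : Rd -> R) : continuous f -> csupp f ->
  (\int[L]_x (mconv chi m1 m2 del x * f x)%:E = (pint m1 m2 (tconv f : BRd -> R))%:E)%E.
Proof.
move=> cf sf; have [i1 e1] := fubini_mconv1 m1 cf sf; have [i2 e2] := fubini_mconv1 m2 cf sf.
rewrite /pint EFinB -e1 -e2 -integralB_EFin//.
by apply: eq_integral => x _; rewrite -EFinB /mconv /pint mulrBl.
Qed.

(** A bound by the total mass, uniform in [del]. It is used to show that the limit is integrable on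
    the whole space, where Luxemburg bounds give only local integrability. *)
Lemma mconv_L1 (m1 m2 : fmeas) (B : R) : 0 <= B -> (forall i t, `|chi i t| <= B) ->
  (\int[L]_x `|(mconv chi m1 m2 del x)%:E| <= ((2 * B) ^+ d * fine (m1 setT + m2 setT))%:E)%E.
Proof.
move=> B0 cB.
have kint (m : fmeas) x := integrable_kerl m x del0 bc.
have mK : measurable_fun setT (fun p : BRd * BRd => `|(ker del chi ((p.1 : Rd) - p.2))%:E|%E).
  by apply: measurableT_comp => //; apply/measurable_EFinP; exact: measurable_ker_sub.
have Km (m : fmeas) : (\int[L]_x \int[m]_y `|(ker del chi ((x : Rd) - y))%:E| <= ((2 * B) ^+ d)%:E * m setT)%E.
  rewrite (fubini_tonelli (fun p : BRd * BRd => `|(ker del chi ((p.1 : Rd) - p.2))%:E|%E))//.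
  apply: (@le_trans _ _ (\int[m]_y ((2 * B) ^+ d)%:E)%E); last by rewrite integral_cst.
  apply: ge0_le_integral => //.
  - by move=> y _; exact: integral_ge0.
  - exact: (measurable_fun_fubini_tonelli_G (fun p : BRd * BRd => `|(ker del chi ((p.1 : Rd) - p.2))%:E|%E)).
  by move=> y _; exact: integral_ker_ler.
have mF (m : fmeas) : measurable_fun setT (fun x : BRd => (\int[m]_y `|(ker del chi ((x : Rd) - y))%:E|)%E).
  exact: (measurable_fun_fubini_tonelli_F (fun p : BRd * BRd => `|(ker del chi ((p.1 : Rd) - p.2))%:E|%E)).
apply: (@le_trans _ _ (\int[L]_x (\int[m1]_y `|(ker del chi ((x : Rd) - y))%:E| +
   \int[m2]_y `|(ker del chi ((x : Rd) - y))%:E|))%E).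
  apply: ge0_le_integral => //.
  - by apply: measurableT_comp => //; apply/measurable_EFinP; exact: measurable_mconv.
  - exact: emeasurable_funD.
  move=> x _; rewrite /mconv /pint EFinB !fineK//; try exact: integrable_fin_num (kint _ x).
  apply: le_trans (lee_abs_sub _ _) _; apply: leeD; apply: le_abse_integral => //;
    exact: measurable_int (kint _ x).
rewrite ge0_integralD//; last 2 first.
- by move=> x _; apply: integral_ge0.
- by move=> x _; apply: integral_ge0.
apply: le_trans (leeD (Km m1) (Km m2)) _.
rewrite EFinM fineK; last by rewrite fin_numD !fin_num_measure.
by rewrite muleDr// fin_num_adde_defl// fin_num_measure.
Qed.

End MconvFubini.

(** * The kernels as an approximate identity *)

Section ApproxIdentity.
Context (R : realType) (d : nat).
Local Notation Rd := (Rd R d).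
Local Notation BRd := (BorelRd R d).
Local Notation L := (@lmeas R d).
Local Notation fmeas := {finite_measure set BRd -> \bar R}.

Lemma kerlE del chi (x y : Rd) :
  ker del chi (x - y) = tens (fun i t => del^-1 * chi i (del^-1 * t + (- del^-1) * y 0 i)) x.
Proof. by apply: eq_bigr => i _; rewrite !mxE; congr (_ * chi i _); ring. Qed.

Lemma tconv_cderiv del chi (al : 'I_d -> nat) (f : Rd -> R) y : 0 < del -> bump_fam chi ->
  smooth f -> csupp f ->
  tconv del chi (cderiv al f) y =
  (-1) ^+ mindex_size al * del^-1 ^+ mindex_size al * tconv del (dfam al chi) f y.
Proof.
move=> d0 bc sf uf; have bc' := bump_fam_dfam al bc.
pose c i t := del^-1 * chi i (del^-1 * t + (- del^-1) * y 0 i).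
have sc i : smooth1 (c i) by apply: smooth1_affine; exact: bc.1.
have := @integral_tens_cderiv R d c f al sc sf uf.
rewrite /tconv; under eq_integral do rewrite -kerlE.
move=> ->.
have -> : (\int[L]_x (tens (fun i => derive1n (al i) (c i)) x * f x)%:E =
    (del^-1 ^+ mindex_size al)%:E * \int[L]_x (ker del (dfam al chi) ((x : Rd) - y) * f x)%:E)%E.
  rewrite -integralZl//; last exact: integrable_ker_mul (smooth_continuous sf) uf.
  apply: eq_integral => x _; rewrite -EFinM kerlE mulrA; congr (_ * _)%:E.
  rewrite /tens /mindex_size -prodrXr -big_split/=; apply: eq_bigr => i _.
  by rewrite /c derive1n_affine; [rewrite mulrA [_ * del^-1]mulrC|exact: bc.1].
rewrite muleA -EFinM fineM//.
exact: integrable_fin_num (integrable_ker_mul d0 bc' y (smooth_continuous sf) uf).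
Qed.

Lemma pintZ (m1 m2 : fmeas) (c : R) (f : BRd -> R) : measurable_fun setT f ->
  (exists B, forall x, `|f x| <= B) -> pint m1 m2 (fun x => c * f x) = c * pint m1 m2 f.
Proof.
move=> mf [B fB].
have fi (m : fmeas) := @integrable_bounded _ _ _ m f B mf fB.
have := @pint_lincomb _ _ _ m1 m2 unit (fun=> c) (fun=> f) (fun=> fi _) (fun=> fi _).
rewrite [X in _ = X]big_const/= card_unit/= addr0 => <-.
by congr pint; apply/funext => x; rewrite big_const/= card_unit/= addr0.
Qed.

(** [iter_lint_prod] asks for nonnegative factors, while kernels with vanishing moments may change
    sign. Here the factors are exchanged one at a time, through [hyb], and each exchange is an
    instance of [integral_slice0]. *)
Lemma tens_integral_eq (c c' : 'I_d -> R -> R) (B M : R) :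
  (forall i, measurable_fun setT (c i)) -> (forall i, measurable_fun setT (c' i)) ->
  (forall i t, `|c i t| <= B * \1_(`[- M, M]%classic) t) ->
  (forall i t, `|c' i t| <= B * \1_(`[- M, M]%classic) t) ->
  (forall i, \int[@lebesgue_measure R]_t (c i t)%:E = \int[@lebesgue_measure R]_t (c' i t)%:E)%E ->
  (\int[L]_x (tens c x)%:E = \int[L]_x (tens c' x)%:E)%E.
Proof.
move=> mc mc' cB cB' cc'.
pose hyb n : 'I_d -> R -> R := fun i => if (i < n)%N then c' i else c i.
have mh n i : measurable_fun setT (hyb n i) by rewrite /hyb; case: ifP.
have hB n i t : `|hyb n i t| <= B * \1_(`[- M, M]%classic) t by rewrite /hyb; case: ifP.
have int1 (g : R -> R) : measurable_fun setT g -> (forall t, `|g t| <= B * \1_(`[- M, M]%classic) t) ->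
    (@lebesgue_measure R).-integrable setT (EFin \o g).
  move=> mg gB; have iI : (@lebesgue_measure R).-integrable setT (fun t : R => (\1_(`[- M, M]%classic) t : R)%:E).
    apply/integrableP; split; first exact/measurable_EFinP/measurable_indic.
    under eq_integral do rewrite gee0_abs ?lee_fin//.
    rewrite integral_indic//= setIT.
    have -> : lebesgue_measure (`[- M, M]%classic : set R) = (if - M < M then (M - - M)%:E else 0%E).
      by rewrite lebesgue_measure_itv/= lte_fin.
    by case: ifP => _; rewrite ltry.
  have {}iI := integrableZl measurableT B iI.
  apply: le_integrable iI => //; first exact/measurable_EFinP.
  by move=> t _ /=; rewrite lee_fin; apply: le_trans (gB t) (ler_norm _).
have mt n : measurable_fun [set: BRd] (tens (hyb n) : BRd -> R).
  apply: measurable_prod => i _; apply: (measurableT_comp (mh n i)).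
  exact: measurable_coord.
have tB n x : `|tens (hyb n) x| <= B ^+ d * \1_(cube M) x.
  have -> : B ^+ d = \prod_(i < d) B by rewrite prodr_const card_ord.
  rewrite cube_indic /tens normr_prod -big_split/=.
  apply: ler_prod => i _; rewrite normr_ge0/=; apply: le_trans (hB n i _) _.
  by rewrite indicE mem_setE in_itv/= -ler_norml.
have it n : L.-integrable setT (EFin \o (tens (hyb n) : BRd -> R)) by exact: integrable_csupp (tB n).
have step n : (\int[L]_x (tens (hyb n) x)%:E = \int[L]_x (tens (hyb n.+1) x)%:E)%E.
  have [nd|nd] := leqP d n.
    apply: eq_integral => x _; congr (_%:E); apply: eq_bigr => i _.
    by rewrite /hyb (leq_trans (ltn_ord i) nd) (leq_trans (ltn_ord i) (leqW nd)).
  apply: fin_sube0; [exact: integrable_fin_num (it _)|exact: integrable_fin_num (it _)|].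
  rewrite -integralB_EFin//.
  pose F : BRd -> R := fun x => tens (hyb n) x - tens (hyb n.+1) x.
  apply: (@integral_slice0 R d F (Ordinal nd)).
    rewrite (_ : EFin \o F = fun x => (EFin \o tens (hyb n)) x - (EFin \o tens (hyb n.+1)) x)%E//.
    exact: integrableB.
  move=> x; set i := Ordinal nd; pose Q := \prod_(j | j != i) hyb n j (x 0 j).
  have FE t : F (setcoord x i t) = Q * (c i t - c' i t).
    rewrite /F !tens_setcoord {1 3}/hyb/= ltnn ltnSn mulrBr !(mulrC Q).
    congr (_ - _ * _); apply: eq_bigr => j ji; rewrite /hyb ltnS leq_eqVlt.
    by rewrite (_ : (j == n :> nat) = false)//; apply/negbTE; apply: contra ji => /eqP jn; apply/eqP/val_inj.
  have ic := int1 _ (mc i) (cB i); have ic' := int1 _ (mc' i) (cB' i).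
  have icc : (@lebesgue_measure R).-integrable setT (fun t => (c i t)%:E - (c' i t)%:E)%E.
    exact: integrableB.
  rewrite (_ : (fun t => (F (setcoord x i t))%:E) = (fun t => Q%:E * ((c i t)%:E - (c' i t)%:E))%E); last first.
    by apply/funext => t; rewrite FE EFinM EFinB.
  split; first exact: integrableZl.
  rewrite integralZl// integralB// cc' subee ?mule0//.
  exact: integrable_fin_num ic'.
have -> : tens c = tens (hyb 0) by [].
have -> : tens c' = tens (hyb d).
  by apply/funext => x; apply: eq_bigr => i _; rewrite /hyb ltn_ord.
have all_eq n : (\int[L]_x (tens (hyb 0) x)%:E = \int[L]_x (tens (hyb n) x)%:E)%E.
  by elim: n => // n ->.
exact: all_eq.
Qed.

End ApproxIdentity.

Section Mollifier.
Context (R : realType) (d N : nat) (a b A : R -> R).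
Hypothesis vp : vanishing_pair N a b A.
Local Notation Rd := (Rd R d).
Local Notation BRd := (BorelRd R d).
Local Notation L := (@lmeas R d).
Local Notation fmeas := {finite_measure set BRd -> \bar R}.

Lemma integral_vanishing1 (del y : R) : 0 < del ->
  (\int[lebesgue_measure]_t (del^-1 * a (del^-1 * t + (- del^-1) * y))%:E = 1)%E.
Proof.
case: vp => -[sa _ _ Aa] [a0 _ A0 A1 _] d0.
have id0 : 0 < del^-1 by rewrite invr_gt0.
have dE (t : R) : t = del * (del^-1 * t) by rewrite mulrA divff ?mul1r// gt_eqF.
pose F t := A (del^-1 * t + (- del^-1) * y).
have FE t : is_derive (t : R) (1 : R) F (del^-1 * a (del^-1 * t + (- del^-1) * y)).
  have := @is_derive_affine R A 1 del^-1 ((- del^-1) * y) t _ (Aa _).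
  rewrite mul1r; under [X in is_derive _ _ X _ -> _]eq_fun do rewrite mul1r.
  by [].
have ab : y - del < y + del by lra.
have cg : continuous (fun t => del^-1 * a (del^-1 * t + (- del^-1) * y)).
  by apply: smooth1_continuous; exact: smooth1_affine.
have := FTC_is_derive ab FE cg.
rewrite /F (_ : del^-1 * (y + del) + _ = 1); last first.
  by rewrite mulrDr mulVf ?gt_eqF//; ring.
rewrite (_ : del^-1 * (y - del) + _ = -1); last first.
  by rewrite mulrBr mulVf ?gt_eqF//; ring.
rewrite A1// A0// subr0 => <-.
rewrite [RHS]integral_mkcond; apply: eq_integral => t _; rewrite patchE.
case: ifPn => // /negP tn; rewrite a0 ?mulr0//.
rewrite leNgt; apply/negP => t1; apply: tn; rewrite mem_setE in_itv/=.
move: t1; rewrite (_ : _ + _ = del^-1 * (t - y)); last ring.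
rewrite ltr_norml => /andP[h1 h2].
have := dE (t - y); move: h1 h2; set u := del^-1 * (t - y) => h1 h2 tE.
have : - del < del * u by rewrite -[ltLHS]mulr1 mulNr -mulrN ltr_pM2l.
have : del * u < del by rewrite -[ltRHS]mulr1 ltr_pM2l.
by rewrite -tE => h3 h4; apply/andP; split; lra.
Qed.

Lemma integral_ker1 del (y : Rd) : 0 < del ->
  (\int[L]_x (ker del (@kfam R d a) ((x : Rd) - y))%:E = 1)%E.
Proof.
move=> d0; case: (vp) => -[sa _ _ Aa] [a0 _ A0 A1 _].
have [B B1 aB] := bump_fam_bound (@bump_kfam R d N a b A vp).
have id0 : 0 < del^-1 by rewrite invr_gt0.
have B0 : 0 <= B by exact: le_trans ler01 B1.
under eq_integral do rewrite kerlE.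
pose M := 1 + del + \sum_i `|y 0 i|.
have yM i : `|y 0 i| <= \sum_i `|y 0 i| by rewrite (bigD1 i)//= lerDl sumr_ge0.
have S0 : 0 <= \sum_i `|y 0 i| by rewrite sumr_ge0.
(* A reference factor of integral 1: its tensor power is the indicator of the unit box. [M] is large
   enough for [[-M, M]] to contain both supports. *)
pose w : R -> R := \1_(`[0, 1]%classic).
have mw : measurable_fun setT w by exact: measurable_indic.
have w1 : (\int[lebesgue_measure]_t (w t)%:E = 1 :> \bar R)%E.
  rewrite integral_indic//= setIT.
  have -> : lebesgue_measure (`[0, 1]%classic : set R) = (if (0 : R) < 1 then (1 - 0)%:E else 0%E).
    by rewrite lebesgue_measure_itv/= lte_fin.
  by rewrite ltr01 subr0.
rewrite (@tens_integral_eq _ _ _ (fun=> w) (1 + del^-1 * B) M).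
- have -> : tens (fun=> w) = (\1_(box 0 (const_mx 1)) : Rd -> R).
    apply/funext => x; rewrite box_indic; apply: eq_bigr => i _.
    by rewrite /w !mxE.
  rewrite integral_indic//= ?setIT; last exact: measurable_box.
  rewrite lmeas_box; last by move=> i; rewrite !mxE.
  by congr EFin; rewrite big1// => i _; rewrite !mxE subr0.
- move=> i; apply: continuous_measurable_fun; apply: smooth1_continuous.
  exact: smooth1_affine.
- by [].
- move=> i t; rewrite indicE mem_setE in_itv/= -ler_norml.
  have [tM|tM] := leP `|t| M.
    rewrite mulr1 normrM (gtr0_norm id0); apply: (@le_trans _ _ (del^-1 * B)); last lra.
    by rewrite ler_pM2l.
  rewrite mulr0 normr_le0 /kfam a0 ?mulr0//.
  rewrite (_ : _ + _ = del^-1 * (t - y 0 i)); last ring.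
  rewrite normrM (gtr0_norm id0) ler_pdivlMl// mulr1.
  have := ler_normB t (y 0 i); have := yM i; have := lerB_dist t (y 0 i); rewrite /M in tM; lra.
- move=> i t; rewrite /w !indicE !mem_setE !in_itv/=.
  have dB : 0 <= del^-1 * B by rewrite mulr_ge0// ltW.
  case: (boolP (0 <= t <= 1)) => [/andP[t0 t1]|_]; last by rewrite normr0 mulr_ge0//; lra.
  rewrite normr1 (_ : _ && _ = true) ?mulr1; first lra.
  by apply/andP; split; rewrite /M; lra.
- by move=> i; rewrite integral_vanishing1.
Qed.

(** The usual argument for a kernel of integral 1 shrinking to a point. As the kernel may be signed,
    its L^1 bound [(2B)^d] enters the choice of [eta]. *)
Lemma tconv_cvg (f : Rd -> R) (y : Rd) : continuous f -> csupp f ->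
  tconv (2 ^- n) (@kfam R d a) f y @[n --> \oo] --> f y.
Proof.
move=> cf sf; have bk := @bump_kfam R d N a b A vp.
have [B B1 aB] := bump_fam_bound bk.
have B0 : 0 <= B by exact: le_trans ler01 B1.
have M0 : 0 < (2 * B) ^+ d by rewrite exprn_gt0// mulr_gt0// (lt_le_trans ltr01).
apply/cvgrPdist_le => eps eps0.
pose eta := eps / (2 * B) ^+ d.
have eta0 : 0 < eta by rewrite divr_gt0.
have /cvgrPdist_lt/(_ eta eta0)/nbhs_ballP[r /= r0 rf] := cf y.
have : (2 ^- n : R) @[n --> \oo] --> 0.
  under eq_fun do rewrite -exprVn; apply: cvg_expr.
  by rewrite ger0_norm// invf_lt1// ltr1n.
move=> /cvgrPdist_lt/(_ r r0).
apply: filterS => n; rewrite sub0r normrN; set del := 2 ^- n => dr.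
have d0 : 0 < del by rewrite invr_gt0 exprn_gt0.
rewrite (gtr0_norm d0) in dr.
have ik : L.-integrable setT (fun x : BRd => (ker del (@kfam R d a) ((x : Rd) - y))%:E).
  apply/integrableP; split; first by apply/measurable_EFinP; exact: measurable_kerr.
  by apply: le_lt_trans (integral_ker_ler y d0 bk B0 aB) _; rewrite ltry.
have ikf := integrable_ker_mul d0 bk y cf sf.
have E : f y = fine (\int[L]_x (f y * ker del (@kfam R d a) ((x : Rd) - y))%:E).
  under eq_integral do rewrite EFinM.
  by rewrite integralZl// integral_ker1// mule1.
have iyk : L.-integrable setT (fun x : BRd => (f y * ker del (@kfam R d a) ((x : Rd) - y))%:E).
  by under eq_fun do rewrite EFinM; exact: integrableZl.
rewrite {1}E /tconv -fineB; [|exact: integrable_fin_num iyk|exact: integrable_fin_num ikf].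
rewrite -integralB_EFin// -fine_abse; last first.
  by apply: integrable_fin_num => //; exact: integrableB.
have iD : L.-integrable setT (fun x : BRd => (f y * ker del (@kfam R d a) ((x : Rd) - y))%:E - (ker del (@kfam R d a) ((x : Rd) - y) * f x)%:E)%E by exact: integrableB.
rewrite -lee_fin fineK; last by rewrite abse_fin_num; exact: integrable_fin_num iD.
apply: le_trans (le_abse_integral _ _ _) _ => //; first exact: measurable_int iD.
apply: (@le_trans _ _ (\int[L]_x (eta%:E * `|(ker del (@kfam R d a) ((x : Rd) - y))%:E|))%E).
  apply: ge0_le_integral => //.
  - by apply: measurableT_comp => //; exact: measurable_int iD.
  - by apply: measurable_funeM; apply: measurableT_comp => //; exact: measurable_int ik.
  move=> x _; rewrite -EFinB !abse_EFin -EFinM lee_fin [X in _ - X]mulrC -mulrBl normrM.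
  have := ker_bound ((x : Rd) - y) d0 bk aB; rewrite indicE.
  case: (boolP (_ \in cube del)) => [/set_mem/cubeP xy _|_]; last first.
    by rewrite mulr0 normr_le0 => /eqP ->; rewrite normr0 !mulr0.
  apply: ler_wpM2r => //; apply: ltW; apply: rf; split => // i j; rewrite (ord1 i) /ball/= .
  by apply: le_lt_trans dr; have := xy j; rewrite !mxE distrC.
rewrite ge0_integralZl_EFin//; [|by apply: measurableT_comp => //; exact: measurable_int ik|exact: ltW].
apply: (@le_trans _ _ (eta%:E * ((2 * B) ^+ d)%:E)%E).
  by apply: lee_wpmul2l; [rewrite lee_fin ltW|exact: integral_ker_ler].
by rewrite -EFinM lee_fin /eta divfK// gt_eqF.
Qed.

End Mollifier.

(** * Finite measures are determined by continuous functions of compact support *)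

Section MeasureEq.
Context (R : realType) (d : nat).
Local Notation Rd := (Rd R d).
Local Notation BRd := (BorelRd R d).
Local Notation L := (@lmeas R d).
Local Notation fmeas := {finite_measure set BRd -> \bar R}.

Lemma pint_cvg (P N : fmeas) (f_ : nat -> BRd -> R) (f : BRd -> R) B :
  (forall n, measurable_fun setT (f_ n)) -> measurable_fun setT f ->
  (forall n x, `|f_ n x| <= B) -> (forall x, f_ n x @[n --> \oo] --> f x) ->
  pint P N (f_ n) @[n --> \oo] --> pint P N f.
Proof.
move=> mf_ mf fB ff; suff H (m : fmeas) : \int[m]_x f_ n x @[n --> \oo] --> \int[m]_x f x.
  by apply: cvgB; exact: H.
have m1 n : measurable_fun setT (EFin \o f_ n) by exact/measurable_EFinP.
have m2 : measurable_fun setT (EFin \o f) by exact/measurable_EFinP.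
have ae1 : {ae m, forall x, [set: BRd] x -> (EFin \o f_ n) x @[n --> \oo] --> (EFin \o f) x}.
  by apply: aeW => x _; apply: cvg_EFin; [exact: nearW|exact: ff].
have B0 : 0 <= B by apply: le_trans (fB 0%N 0); exact: normr_ge0.
have iB : m.-integrable setT (EFin \o (fun _ : BRd => B)).
  by apply: (@integrable_bounded _ _ _ _ _ B) => // x; rewrite ger0_norm.
have dom : {ae m, forall x n, [set: BRd] x -> (`|(EFin \o f_ n) x| <= (EFin \o (fun _ : BRd => B)) x)%E}.
  by apply: aeW => x n _; rewrite /= lee_fin.
have [iff _ cv] := dominated_convergence measurableT m1 m2 ae1 iB dom.
rewrite /Rintegral; apply: fine_cvg.
by rewrite fineK; [exact: cv|exact: integrable_fin_num iff].
Qed.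

(** For [a <= b]: equal to 1 on [[a, b]] and falling linearly to 0 at distance [1/(n+1)], a
    continuous approximation of the indicator from above. *)
Definition trapezoid (n : nat) (a b t : R) : R :=
  Num.max 0 (1 - n.+1%:R * Num.max 0 (Num.max (a - t) (t - b))).

Lemma trapezoid_ge0 n a b t : 0 <= trapezoid n a b t.
Proof. by rewrite le_max lexx. Qed.

Lemma trapezoid_le1 n a b t : trapezoid n a b t <= 1.
Proof. by rewrite ge_max ler01/= gerBl mulr_ge0// le_max lexx. Qed.

Lemma continuous_trapezoid n a b : continuous (trapezoid n a b).
Proof.
have c0 : continuous (cst 0 : R -> R) by exact: cst_continuous.
have h : continuous (fun t : R => Num.max 0 (Num.max (a - t) (t - b))).
  move=> t; apply: (@continuous_max _ _ (cst 0) (fun t => Num.max (a - t) (t - b))); first exact: c0.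
  apply: (@continuous_max _ _ (fun t => a - t) (fun t => t - b)).
    by apply: cvgB; [exact: cvg_cst|exact: cvg_id].
  by apply: cvgB; [exact: cvg_id|exact: cvg_cst].
move=> t; apply: (@continuous_max _ _ (cst 0) (fun t => 1 - n.+1%:R * Num.max 0 (Num.max (a - t) (t - b)))); first exact: c0.
apply: cvgB; first exact: cvg_cst.
by apply: cvgM; [exact: cvg_cst|exact: h].
Qed.

Lemma trapezoid_cvg a b t : trapezoid n a b t @[n --> \oo] --> (\1_(`[a, b]%classic) t : R).
Proof.
rewrite indicE mem_setE in_itv/=; case: (boolP (a <= t <= b)) => [/andP[at_ tb]|tab].
  rewrite (_ : (fun n => _) = cst 1); first exact: cvg_cst.
  apply/funext => n; rewrite /trapezoid [Num.max 0 (Num.max _ _)]max_l.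
    by rewrite mulr0 subr0 max_r.
  by rewrite ge_max; apply/andP; split; lra.
pose r := Num.max 0 (Num.max (a - t) (t - b)).
have r0 : 0 < r.
  rewrite /r !lt_max ltxx/=; move: tab; rewrite negb_and -!ltNge => /orP[h|h].
    by apply/orP; left; lra.
  by apply/orP; right; lra.
apply: cvg_near_cst; near=> n; rewrite /trapezoid max_l// -/r.
rewrite subr_le0 -ler_pdivrMr//.
apply: le_trans (_ : n%:R <= _); last by rewrite ler_nat.
near: n; exact: nbhs_infty_ger.
Unshelve. all: by end_near. Qed.

Lemma csupp_trapezoid n (u v : Rd) : csupp (tens (fun i => trapezoid n (u 0 i) (v 0 i))).
Proof.
exists (1 + \sum_i (`|u 0 i| + `|v 0 i|)) => x /cubeP/existsNP[i /negP].
rewrite -ltNge => xi; rewrite /tens (bigD1 i)//= [trapezoid _ _ _ _](_ : _ = 0) ?mul0r//.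
have : `|u 0 i| + `|v 0 i| <= \sum_i (`|u 0 i| + `|v 0 i|).
  by rewrite (bigD1 i)//= lerDl sumr_ge0// => j _; rewrite addr_ge0.
set S := \sum_i _ in xi *; move=> uv.
rewrite /trapezoid max_l// subr_le0.
have : 1 <= Num.max 0 (Num.max (u 0 i - x 0 i) (x 0 i - v 0 i)).
  rewrite !le_max; apply/orP; right; apply/orP.
  have h1 := ler_norm (v 0 i); have h2 := ler_norm (- u 0 i); rewrite normrN in h2.
  have u0 := normr_ge0 (u 0 i); have v0 := normr_ge0 (v 0 i).
  have [x0|x0] := leP 0 (x 0 i); [right|left].
    by rewrite (ger0_norm x0) in xi; lra.
  by rewrite (ltr0_norm x0) in xi; lra.
have n1 : 1 <= n.+1%:R :> R by rewrite ler1n.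
by move=> h; rewrite -[leLHS]mulr1; apply: ler_pM.
Qed.

(** Closed boxes are stable under intersection and generate the Borel sets, so agreement on boxes
    suffices; the indicator of a box is a bounded limit of products of trapezoids. *)
Lemma measure_eq_csupp (P N : fmeas) :
  (forall f : Rd -> R, continuous f -> csupp f -> pint P N (f : BRd -> R) = 0) ->
  forall A : set BRd, measurable A -> P A = N A.
Proof.
move=> PN.
have boxE (u v : Rd) : P (box u v) = N (box u v).
  pose f n : Rd -> R := tens (fun i => trapezoid n (u 0 i) (v 0 i)).
  have cf n : continuous (f n).
    by apply: continuous_tens => i; exact: continuous_trapezoid.
  have fB n x : `|f n x| <= 1.
    rewrite /f /tens normr_prod [X in _ <= X](_ : 1 = \prod_(i < d) 1); last by rewrite big1_eq.
    by apply: ler_prod => i _; rewrite normr_ge0/= ger0_norm ?trapezoid_le1// trapezoid_ge0.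
  have ff x : f n x @[n --> \oo] --> (\1_(box u v) x : R).
    rewrite box_indic /f /tens.
    have : forall r : seq 'I_d, \prod_(i <- r) trapezoid n (u 0 i) (v 0 i) (x 0 i) @[n --> \oo] -->
       \prod_(i <- r) (\1_(`[u 0 i, v 0 i]%classic) (x 0 i) : R).
      elim => [|i r IH].
        by under eq_cvg do rewrite big_nil; rewrite big_nil; exact: cvg_cst.
      by under eq_cvg do rewrite big_cons; rewrite big_cons; apply: cvgM => //; exact: trapezoid_cvg.
    exact.
  have mb := @measurable_box R d u v.
  have := @pint_cvg P N f (\1_(box u v)) 1 (fun n => continuous_borel (cf n)) _ fB ff.
  move=> /(_ (measurable_indic mb)).
  rewrite (_ : (fun n => pint P N (f n)) = cst 0); last first.
    by apply/funext => n; apply: PN => //; exact: csupp_trapezoid.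
  move/(cvg_unique _ (cvg_cst 0)) => /(_ (@Rhausdorff R)).
  rewrite /pint /Rintegral !integral_indic//= !setIT => /eqP; rewrite eq_sym subr_eq0 => /eqP h.
  by rewrite -[LHS]fineK ?fin_num_measure// h fineK// fin_num_measure.
move=> A mA.
apply: (@measure_unique _ R BRd [set B | exists u v : Rd, B = box u v]
  (fun n => box (const_mx (- n%:R)) (const_mx n%:R))) => //.
- apply/seteqP; split; last first.
    apply: smallest_sub; first exact: sigma_algebra_measurable.
    by move=> _ [u [v ->]]; exact: measurable_box.
  apply: smallest_sub; first exact: smallest_sigma_algebra.
  move=> U oU; rewrite (open_rboxes oU) bigcup_mkcond.
  pose G := [set B : set Rd | exists u v : Rd, B = box u v].
  apply: (@countable_bigcupT_measurable _ (g_sigma_algebraType G)); first exact: countableP.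
  move=> [c n]; case: ifPn => // _; apply: sub_sigma_algebra.
  exists (map_mx ratr c - const_mx n.+1%:R^-1), (map_mx ratr c + const_mx n.+1%:R^-1).
  apply/seteqP; split => x h i; have := h i; rewrite !mxE/= ler_norml; move: (n.+1%:R^-1) (ratr _) => r s.
    by move=> /andP[h1 h2]; apply/andP; split; lra.
  by move=> /andP[h1 h2]; apply/andP; split; lra.
- move=> _ _ [u [v ->]] [u' [v' ->]].
  exists (\row_i Num.max (u 0 i) (u' 0 i)), (\row_i Num.min (v 0 i) (v' 0 i)).
  apply/seteqP; split => x /=.
    by move=> [h1 h2] i; rewrite !mxE ge_max le_min; have /andP[-> ->] := h1 i; have /andP[-> ->] := h2 i.
  by move=> h; split => i; have := h i; rewrite !mxE ge_max le_min => /andP[/andP[h1 h2] /andP[h3 h4]]; apply/andP.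
- by move=> n; exists (const_mx (- n%:R)), (const_mx n%:R).
- exact: bigcup_box.
- by move=> B [u [v ->]]; exact: boxE.
- by move=> n; rewrite ltey_eq fin_num_measure//; exact: measurable_box.
Qed.

End MeasureEq.

Lemma mindex_size0 d : mindex_size (fun _ : 'I_d => 0%N) = 0%N.
Proof. by rewrite /mindex_size big1. Qed.

(** * Summability of the increments and identification of the limits *)

Section Interpolation.
Context (R : realType) (d q k m : nat) (a b A : R -> R) (e : R -> R).
Hypothesis vp : vanishing_pair (2 * m) a b A.
Hypothesis ye : young e.
Local Notation Rd := (Rd R d).
Local Notation BRd := (BorelRd R d).
Local Notation L := (@lmeas R d).
Local Notation fmeas := {finite_measure set BRd -> \bar R}.
Local Notation kf := (@kfam R d a).

Let bk : bump_fam kf. Proof. exact: bump_kfam vp. Qed.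

(** The derivative of order [al] of the mollification of [m1 - m2] at scale [2^-n], with the
    derivative placed on the kernel. *)
Definition smoothing (m1 m2 : fmeas) (al : 'I_d -> nat) (n : nat) (x : BRd) : R :=
  (2 ^- n)^-1 ^+ mindex_size al * mconv (dfam al kf) m1 m2 (2 ^- n) x.

(* [w n] is the [n]-th term of [pi_qkme] with [dist_k] and the Sobolev norm
   replaced by finite upper bounds. *)
Definition approximable (m1 m2 : fmeas) (w : nat -> R) : Prop :=
  forall n, exists (D S : R) (P N : fmeas) (p : Rd -> R),
    [/\ 0 < D /\ 0 < S, diff_density p P N, dual_bound k (madd m1 N) (madd m2 P) D,
        forall ga, (mindex_size ga <= 2 * m + q)%N ->
          exists G, weak_deriv ga p G /\ orlicz_le e (G : BRd -> R) S &
        w n = 2 ^+ (n * (q + k)) * beta_e e (2 ^+ (n * d)) * D + (2 ^+ (2 * n * m))^-1 * S].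

Lemma scale_gt0 n : 0 < 2 ^- n :> R.
Proof. by rewrite invr_gt0 exprn_gt0. Qed.

Lemma scale_le1 n : 2 ^- n <= 1 :> R.
Proof. by rewrite invf_le1 ?exprn_gt0// exprn_ege1// ler1n. Qed.

Lemma approximable_gt0 m1 m2 w n : approximable m1 m2 w -> 0 < w n.
Proof.
move=> /(_ n)[D [S [P [N [p [[D0 S0] _ _ _ ->]]]]]].
have b0 : 0 < beta_e e (2 ^+ (n * d)) by apply: (beta_gt0 ye); exact: exprn_gt0.
apply: addr_gt0; last by rewrite mulr_gt0// invr_gt0 exprn_gt0.
by apply: mulr_gt0 => //; apply: mulr_gt0 => //; exact: exprn_gt0.
Qed.

(** In the increments [ga] exceeds [al] by [2m] derivatives, and [2^(n|al|) 2^(-n|ga|)] is the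
    weight [2^(-2nm)]. In the starting term [n = 0] every power of the scale is 1. *)
Lemma mconv_approx (al ga : 'I_d -> nat) (X : 'I_d -> R -> R) : bump_fam X ->
  (mindex_size al <= q)%N -> (mindex_size ga <= 2 * m + q)%N ->
  exists2 C, 0 < C & forall m1 m2 w n, approximable m1 m2 w ->
    (n = 0%N \/ mindex_size ga = (mindex_size al + 2 * m)%N) ->
    orlicz_le e (fun x => (2 ^- n)^-1 ^+ mindex_size al * mconv (dfam ga X) m1 m2 (2 ^- n) x) (C * w n).
Proof.
move=> bX alq gaq; have [C C0 hC] := conv_step k ye ga bX.
exists C => // m1 m2 w n /(_ n)[D [S [P [N [p [[D0 S0] pPN dD /(_ _ gaq)[G [wd GS]] wE]]]]]] nga.
have := hC _ _ _ _ _ _ _ _ _ (scale_gt0 n) (scale_le1 n) D0 S0 pPN dD wd GS.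
have z0 : 0 < (2 ^- n)^-1 ^+ mindex_size al :> R by rewrite exprn_gt0// invr_gt0 scale_gt0.
move=> /(orlicz_leZ z0) h; apply: (orlicz_leW ye h) => {h}.
rewrite mulrCA ler_pM2l// wE mulrDr !invrK; apply: lerD.
  have b0 : 0 < beta_e e (2 ^+ (n * d)) by apply: (beta_gt0 ye); exact: exprn_gt0.
  rewrite -!exprM; move: (beta_e _ _) b0 => bb b0.
  rewrite !mulrA -exprD; apply: ler_wpM2r; first exact: ltW.
  apply: ler_wpM2r; first exact: ltW.
  by rewrite ler_weXn2l ?ler1n// -mulnDr leq_mul2l leq_add2r alq orbT.
rewrite mulrA; apply: ler_wpM2r; first exact: ltW.
case: nga => [->|->]; first by rewrite muln0 mul0n !expr0 invr1 !expr1n mulr1.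
rewrite exprD mulrA -exprMn divff ?expr1n ?mul1r; last by rewrite gt_eqF// exprn_gt0.
by rewrite exprVn -exprM mulnCA mulnA.
Qed.

Lemma smoothing_step m1 m2 al n x :
  smoothing m1 m2 al n.+1 x - smoothing m1 m2 al n x =
  \sum_(i < d) (2 ^- n)^-1 ^+ mindex_size al *
    mconv (dfam (madd_mi (2 * m) al i) (pre_step a b i)) m1 m2 (2 ^- n) x.
Proof.
have bal := bump_fam_dfam al bk.
have bst i := bump_fam_dfam (madd_mi (2 * m) al i) (bump_pre_step vp i).
set c := (2 ^- n)^-1 ^+ mindex_size al.
pose c' : R := (2 ^- n.+1)^-1 ^+ mindex_size al.
transitivity (pint m1 m2 (fun y : BRd => \sum_(i < d) c *
   ker (2 ^- n) (dfam (madd_mi (2 * m) al i) (pre_step a b i)) (x - y))).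
  rewrite /smoothing -/c -/c'.
  (* The two successive kernels are indexed by a boolean so that their difference is a combination
     covered by [pint_lincomb]. *)
  pose K (j : bool) : BRd -> R := fun y => if j then ker (2 ^- n.+1) (dfam al kf) (x - y)
     else ker (2 ^- n) (dfam al kf) (x - y).
  have iK (m0 : fmeas) j : m0.-integrable setT (EFin \o K j).
    by case: j; apply: integrable_kerl => //; exact: scale_gt0.
  have := @pint_lincomb _ _ _ m1 m2 bool (fun j => if j then c' else - c) K (iK _) (iK _).
  rewrite [X in _ = X]big_bool/= mulNr => <-.
  congr pint; apply/funext => y; rewrite big_bool/= mulNr (ker_step vp) mulr_sumr.
  by [].
rewrite (pint_lincomb (fun=> c))//.
- by move=> i; apply: integrable_kerl => //; exact: scale_gt0.
- by move=> i; apply: integrable_kerl => //; exact: scale_gt0.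
Qed.

Lemma smoothing_orlicz al : (mindex_size al <= q)%N ->
  exists2 C, 0 < C & forall m1 m2 w, approximable m1 m2 w ->
    orlicz_le e (smoothing m1 m2 al 0) (C * w 0%N) /\
    forall n, orlicz_le e (fun x => smoothing m1 m2 al n.+1 x - smoothing m1 m2 al n x) (C * w n).
Proof.
move=> alq; have al2 : (mindex_size al <= 2 * m + q)%N by rewrite (leq_trans alq)// leq_addl.
have [C0 C00 hC0] := mconv_approx bk alq al2.
have gaq i : (mindex_size (madd_mi (2 * m) al i) <= 2 * m + q)%N.
  by rewrite mindex_size_madd addnC leq_add2l.
have step i : exists C, 0 < C /\ forall m1 m2 w n, approximable m1 m2 w ->
    orlicz_le e (fun x => (2 ^- n)^-1 ^+ mindex_size al *
      mconv (dfam (madd_mi (2 * m) al i) (pre_step a b i)) m1 m2 (2 ^- n) x) (C * w n).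
  have [C CC hC] := mconv_approx (bump_pre_step vp i) alq (gaq i).
  exists C; split => // m1 m2 w n ap; apply: hC ap _; right.
  exact: mindex_size_madd.
have [C_ hC_] := choice step.
have S0 : 0 <= \sum_i C_ i by apply: sumr_ge0 => i _; rewrite ltW//; case: (hC_ i).
(* [C0] is for the starting term, the sum for the [d] kernels of an increment, and 1 pays for the
   additional [w n] in [orlicz_le_sum]. *)
exists (C0 + (1 + \sum_i C_ i)); first lra.
move=> m1 m2 w ap; have w0 n : 0 < w n := approximable_gt0 n ap.
split=> [|n].
  apply: (orlicz_leW ye (hC0 m1 m2 w 0%N ap (or_introl erefl))).
  by rewrite ler_pM2r//; lra.
apply: (@orlicz_le_ext _ _ _ (fun x => \sum_(i < d) (2 ^- n)^-1 ^+ mindex_size al *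
    mconv (dfam (madd_mi (2 * m) al i) (pre_step a b i)) m1 m2 (2 ^- n) x)).
  by move=> x; rewrite smoothing_step.
have := orlicz_le_sum ye (index_enum 'I_d) (fun i => (hC_ i).2 m1 m2 w n ap) (w0 n).
move=> h; apply: (orlicz_leW ye h).
by rewrite -mulr_suml mulrDl mulrDl mul1r lerDr mulr_ge0// ltW.
Qed.

Definition smoothing_lim m1 m2 al : Rd -> R := lim_fun (smoothing m1 m2 al).

Lemma smoothing_limP al : (mindex_size al <= q)%N ->
  exists2 C, 0 < C & forall m1 m2 w W, approximable m1 m2 w ->
    (forall n, \sum_(i < n) w i <= W) ->
    [/\ orlicz_le e (smoothing_lim m1 m2 al : BRd -> R) (C * W),
        {ae L, forall x, smoothing m1 m2 al n x @[n --> \oo] --> (smoothing_lim m1 m2 al : BRd -> R) x} &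
        forall phi : Rd -> R, continuous phi -> csupp phi ->
          (\int[L]_x (smoothing m1 m2 al n x * phi x)%:E @[n --> \oo] -->
           \int[L]_x (smoothing_lim m1 m2 al x * phi x)%:E)%E].
Proof.
move=> alq; have [C C0 hC] := smoothing_orlicz alq; exists (C * 2); first by rewrite mulr_gt0.
move=> m1 m2 w W ap wW; have [h0 hS] := hC _ _ _ ap.
(* The increment from [n] to [n+1] is bounded by [w n], so [w 0] is counted for the starting term
   and again for the first increment: hence the factor 2. *)
pose c n := C * w n.-1.
have cW n : \sum_(i < n) c i <= C * 2 * W.
  rewrite -mulr_sumr -mulrA ler_pM2l//.
  have w0 i : 0 <= w i by rewrite ltW//; exact: approximable_gt0 ap.
  case: n => [|n].
    by rewrite big_ord0 mulr_ge0//; apply: le_trans (wW 1%N); rewrite big_ord1.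
  rewrite big_ord_recl/= mulr_natl mulr2n; apply: lerD; last exact: wW.
  by apply: le_trans (wW 1%N); rewrite big_ord1.
split.
- exact: (lim_fun_orlicz_le ye (c := c) h0 hS cW).
- exact: (lim_fun_cvg ye (c := c) h0 hS cW).
- exact: (lim_fun_integral ye (c := c) h0 hS cW).
Qed.

Lemma measurable_smoothing m1 m2 al n : measurable_fun setT (smoothing m1 m2 al n).
Proof.
apply: measurable_funM => //; apply: measurable_mconv; exact: bump_fam_dfam.
Qed.

Lemma smoothing_integral m1 m2 al n (phi : Rd -> R) : continuous phi -> csupp phi ->
  (\int[L]_x (smoothing m1 m2 al n x * phi x)%:E =
   ((2 ^- n)^-1 ^+ mindex_size al * pint m1 m2 (tconv (2 ^- n) (dfam al kf) phi : BRd -> R))%:E)%E.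
Proof.
move=> cphi sphi; have bal := bump_fam_dfam al bk.
rewrite EFinM -(fubini_mconv (scale_gt0 n) bal m1 m2 cphi sphi) -integralZl//.
  by apply: eq_integral => x _; rewrite /smoothing -EFinM mulrA.
have [i1 _] := fubini_mconv1 (scale_gt0 n) bal m1 cphi sphi.
have [i2 _] := fubini_mconv1 (scale_gt0 n) bal m2 cphi sphi.
rewrite (_ : (fun x => _) = (fun x : BRd => ((\int[m1]_y ker (2 ^- n) (dfam al kf) ((x : Rd) - y)) * phi x)%:E
   - ((\int[m2]_y ker (2 ^- n) (dfam al kf) ((x : Rd) - y)) * phi x)%:E)%E).
  exact: integrableB.
by apply/funext => x; rewrite -EFinB /mconv /pint mulrBl.
Qed.

(** Fubini turns both sides into integrals against the measure, and [tconv_cderiv] moves the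
    derivatives from [phi] to the kernel. The identity is exact at each level and passes to the
    limit. *)
Lemma smoothing0_integral m1 m2 al n (phi : Rd -> R) : smooth phi -> csupp phi ->
  (\int[L]_x (smoothing m1 m2 (fun=> 0%N) n x * cderiv al phi x)%:E =
   ((-1) ^+ mindex_size al)%:E * \int[L]_x (smoothing m1 m2 al n x * phi x)%:E)%E.
Proof.
move=> sphi uphi; have d0 := scale_gt0 n; have bal := bump_fam_dfam al bk.
rewrite smoothing_integral; last 2 first.
- by rewrite cderivE; apply: smooth_continuous; exact: smooth_foldr_pderiv.
- by rewrite cderivE; exact: csupp_foldr_pderiv.
have cphi := smooth_continuous sphi.
rewrite smoothing_integral// -EFinM; congr EFin.
rewrite mindex_size0 expr0 mul1r mulrA -(pintZ m1 m2).
- by congr pint; apply/funext => y; exact: tconv_cderiv.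
- exact: measurable_tconv.
- by have [T _ hT] := tconv_bounded d0 bal cphi uphi; exists T.
Qed.

Lemma weak_deriv_smoothing_lim m1 m2 w W al : approximable m1 m2 w ->
  (forall n, \sum_(i < n) w i <= W) -> (mindex_size al <= q)%N ->
  weak_deriv al (smoothing_lim m1 m2 (fun=> 0%N)) (smoothing_lim m1 m2 al).
Proof.
move=> ap wW alq.
have z0 := mindex_size0 d.
have zq : (mindex_size (fun _ : 'I_d => 0%N) <= q)%N by rewrite z0.
have [C C0 /(_ _ _ _ _ ap wW)[hp _ cp]] := smoothing_limP zq.
have [C' C'0 /(_ _ _ _ _ ap wW)[hG _ cG]] := smoothing_limP alq.
split; first exact: orlicz_le_locally_integrable hp.
split; first exact: orlicz_le_locally_integrable hG.
move=> phi /test_function_csupp[sphi uphi].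
have sd : smooth (cderiv al phi) by rewrite cderivE; exact: smooth_foldr_pderiv.
have ud : csupp (cderiv al phi) by rewrite cderivE; exact: csupp_foldr_pderiv.
have [mp _ _] := hp; have [mG _ _] := hG.
have md := continuous_borel (smooth_continuous sd).
have mphi := continuous_borel (smooth_continuous sphi).
have m1' : borel_measurable (fun x => smoothing_lim m1 m2 (fun=> 0%N) x * cderiv al phi x).
  exact: measurable_funM mp md.
have m2' : borel_measurable (fun x => smoothing_lim m1 m2 al x * phi x).
  exact: measurable_funM mG mphi.
rewrite (lintRE m1') (lintRE m2').
have h1 := cp _ (smooth_continuous sd) ud.
have h2 := cG _ (smooth_continuous sphi) uphi.
have h3 : (\int[L]_x (smoothing m1 m2 (fun=> 0%N) n x * cderiv al phi x)%:E @[n --> \oo] -->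
    ((-1) ^+ mindex_size al)%:E * \int[L]_x (smoothing_lim m1 m2 al x * phi x)%:E)%E.
  under eq_fun do rewrite smoothing0_integral//.
  by apply: cvgeZl.
exact: (cvg_unique (@ereal_hausdorff R) h1 h3).
Qed.

(** Unlike [tconv_bounded], a bound uniform in the scale, as dominated convergence requires. *)
Lemma tconv_le (f : Rd -> R) B : continuous f -> csupp f -> (forall x, `|f x| <= B) ->
  exists T, forall n y, `|tconv (2 ^- n) kf f y| <= T.
Proof.
move=> cf sf fB; have [B' B1 aB] := bump_fam_bound bk.
have B'0 : 0 <= B' by exact: le_trans ler01 B1.
have B0 : 0 <= B by apply: le_trans (fB 0); exact: normr_ge0.
exists (B * (2 * B') ^+ d) => n y; have d0 := scale_gt0 n.
have ik := integrable_ker_mul d0 bk y cf sf.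
rewrite /tconv -lee_fin -fine_abse; last exact: integrable_fin_num ik.
rewrite fineK; last by rewrite abse_fin_num; exact: integrable_fin_num ik.
apply: le_trans (le_abse_integral _ _ _) _ => //; first exact: measurable_int ik.
have mk := measurable_kerr (2 ^- n) y bk.
apply: (@le_trans _ _ (\int[L]_x (B%:E * `|(ker (2 ^- n) kf ((x : Rd) - y))%:E|))%E).
  apply: ge0_le_integral => //.
  - by apply: measurableT_comp => //; exact: measurable_int ik.
  - by apply: measurable_funeM; apply: measurableT_comp => //; exact/measurable_EFinP.
  by move=> x _; rewrite !abse_EFin -EFinM lee_fin normrM mulrC ler_wpM2r.
rewrite ge0_integralZl_EFin//; last by apply: measurableT_comp => //; exact/measurable_EFinP.
by rewrite EFinM; apply: lee_wpmul2l; [rewrite lee_fin|exact: integral_ker_ler].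
Qed.

Lemma smoothing_lim_integrable m1 m2 w W : approximable m1 m2 w ->
  (forall n, \sum_(i < n) w i <= W) ->
  L.-integrable setT (EFin \o (smoothing_lim m1 m2 (fun=> 0%N) : BRd -> R)).
Proof.
move=> ap wW.
have z0 := mindex_size0 d.
have zq : (mindex_size (fun _ : 'I_d => 0%N) <= q)%N by rewrite z0.
have [C C0 /(_ _ _ _ _ ap wW)[[mp _ _] cp _]] := smoothing_limP zq.
have [B B1 aB] := bump_fam_bound bk.
have B0 : 0 <= B by exact: le_trans ler01 B1.
apply/integrableP; split; first exact/measurable_EFinP.
apply: (@le_lt_trans _ _ ((2 * B) ^+ d * fine (m1 setT + m2 setT))%:E); last exact: ltry.
pose U n (x : BRd) := smoothing m1 m2 (fun=> 0%N) n x.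
have mU n : measurable_fun setT (fun x => `|(U n x)%:E|%E).
  by apply: measurableT_comp => //; apply/measurable_EFinP; exact: measurable_smoothing.
apply: (@le_trans _ _ (\int[L]_x limn_einf (fun n => `|(U n x)%:E|))%E).
  apply: ae_ge0_le_integral => //.
  - by apply: measurableT_comp => //; exact/measurable_EFinP.
  - by move=> x _; apply: limn_einf_ge => n; exact: abse_ge0.
  - apply: measurableT_comp => //; apply: measurable_fun_limn_esup => n.
    exact: measurableT_comp.
  - apply: (@filterS _ _ (ae_filter_ringOfSetsType _)) cp => x Ux _.
    have : `|(U n x)%:E|%E @[n --> \oo] --> `|(smoothing_lim m1 m2 (fun=> 0%N) x)%:E|%E.
      by apply: cvg_EFin; [exact: nearW|exact: cvg_norm].
    by move/cvg_limn_einf_sup => [-> _].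
apply: le_trans (fatou L measurableT mU _) _ => //.
apply: limn_einf_le => n.
have := mconv_L1 (scale_gt0 n) bk m1 m2 B0 aB; apply: le_trans.
apply: ge0_le_integral => //.
  by apply: measurableT_comp => //; apply/measurable_EFinP; exact: measurable_mconv.
by move=> x _; rewrite /U /smoothing z0 expr0 mul1r.
Qed.

(** The integrals of the mollifications against a continuous [f] of compact support have two limits:
    the integral of [f] against the limit function, and, by the approximate identity, that against
    [mu]. Their equality extends to Borel sets by comparing the positive measures [m1 + N] and
    [m2 + P]. *)
Lemma is_density_smoothing_lim mu m1 m2 w W : charge_diff mu m1 m2 -> approximable m1 m2 w ->
  (forall n, \sum_(i < n) w i <= W) ->
  is_density mu (smoothing_lim m1 m2 (fun=> 0%N)).
Proof.
move=> dmu ap wW; have ip := smoothing_lim_integrable ap wW.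
have z0 := mindex_size0 d.
have zq : (mindex_size (fun _ : 'I_d => 0%N) <= q)%N by rewrite z0.
have [C C0 /(_ _ _ _ _ ap wW)[_ _ cp]] := smoothing_limP zq.
split; first exact/lebesgue_integrableP.
have [P [N dPN]] := integrable_diff_density ip.
have Cc (f : Rd -> R) : continuous f -> csupp f -> pint (madd m1 N) (madd m2 P) (f : BRd -> R) = 0.
  move=> cf sf; have mf := continuous_borel cf.
  have [M [B [M0 B0 fB]]] := csupp_bounded cf sf.
  have fB' x : `|f x| <= B.
    by apply: le_trans (fB x) _; rewrite ler_piMr// indicE; case: (_ \in _).
  rewrite pint_madd//; last by exists B.
  rewrite dPN//; last by exists B.
  have [T hT] := tconv_le cf sf fB'.
  have h1 := cp f cf sf.
  have h2 : (\int[L]_x (smoothing m1 m2 (fun=> 0%N) n x * f x)%:E @[n --> \oo] -->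
     (pint m1 m2 (f : BRd -> R))%:E)%E.
    under eq_fun do rewrite smoothing_integral// z0 expr0 mul1r.
    apply: cvg_EFin; first exact: nearW.
    apply: (@pint_cvg _ _ m1 m2 _ _ T) => //.
    - by move=> n; apply: measurable_tconv.
    - by move=> x; exact: (tconv_cvg vp).
  by rewrite (cvg_unique (@ereal_hausdorff R) h1 h2)/= subrr.
move=> E mE; have eqE : (m1 E + N E = m2 E + P E)%E := measure_eq_csupp Cc mE; rewrite dmu// (diff_density_set ip dPN mE).
have F (m0 : fmeas) : m0 E = (fine (m0 E))%:E.
  by rewrite fineK//; exact: fin_num_measure.
move: eqE; rewrite (F m1) (F m2) (F P) (F N) -!EFinD => -[h].
by congr EFin; lra.
Qed.

End Interpolation.

(** * From the functional [pi] to the approximation hypothesis *)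

Section Main.
Context (R : realType) (d q k m : nat) (e : R -> R).
Hypothesis ye : young e.
Local Notation Rd := (Rd R d).
Local Notation BRd := (BorelRd R d).
Local Notation fmeas := {finite_measure set BRd -> \bar R}.

Lemma sobolev_wnorm_ge0 s l (f : Rd -> R) : (0 <= sobolev_wnorm s l e f)%E.
Proof.
apply: le_ereal_inf_tmp => _ [G [_ ->]].
by apply: sume_ge0 => g _; apply: sume_ge0 => a _; exact: orlicz_norm_ge0.
Qed.

Lemma monom0 (g : 'I_d -> nat) (x : Rd) : mindex_size g = 0%N -> monom g x = 1.
Proof.
move=> /eqP; rewrite sum_nat_eq0 => /forallP g0; rewrite /monom big1// => i _.
by have /implyP/(_ isT)/eqP -> := g0 i.
Qed.

(** A strict bound on the infimum yields a family of weak derivatives; the summand with trivial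
    monomial and derivative [ga] is at most the whole nonnegative sum. *)
Lemma sobolev_wnorm_weak_deriv s l (f : Rd -> R) (S : R) ga :
  (sobolev_wnorm s l e f < S%:E)%E -> (mindex_size ga <= s)%N ->
  exists G, weak_deriv ga f G /\ orlicz_le e (G : BRd -> R) S.
Proof.
move=> /ereal_inf_lt[_ [G [wG ->]] GS] gas.
pose a : {ffun 'I_d -> 'I_s.+1} := [ffun i => inord (ga i)].
have aE : mi_of a = ga.
  apply/funext => i; rewrite /mi_of ffunE inordK// ltnS; apply: leq_trans gas.
  by rewrite /mindex_size (bigD1 i)//= leq_addr.
have as_ : (mindex_size (mi_of a) <= s)%N by rewrite aE.
have wd := wG a as_; exists (G a); split; first by rewrite -aE.
apply: norm_orlicz_le => //; first by case: wd => _ [[]].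
apply: le_lt_trans GS.
pose g0 : {ffun 'I_d -> 'I_l.+1} := [ffun=> ord0].
have g00 := mindex_size_ord0 d l.
rewrite (bigD1 g0)/= ?g00// (bigD1 a)//=.
rewrite (_ : (fun x => monom (mi_of g0) x * G a x) = G a); last first.
  by apply/funext => x; rewrite monom0// mul1r.
rewrite -addeA -[X in (X <= _)%E]adde0; apply: leeD => //; apply: adde_ge0.
  by apply: sume_ge0 => b _; exact: orlicz_norm_ge0.
by apply: sume_ge0 => g _; apply: sume_ge0 => b _; exact: orlicz_norm_ge0.
Qed.

Lemma sum_geometric_le1 n : \sum_(i < n) 2 ^- i.+1 <= 1 :> R.
Proof.
suff -> : \sum_(i < n) 2 ^- i.+1 = 1 - 2 ^- n :> R.
  by rewrite gerBl invr_ge0 exprn_ge0.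
elim: n => [|n IH]; first by rewrite big_ord0 expr0 invr1 subrr.
by rewrite big_ord_recr/= IH exprS; field.
Qed.

Lemma pi_qkme_ge0 (mu : signed_measure R d) mu_ (p_ : nat -> Rd -> R) :
  (0 <= pi_qkme q k m e mu mu_ p_)%E.
Proof.
apply: adde_ge0; apply: nneseries_ge0 => n _ _; apply: mule_ge0.
- rewrite lee_fin mulr_ge0 ?exprn_ge0// ltW//; apply: (beta_gt0 ye); exact: exprn_gt0.
- exact: dist_k_ge0.
- by rewrite lee_fin invr_ge0 exprn_ge0.
- exact: sobolev_wnorm_ge0.
Qed.

(** Positive weights make each distance and norm finite once [pi] is. They are then enlarged
    slightly, since [approximable] asks for positive bounds and the Sobolev norm must be bounded
    strictly. *)
Lemma approximable_pi (mu : signed_measure R d) (m1 m2 : fmeas)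
    (mu_ : nat -> signed_measure R d) (p_ : nat -> Rd -> R) (eps : R) :
  charge_diff mu m1 m2 -> (forall n, is_density (mu_ n) (p_ n)) -> 0 < eps ->
  (pi_qkme q k m e mu mu_ p_ < +oo)%E ->
  exists w, approximable q k m e m1 m2 w /\
    forall n, \sum_(i < n) w i <= fine (pi_qkme q k m e mu mu_ p_) + eps.
Proof.
move=> dmu dens eps0 pioo.
pose al n : R := 2 ^+ (n * (q + k)) * beta_e e (2 ^+ (n * d)).
pose be n : R := (2 ^+ (2 * n * m))^-1.
have al0 n : 0 < al n.
  by apply: mulr_gt0; [exact: exprn_gt0|apply: (beta_gt0 ye); exact: exprn_gt0].
have be0 n : 0 < be n by rewrite invr_gt0 exprn_gt0.
pose D n := dist_k k mu (mu_ n).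
pose S n := sobolev_wnorm (2 * m + q) (2 * m) e (p_ n).
have D0 n : (0 <= D n)%E by exact: dist_k_ge0.
have S0 n : (0 <= S n)%E by exact: sobolev_wnorm_ge0.
have aD0 n : (0 <= (al n)%:E * D n)%E by rewrite mule_ge0// lee_fin ltW.
have bS0 n : (0 <= (be n)%:E * S n)%E by rewrite mule_ge0// lee_fin ltW.
have piE : pi_qkme q k m e mu mu_ p_ =
  (\sum_(0 <= n <oo) (al n)%:E * D n + \sum_(0 <= n <oo) (be n)%:E * S n)%E by [].
have sD0 : (0 <= \sum_(0 <= n <oo) (al n)%:E * D n)%E by apply: nneseries_ge0.
have sS0 : (0 <= \sum_(0 <= n <oo) (be n)%:E * S n)%E by apply: nneseries_ge0.
have sDle n : (\sum_(0 <= i < n) (al i)%:E * D i <= \sum_(0 <= n <oo) (al n)%:E * D n)%E.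
  by apply: nneseries_lim_ge => i _ _.
have sSle n : (\sum_(0 <= i < n) (be i)%:E * S i <= \sum_(0 <= n <oo) (be n)%:E * S n)%E.
  by apply: nneseries_lim_ge => i _ _.
have term (c : nat -> R) (X : nat -> \bar R) n : (forall i, 0 < c i) -> (forall i, 0 <= X i)%E ->
    (\sum_(0 <= i < n.+1) (c i)%:E * X i < +oo)%E -> X n \is a fin_num.
  move=> c0 X0; rewrite big_nat_recr//= => h; rewrite ge0_fin_numE// ltey; apply/eqP => Xn.
  move: h; rewrite Xn gt0_muley ?lte_fin// addey// gt_eqF//.
  have s0 : (0 <= \sum_(0 <= i < n) (c i)%:E * X i)%E.
    by apply: sume_ge0 => i _; rewrite mule_ge0// lee_fin ltW.
  by apply: lt_le_trans s0; exact: ltNyr.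
have sDoo : (\sum_(0 <= n <oo) (al n)%:E * D n < +oo)%E.
  by apply: le_lt_trans pioo; rewrite piE leeDl.
have sSoo : (\sum_(0 <= n <oo) (be n)%:E * S n < +oo)%E.
  by apply: le_lt_trans pioo; rewrite piE leeDr.
have Dfin n : D n \is a fin_num by apply: (term al) => //; apply: le_lt_trans (sDle _) sDoo.
have Sfin n : S n \is a fin_num by apply: (term be) => //; apply: le_lt_trans (sSle _) sSoo.
(* Spent once on the distance and once on the norm at each level, for a total of at most [eps]. *)
pose eta n : R := eps / 2 * 2 ^- n.+1.
have eta0 n : 0 < eta n by rewrite mulr_gt0 ?divr_gt0// invr_gt0 exprn_gt0.
pose D' n := fine (D n) + eta n / al n.
pose S' n := fine (S n) + eta n / be n.
exists (fun n => al n * D' n + be n * S' n); split.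
  move=> n; have [P [N [dPN pPN]]] := density_diff (dens n).
  exists (D' n), (S' n), P, N, (p_ n); split => //.
  - by split; apply: ltr_wpDl; rewrite ?divr_gt0// fine_ge0.
  - apply: (dual_bound_dist dmu dPN); rewrite -/(D n) -(fineK (Dfin n)) lee_fin.
    by rewrite lerDl ltW// divr_gt0.
  - move=> ga gaq; apply: (@sobolev_wnorm_weak_deriv (2 * m + q) (2 * m) _ _ _ _ gaq).
    by rewrite -/(S n) -(fineK (Sfin n)) lte_fin ltrDl divr_gt0.
move=> n; have wE i : al i * D' i + be i * S' i =
    fine ((al i)%:E * D i) + fine ((be i)%:E * S i) + eps * 2 ^- i.+1.
  have ea : al i * (eta i / al i) = eta i by rewrite mulrC divfK// gt_eqF.
  have eb : be i * (eta i / be i) = eta i by rewrite mulrC divfK// gt_eqF.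
  have <- : eta i + eta i = eps * 2 ^- i.+1 by rewrite /eta -mulrDl -splitr.
  by rewrite !fineM//= /D' /S' !mulrDr ea eb; ring.
under eq_bigr do rewrite wE.
rewrite big_split/= -mulr_sumr; apply: lerD; last first.
  by rewrite -[leRHS]mulr1 ler_pM2l//; exact: sum_geometric_le1.
rewrite big_split/= piE fineD; last 2 first.
- by rewrite ge0_fin_numE.
- by rewrite ge0_fin_numE.
apply: lerD.
  rewrite -lee_fin fineK ?ge0_fin_numE//; apply: le_trans (sDle n).
  by rewrite big_mkord -sumEFin; apply: lee_sum => i _; rewrite fineK// fin_numM.
rewrite -lee_fin fineK ?ge0_fin_numE//; apply: le_trans (sSle n).
by rewrite big_mkord -sumEFin; apply: lee_sum => i _; rewrite fineK// fin_numM.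
Qed.

End Main.

Theorem mainTheorem1 (R : realType) (d q k m : nat) (e : R -> R) :
  (0 < d)%N -> (0 < m)%N -> young_E e ->
  exists C : R, forall mu : signed_measure R d,
    S_qkme q k m e mu ->
    exists p : Rd R d -> R,
      [/\ is_density mu p,
          (sobolev_norm q e p < +oo)%E &
          (sobolev_norm q e p <= C%:E * rho_qkme q k m e mu)%E].
Proof.
move=> _ m0 [ye _ _].
have [a [b [A vp]]] := @vanishing_pair_exists R (2 * m).-1.
rewrite prednK ?muln_gt0// in vp.
(* The constants are fixed before [mu] is introduced, hence depend only on the parameters. Indices
   of order above [q] get the default value 1. *)
have lims (al : {ffun 'I_d -> 'I_q.+1}) : exists C, 0 < C /\ ((mindex_size (mi_of al) <= q)%N ->
    forall (m1 m2 : {finite_measure set (BorelRd R d) -> \bar R}) w W, approximable q k m e m1 m2 w ->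
      (forall n, \sum_(i < n) w i <= W) ->
      (orlicz_norm e (smoothing_lim a m1 m2 (mi_of al)) <= (C * W)%:E)%E).
  have [alq|alq] := boolP (mindex_size (mi_of al) <= q)%N; last by exists 1.
  have [C C0 hC] := smoothing_limP k vp ye alq; exists C; split => // _ m1 m2 w W ap wW.
  by have [h _ _] := hC _ _ _ _ ap wW; exact: orlicz_le_norm h.
have [C_ hC_] := choice lims.
pose C := 1 + \sum_al C_ al.
have C0 : 0 < C by apply: ltr_pwDl => //; apply: sumr_ge0 => al _; rewrite ltW//; case: (hC_ al).
exists C => mu Smu.
have [m1 [m2 dmu]] := jordan_charge_diff mu.
(* [p] is chosen before any approximating sequence, so [bound_pi] holds for all sequences with this
   [p] and yields the bound by the infimum. *)
pose p := smoothing_lim a m1 m2 (fun=> 0%N).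
have bound w W : approximable q k m e m1 m2 w -> (forall n, \sum_(i < n) w i <= W) ->
    (sobolev_norm q e p <= (C * W)%:E)%E.
  move=> ap wW; have W0 : 0 <= W by apply: le_trans (wW 0%N); rewrite big_ord0.
  pose G (al : {ffun 'I_d -> 'I_q.+1}) := smoothing_lim a m1 m2 (mi_of al).
  apply: (@le_trans _ _ (\sum_(g : {ffun 'I_d -> 'I_1} | (mindex_size (mi_of g) <= 0)%N)
     \sum_(al : {ffun 'I_d -> 'I_q.+1} | (mindex_size (mi_of al) <= q)%N)
       orlicz_norm e (fun x => (monom (mi_of g) x * G al x)%R))%E).
    apply: ereal_inf_lbound; exists G; split => // al alq.
    exact: (weak_deriv_smoothing_lim vp ye ap wW alq).
  pose g0 : {ffun 'I_d -> 'I_1} := [ffun=> ord0].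
  have g00 := mindex_size_ord0 d 0.
  rewrite (big_pred1 g0); last first.
    by move=> g; have -> : g = g0; [apply/ffunP => i; rewrite ffunE ord1|rewrite g00/= eqxx].
  apply: (@le_trans _ _ (\sum_(al : {ffun 'I_d -> 'I_q.+1} | (mindex_size (mi_of al) <= q)%N) (C_ al * W)%:E)%E).
    apply: lee_sum => al alq.
    rewrite (_ : (fun x => monom (mi_of g0) x * G al x) = G al); last first.
      by apply/funext => x; rewrite monom0// mul1r.
    exact: (hC_ al).2 alq m1 m2 w W ap wW.
  rewrite sumEFin lee_fin -mulr_suml; apply: ler_wpM2r => //.
  apply: (@le_trans _ _ (\sum_al C_ al)); last by rewrite lerDr.
  by rewrite big_mkcond/=; apply: ler_sum => al _; case: ifP => // _; rewrite ltW//; case: (hC_ al).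
have bound_pi mu_ p_ : (forall n, is_density (mu_ n) (p_ n)) ->
    (sobolev_norm q e p <= C%:E * pi_qkme q k m e mu mu_ p_)%E.
  move=> dens; have [pioo|] := ltP (pi_qkme q k m e mu mu_ p_) +oo%E; last first.
    by rewrite leye_eq => /eqP ->; rewrite gt0_muley ?lte_fin// leey.
  have pi0 : (0 <= pi_qkme q k m e mu mu_ p_)%E by exact: pi_qkme_ge0.
  (* The slack of [approximable_pi] is removed by letting it tend to zero; it is taken as [eps / C]
     to absorb the constant. *)
  apply/lee_addgt0Pr => eps eps0.
  have ep0 : 0 < eps / C by rewrite divr_gt0.
  have [w [ap wW]] := approximable_pi ye dmu dens ep0 pioo.
  apply: le_trans (bound _ _ ap wW) _.
  rewrite mulrDr [C * (eps / C)]mulrC divfK ?gt_eqF// EFinD EFinM.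
  by rewrite (fineK (_ : _ \is a fin_num)) ?ge0_fin_numE.
have bound_rho : (sobolev_norm q e p <= C%:E * rho_qkme q k m e mu)%E.
  rewrite -lee_pdivrMl//; apply: le_ereal_inf_tmp => _ [mu_ [p_ [dens ->]]].
  by rewrite lee_pdivrMl//; exact: bound_pi.
exists p; split => //.
- have [_ [mu_ [p_ [dens ->]]] pioo] := ereal_inf_lt Smu.
  have [w [ap wW]] := approximable_pi ye dmu dens ltr01 pioo.
  exact: (is_density_smoothing_lim vp ye dmu ap wW).
- by apply: le_lt_trans bound_rho _; rewrite lte_mul_pinfty// lee_fin ltW.
Qed.
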